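(* Let $(M,g)$ be an oriented connected Riemannian $4$-manifold, and let $\mathbb J_1$ be the almost complex structure on its generalized twistor space $\mathcal Z(M,g)$ defined in the context. Then $\mathbb J_1$ is semi-integrable on $\mathcal Z^{+-}(M,g)$ if and only if $g$ is Einstein; likewise, $\mathbb J_1$ is semi-integrable on $\mathcal Z^{-+}(M,g)$ if and only if $g$ is Einstein.
   Context: Put $\mathbb T M=TM\oplus T^*M$, with the pseudo-metric $\langle X+\xi,Y+\eta\rangle=\tfrac12(\xi(Y)+\eta(X))$. The metric $g$ extends to a metric $g$ on $\mathbb T M$ (dual metric on $T^*M$, with $TM\perp T^*M$). The generalized twistor space is the bundle $\pi:\mathcal Z(M,g)\to M$ whose fibre over $m$ is the set of endomorphisms $u$ of $\mathbb T_mM$ that are orthogonal for both $\langle\cdot,\cdot\rangle$ and $g$ and satisfy $u^2=-\mathrm{Id}$. Let $C^\pm=\{X\pm g(X,\cdot): X\in TM\}\subset\mathbb T M$, so $\mathbb T M=C^+\oplus C^-$; the projections $C^\pm\to TM$ are isomorphisms. Each $u\in\mathcal Z(M,g)$ preserves $C^\pm$, and via these isomorphisms $u=\mathrm{diag}(u_1,u_2)$ in $C^+\oplus C^-$, where $u_1,u_2$ are $g$-orthogonal endomorphisms of $T_mM$ with $u_i^2=-\mathrm{Id}$. Let $Z^+(M,g)$ (resp. $Z^-(M,g)$) be the bundle of $g$-orthogonal $v\in \mathrm{End}(TM)$ with $v^2=-\mathrm{Id}$ such that for all $X,Y$ the family $(X,vX,Y,vY)$ is linearly dependent or positively (resp.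 negatively) oriented. For signs $\epsilon_1,\epsilon_2\in\{+,-\}$, $\mathcal Z^{\epsilon_1\epsilon_2}(M,g)$ is the set of $u=\mathrm{diag}(u_1,u_2)\in\mathcal Z(M,g)$ with $u_1\in Z^{\epsilon_1}(M,g)$ and $u_2\in Z^{\epsilon_2}(M,g)$. Let $\mathcal V=\ker d\pi$ and let $\mathcal H$ be the horizontal distribution induced on $\mathcal Z(M,g)$ by the Levi-Civita connection, so $T\mathcal Z(M,g)=\mathcal H\oplus\mathcal V$. The almost complex structure $\mathbb J_1$ on $\mathcal Z(M,g)$ is the direct sum, at $u=\mathrm{diag}(u_1,u_2)$ over $m$, of the action of $u_1$ on $\mathcal H_u\cong T_mM$ (via $d\pi$) and of the natural complex structure $A\mapsto u\circ A$ on $\mathcal V_u\subset\mathrm{End}(\mathbb T_mM)$. Semi-integrability. Let $Z(C^-,g)=\{v\in\mathrm{End}(C^-): v^2=-\mathrm{Id},\ v \text{ orthogonal for } g|_{C^-}\}$ and let $pr_-:\mathcal Z(M,g)\to Z(C^-,g)$, $u\mapsto u|_{C^-}=u_2$. An almost complex structure on $\mathcal Z(M,g)$ (or on one of the components $\mathcal Z^{\epsilon_1\epsilon_2}(M,g)$) is semi-integrable if the projection of its Nijenhuis tensor to $Z(C^-,g)$ (under the differential of $pr_-$) vanishes. $g$ is Einstein if its trace-free Ricci tensor vanishes. *)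

(* Defs.v *)
From HB Require Import structures.
From mathcomp Require Import all_boot all_order all_algebra.
From mathcomp Require Import all_classical all_reals all_analysis.

Set Implicit Arguments.
Unset Strict Implicit.
Unset Printing Implicit Defensive.

Import Order.TTheory GRing.Theory Num.Theory.
Import numFieldTopology.Exports numFieldNormedType.Exports.

Local Open Scope classical_set_scope.
Local Open Scope ring_scope.

(* Conventions.  Vectors are columns and matrices act on the left.  Every
   geometric object on a manifold is given by its components in the charts of
   an atlas.  Over a chart with coordinates x, T_mM is 'cV_4 and T_mM + T*_mM
   is 'cV_(4 + 4), a pair X + xi being col_mx X xi. *)

Section Calculus.
Variables (R : realType) (E F : normedModType R).

(* C^oo on a set U, meant for U open: every iterated directional derivative of
   f exists and is Frechet differentiable at each point of U. *)
Definition iter_derive (vs : seq E) (f : E -> F) : E -> F :=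
  foldr (fun v h => 'D_v h) f vs.

Definition smooth_on (U : set E) (f : E -> F) : Prop :=
  forall (vs : seq E) (x : E), U x -> differentiable (iter_derive vs f) x.

(* Velocities at p of the curves that stay in S: if S is an embedded
   submanifold, this is its tangent space at p. *)
Definition tangent (S : set E) (p v : E) : Prop :=
  exists c : R -> E,
    [/\ c 0 = p, \forall t \near (0 : R), S (c t) & is_derive (0 : R) 1 c v].

End Calculus.

Section VectorFields.
Variables (R : realType) (E : normedModType R).

(* A smooth vector field on the part of the submanifold S that lies in the open
   set W, given by an extension to W.  At the points of S, the brackets below
   do not depend on the extension, since they differentiate only along S. *)
Definition vector_field (S W : set E) (A : E -> E) : Prop :=
  smooth_on W A /\ forall p, (S `&` W) p -> tangent S p (A p).

Definition lie_bracket (A B : E -> E) (p : E) : E := 'D_(A p) B p - 'D_(B p) A p.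

Definition nijenhuis (J : E -> E -> E) (A B : E -> E) (p : E) : E :=
  let JA q := J q (A q) in
  let JB q := J q (B q) in
  lie_bracket JA JB p - J p (lie_bracket JA B p) - J p (lie_bracket A JB p)
  - lie_bracket A B p.

End VectorFields.

Section Manifold.
Variable R : realType.

Definition ebase (k : 'I_4) : 'cV[R]_4 := delta_mx k 0.

Definition jac (f : 'cV[R]_4 -> 'cV[R]_4) (x : 'cV[R]_4) : 'M[R]_4 :=
  \matrix_(k, l) ('D_(ebase l) f x) k 0.

(* A smooth structure together with an orientation: the charts are the positive
   ones. *)
Record oriented_atlas (M : topologicalType) := OrientedAtlas {
  idx : Type;
  dom : idx -> set M;
  chart : idx -> M -> 'cV[R]_4;
  param : idx -> 'cV[R]_4 -> M;
  codom_chart := fun i => chart i @` dom i;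
  transition := fun i j x => chart j (param i x);
  overlap := fun i j => chart i @` (dom i `&` dom j);
  dom_open : forall i, open (dom i);
  codom_open : forall i, open (codom_chart i);
  chartK : forall i m, dom i m -> param i (chart i m) = m;
  chart_continuous : forall i, {within dom i, continuous (chart i)};
  param_continuous : forall i, {within codom_chart i, continuous (param i)};
  atlas_cover : forall m, exists i, dom i m;
  transition_smooth : forall i j, smooth_on (overlap i j) (transition i j);
  transition_positive : forall i j x,
    overlap i j x -> 0 < \det (jac (transition i j) x)
}.

Variables (M : topologicalType) (A : oriented_atlas M).

Definition bilin n (B : 'M[R]_n) (a b : 'cV[R]_n) : R := (a^T *m B *m b) 0 0.

Record riemannian_metric := RiemannianMetric {
  gmx : idx A -> 'cV[R]_4 -> 'M[R]_4;
  gmx_smooth : forall i, smooth_on (codom_chart i) (gmx i);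
  gmx_sym : forall i x, codom_chart i x -> (gmx i x)^T = gmx i x;
  gmx_pos : forall i x X, codom_chart i x -> X != 0 -> 0 < bilin (gmx i x) X X;
  gmx_tensor : forall i j x, overlap i j x ->
    gmx i x = (jac (transition i j) x)^T *m gmx j (transition i j x)
              *m jac (transition i j) x
}.

End Manifold.

(* The Levi-Civita connection and its curvature in a chart where the metric has
   matrix g x at the point of coordinates x. *)
Section LeviCivita.
Variables (R : realType) (g : 'cV[R]_4 -> 'M[R]_4).

Definition partial_g (l : 'I_4) (x : 'cV[R]_4) : 'M[R]_4 := 'D_(ebase R l) g x.

(* christoffel i x k j is Gamma^k_ij, so that nabla_i Y = d_i Y + Gamma_i Y. *)
Definition christoffel (i : 'I_4) (x : 'cV[R]_4) : 'M[R]_4 :=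
  \matrix_(k, j) (2^-1 * \sum_l invmx (g x) k l *
    (partial_g i x j l + partial_g j x i l - partial_g l x i j)).

Definition connection_form (x X : 'cV[R]_4) : 'M[R]_4 :=
  \sum_i X i 0 *: christoffel i x.

(* Matrix of R(d_i, d_j) =
   nabla_i nabla_j - nabla_j nabla_i. *)
Definition curvature (i j : 'I_4) (x : 'cV[R]_4) : 'M[R]_4 :=
  'D_(ebase R i) (christoffel j) x - 'D_(ebase R j) (christoffel i) x
  + christoffel i x *m christoffel j x - christoffel j x *m christoffel i x.

(* Ric(Y, Z) is the trace of X |-> R(X, Y)Z. *)
Definition ricci (x : 'cV[R]_4) : 'M[R]_4 :=
  \matrix_(j, k) \sum_i curvature i j x i k.

Definition scalar_curvature (x : 'cV[R]_4) : R := \tr (invmx (g x) *m ricci x).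

Definition tracefree_ricci (x : 'cV[R]_4) : 'M[R]_4 :=
  ricci x - (scalar_curvature x / 4) *: g x.

End LeviCivita.

Definition einstein (R : realType) (M : topologicalType)
    (A : oriented_atlas R M) (g : riemannian_metric A) : Prop :=
  forall i x, codom_chart i x -> tracefree_ricci (gmx g i) x = 0.

Inductive sign := Plus | Minus.

(* Linear algebra in one fibre; g is the matrix of the metric of T_mM. *)
Section Fibre.
Variable R : realType.

Definition orthogonal_for n (B : 'cV[R]_n -> 'cV[R]_n -> R) (u : 'M[R]_n) : Prop :=
  forall a b, B (u *m a) (u *m b) = B a b.

Definition pairing (a b : 'cV[R]_(4 + 4)) : R :=
  2^-1 * (((dsubmx a)^T *m usubmx b) 0 0 + ((dsubmx b)^T *m usubmx a) 0 0).

Variable g : 'M[R]_4.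

Definition metric_TT (a b : 'cV[R]_(4 + 4)) : R :=
  bilin g (usubmx a) (usubmx b) + bilin (invmx g) (dsubmx a) (dsubmx b).

Definition twistor_fibre : set 'M[R]_(4 + 4) :=
  [set u | [/\ orthogonal_for pairing u, orthogonal_for metric_TT u
             & u *m u = - 1%:M]].

Definition sg (e : sign) : R := if e is Plus then 1 else -1.

(* Inverse of the projection C^e -> TM, namely X |-> X + e g(X, .). *)
Definition liftC (e : sign) (X : 'cV[R]_4) : 'cV[R]_(4 + 4) :=
  col_mx X (sg e *: (g *m X)).

(* The endomorphism of T_mM induced by the action of u on C^e: its l-th column
   is the projection to T_mM of u (liftC e d_l). *)
Definition blockC (e : sign) (u : 'M[R]_(4 + 4)) : 'M[R]_4 :=
  \matrix_(k, l) (usubmx (u *m liftC e (ebase R l))) k 0.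

Definition family4 (X Y Z W : 'cV[R]_4) : 'M[R]_4 :=
  row_mx (row_mx X Y) (row_mx Z W).

Definition Zfibre (e : sign) : set 'M[R]_4 :=
  [set v | [/\ orthogonal_for (bilin g) v, v *m v = - 1%:M
    & forall X Y : 'cV[R]_4,
        let F := family4 X (v *m X) Y (v *m Y) in
        (\rank F < 4)%N \/ 0 < sg e * \det F]].

Definition twistor_fibre_component (e1 e2 : sign) : set 'M[R]_(4 + 4) :=
  [set u | [/\ twistor_fibre u, Zfibre e1 (blockC Plus u)
             & Zfibre e2 (blockC Minus u)]].

End Fibre.

Definition twistor_coord (R : realType) : normedModType R :=
  ('cV[R]_4 * 'M[R]_(4 + 4))%type.

(* The generalized twistor space over a chart, as a subset of the vector space
   of pairs (x, u), x being the coordinates of the base point and u the matrix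
   of the endomorphism. *)
Section TwistorSpace.
Variables (R : realType) (M : topologicalType) (A : oriented_atlas R M).
Variables (g : riemannian_metric A) (i : idx A).

Local Notation E := (twistor_coord R).

Definition twistor_component (e1 e2 : sign) : set E :=
  [set p | codom_chart i p.1
           /\ twistor_fibre_component (gmx g i p.1) e1 e2 p.2].

(* Connection form on TM + T*M: the connection on T*M is dual to that on TM. *)
Definition connection_form_TT (x X : 'cV[R]_4) : 'M[R]_(4 + 4) :=
  let w := connection_form (gmx g i) x X in block_mx w 0 0 (- w^T).

Definition ad_connection (p : E) (X : 'cV[R]_4) : 'M[R]_(4 + 4) :=
  connection_form_TT p.1 X *m p.2 - p.2 *m connection_form_TT p.1 X.

(* The horizontal lift solves nabla_X u = du(X) + [connection_form_TT X, u] = 0. *)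
Definition hlift (p : E) (X : 'cV[R]_4) : E := (X, - ad_connection p X).

Definition vpart (p v : E) : 'M[R]_(4 + 4) := (v - hlift p v.1).2.

(* J_1 at p = (x, u) on a tangent vector v whose projection to the base is v.1;
   blockC Plus u is the matrix of u_1. *)
Definition J1 (p v : E) : E :=
  hlift p (blockC (gmx g i p.1) Plus p.2 *m v.1) + (0, p.2 *m vpart p v).

(* Z(C^-, g) over the chart consists of pairs (x, v), the endomorphism v of C^-
   being read on TM through the projection C^- -> TM. *)
Definition pr_minus (p : E) : 'cV[R]_4 * 'M[R]_4 :=
  (p.1, blockC (gmx g i p.1) Minus p.2).

End TwistorSpace.

(* J i is the almost complex structure over the chart i.  The image of its
   Nijenhuis tensor under the differential of pr_minus vanishes on Z^{e1 e2};
   this is tested on all local vector fields. *)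
Definition semi_integrable (R : realType) (M : topologicalType)
    (A : oriented_atlas R M) (g : riemannian_metric A)
    (J : idx A -> twistor_coord R -> twistor_coord R -> twistor_coord R)
    (e1 e2 : sign) : Prop :=
  forall (i : idx A) (W : set (twistor_coord R))
      (V1 V2 : twistor_coord R -> twistor_coord R),
    let Z := twistor_component g i e1 e2 in
    open W -> vector_field Z W V1 -> vector_field Z W V2 ->
    forall p, (Z `&` W) p ->
      'D_(nijenhuis (J i) V1 V2 p) (pr_minus g i) p = 0.

(* Main.v *)
From HB Require Import structures.
From mathcomp Require Import all_boot all_order all_algebra.
From mathcomp Require Import all_classical all_reals all_analysis.
From mathcomp Require Import ring lra.
Require Import Defs.

(* At a point u = diag(u1, u2) one has J_1^2 = -1 on the whole ambient space,
   so the Nijenhuis tensor of two fields with values a, b is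
   (D_{Ja} J) b - (D_{Jb} J) a + J (D_b J) a - J (D_a J) b and depends only on a
   and b.  As the Levi-Civita connection is metric and torsion free, it vanishes
   on vertical arguments, and on lifts of X, Y its C^- part is zero iff
     [R1, u2] = u2 [R2, u2],  R1 = R(u1 X, u1 Y) - R(X, Y),
                              R2 = R(u1 X, Y) + R(X, u1 Y).
   For u1 self-dual the bivectors in R1 and R2 are self-dual, and u2 is
   anti-self-dual (or conversely).  Changing u2 into -u2 shows that [R1, u2] = 0;
   letting u1 and u2 vary, the condition says that R maps self-dual bivectors to
   self-dual ones, i.e. that the trace-free Ricci tensor vanishes.  Every pair
   X, Y is attained because horizontal lifts of constant fields are tangent to
   the twistor space: a twistor is transported along a curve by isometries
   obtained from the Gram-Schmidt process. *)

Set Implicit Arguments.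
Unset Strict Implicit.
Unset Printing Implicit Defensive.

Import Order.TTheory GRing.Theory Num.Theory.
Import numFieldTopology.Exports numFieldNormedType.Exports.

Local Open Scope classical_set_scope.
Local Open Scope ring_scope.

(** * Directional derivatives *)

Section DirectionalDerivatives.
Variables (R : realType) (V : normedModType R).
Implicit Types (t v : V).

(** The computation takes place in the flat space of pairs (x, u), where [J1] is a formula defined
    on every vector, tangent or not, so that brackets of arbitrary extensions can be expanded by the
    product rule. Tangency of the given fields is used for one fact only: the vertical part of a
    tangent vector maps C^+ to itself. Composition with u then commutes with restriction to C^+,
    which is what lets the terms with the derivative of u1 cancel. In coordinates, neither the
    connection forms nor the derivative of u preserve C^+; both defects come from the derivative of
    the metric, and they compensate each other because the connection is metric. The Ricci tensor
    appears through the classical decomposition of the curvature operator: for the splitting of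
    bivectors by duality, the off-diagonal block is the trace-free Ricci tensor. As the operator is
    symmetric, its two off-diagonal blocks are transposes of each other, so a single sign s treats
    both components of the twistor space. *)

Lemma is_derive_mxP m n (M : V -> 'M[R]_(m, n)) t v dM :
  is_derive t v M dM <-> forall i j, is_derive t v (fun x => M x i j) (dM i j).
Proof.
split=> [[dvM <-] i j|H].
  have /derivable_mxP/(_ i j) dvMij := dvM.
  by apply: DeriveDef => //; rewrite derive_mx// mxE.
have dvM : derivable M t v by apply/derivable_mxP => i j; apply: ex_derive.
apply: DeriveDef => //; rewrite derive_mx//; apply/matrixP => i j.
by rewrite mxE; apply: derive_val.
Qed.

Lemma is_derive_fsum (I : Type) (r : seq I) (P : pred I) (W : normedModType R)
    (h : I -> V -> W) dh t v :
  (forall i, is_derive t v (h i) (dh i)) ->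
  is_derive t v (fun x => \sum_(i <- r | P i) h i x) (\sum_(i <- r | P i) dh i).
Proof.
move=> H; elim: r => [|i r IH].
  rewrite big_nil (_ : (fun _ => _) = cst 0); first exact: is_derive_cst.
  by apply/funext => x; rewrite big_nil.
rewrite big_cons; case: ifP => Pi.
  rewrite (_ : (fun _ => _) = h i + fun x => \sum_(i <- r | P i) h i x).
    exact: is_deriveD.
  by apply/funext => x; rewrite big_cons Pi.
rewrite (_ : (fun _ => _) = fun x => \sum_(i <- r | P i) h i x) //.
by apply/funext => x; rewrite big_cons Pi.
Qed.

Lemma is_derive_mulr (f g : V -> R) df dg t v :
  is_derive t v f df -> is_derive t v g dg ->
  is_derive t v (fun x => f x * g x) (df * g t + f t * dg).
Proof.
move=> Hf Hg; apply: is_derive_eq (is_deriveM Hf Hg) _.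
by rewrite addrC [df * _]mulrC.
Qed.

Lemma is_derive_mulmx m n p (f : V -> 'M[R]_(m, n)) (g : V -> 'M[R]_(n, p))
    df dg t v :
  is_derive t v f df -> is_derive t v g dg ->
  is_derive t v (fun x => f x *m g x) (df *m g t + f t *m dg).
Proof.
move=> /is_derive_mxP Hf /is_derive_mxP Hg; apply/is_derive_mxP => i j.
rewrite (_ : (fun _ => _) = fun x => \sum_k f x i k * g x k j); last first.
  by apply/funext => x; rewrite mxE.
rewrite !mxE -big_split /=; apply: is_derive_fsum => k; exact: is_derive_mulr.
Qed.

(** Expanding the argument on the matrices [delta_mx i j] reduces the claim to finite sums of
    products. Linearity is a hypothesis, not a structure, so that block extraction and transposition
    are instances. *)
Lemma is_derive_linmx m n p q (phi : 'M[R]_(m, n) -> 'M[R]_(p, q))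
    (f : V -> 'M[R]_(m, n)) df t v : linear phi ->
  is_derive t v f df -> is_derive t v (fun x => phi (f x)) (phi df).
Proof.
move=> lphi /is_derive_mxP Hf.
pose L := HB.pack_for {linear 'M[R]_(m, n) -> 'M[R]_(p, q)} phi
  (GRing.isLinear.Build _ _ _ _ phi lphi).
have LE A k l : phi A k l = \sum_i \sum_j A i j * phi (delta_mx i j) k l.
  rewrite {1}(matrix_sum_delta A) -[phi]/(L : _ -> _) linear_sum summxE.
  apply: eq_bigr => i _.
  by rewrite linear_sum summxE; apply: eq_bigr => j _; rewrite linearZ mxE.
apply/is_derive_mxP => k l; rewrite LE.
rewrite (_ : (fun _ => _) =
  fun x => \sum_i \sum_j f x i j * phi (delta_mx i j) k l); last first.
  by apply/funext => x; rewrite LE.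
apply: is_derive_fsum => i; apply: is_derive_fsum => j.
have Hc := @is_derive_cst R V R^o (phi (delta_mx i j) k l) t v.
apply: is_derive_eq (is_derive_mulr (Hf i j) Hc) _.
by rewrite mulr0 addr0.
Qed.

Lemma is_derive_ulsubmx m1 m2 n1 n2 (f : V -> 'M[R]_(m1 + m2, n1 + n2)) df t v :
  is_derive t v f df -> is_derive t v (fun x => ulsubmx (f x)) (ulsubmx df).
Proof.
by apply: is_derive_linmx => c A B; apply/matrixP => i j; rewrite !mxE.
Qed.

Lemma is_derive_ursubmx m1 m2 n1 n2 (f : V -> 'M[R]_(m1 + m2, n1 + n2)) df t v :
  is_derive t v f df -> is_derive t v (fun x => ursubmx (f x)) (ursubmx df).
Proof.
by apply: is_derive_linmx => c A B; apply/matrixP => i j; rewrite !mxE.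
Qed.

Lemma is_derive_dlsubmx m1 m2 n1 n2 (f : V -> 'M[R]_(m1 + m2, n1 + n2)) df t v :
  is_derive t v f df -> is_derive t v (fun x => dlsubmx (f x)) (dlsubmx df).
Proof.
by apply: is_derive_linmx => c A B; apply/matrixP => i j; rewrite !mxE.
Qed.

Lemma is_derive_drsubmx m1 m2 n1 n2 (f : V -> 'M[R]_(m1 + m2, n1 + n2)) df t v :
  is_derive t v f df -> is_derive t v (fun x => drsubmx (f x)) (drsubmx df).
Proof.
by apply: is_derive_linmx => c A B; apply/matrixP => i j; rewrite !mxE.
Qed.

Lemma is_derive_trmx m n (f : V -> 'M[R]_(m, n)) df t v :
  is_derive t v f df -> is_derive t v (fun x => (f x)^T) df^T.
Proof.
by apply: is_derive_linmx => c A B; apply/matrixP => i j; rewrite !mxE.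
Qed.

Lemma is_derive_scalemx m n (f : V -> R) (g : V -> 'M[R]_(m, n)) df dg t v :
  is_derive t v f df -> is_derive t v g dg ->
  is_derive t v (fun x => f x *: g x) (df *: g t + f t *: dg).
Proof.
move=> Hf /is_derive_mxP Hg; apply/is_derive_mxP => i j.
rewrite (_ : (fun _ => _) = fun x => f x * g x i j); last first.
  by apply/funext => x; rewrite mxE.
by rewrite !mxE; exact: is_derive_mulr.
Qed.

Lemma is_derive_block_mx m1 m2 n1 n2 (a : V -> 'M[R]_(m1, n1))
    (b : V -> 'M[R]_(m1, n2)) (c : V -> 'M[R]_(m2, n1)) (d : V -> 'M[R]_(m2, n2))
    da db dc dd t v :
  is_derive t v a da -> is_derive t v b db ->
  is_derive t v c dc -> is_derive t v d dd ->
  is_derive t v (fun x => block_mx (a x) (b x) (c x) (d x))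
    (block_mx da db dc dd).
Proof.
move=> /is_derive_mxP Ha /is_derive_mxP Hb /is_derive_mxP Hc /is_derive_mxP Hd.
apply/is_derive_mxP => i j.
rewrite -[i]splitK -[j]splitK.
by case: (fintype.split i) => i'; case: (fintype.split j) => j' /=;
  rewrite ?(block_mxEul, block_mxEur, block_mxEdl, block_mxEdr);
  under eq_fun do
    rewrite ?(block_mxEul, block_mxEur, block_mxEdl, block_mxEdr).
Qed.

Lemma is_derive_pair (W1 W2 : normedModType R) (f : V -> W1) (g : V -> W2)
    df dg t v :
  is_derive t v f df -> is_derive t v g dg ->
  is_derive t v (fun x => (f x, g x)) (df, dg).
Proof.
move=> [cf <-] [cg <-].
suff H : (fun h : R => h^-1 *: (((fun x => (f x, g x)) \o shift t) (h *: v) -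
    (f t, g t))) @ 0^' --> ('D_v f t, 'D_v g t).
  by apply: DeriveDef; [apply/cvg_ex; eexists; exact: H | exact: cvg_lim H].
exact: (cvg_pair cf cg).
Qed.

End DirectionalDerivatives.

Section ProductDomain.
Variables (R : realType) (V1 V2 W : normedModType R).

Lemma is_derive_fst_comp (f : V1 -> W) (p v : V1 * V2) df :
  is_derive p.1 v.1 f df -> is_derive p v (fun q => f q.1) df.
Proof. by move=> [cf <-]; apply: DeriveDef. Qed.

End ProductDomain.

Section ProductCodomain.
Variables (R : realType) (V W1 W2 : normedModType R).

Lemma is_derive_fst (f : V -> W1 * W2) (p v : V) df :
  is_derive p v f df -> is_derive p v (fun q => (f q).1) df.1.
Proof.
move=> [cf <-].
suff H : (fun h : R => h^-1 *: (((fun x => (f x).1) \o shift p) (h *: v) -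
    (f p).1)) @ 0^' --> ('D_v f p).1.
  by apply: DeriveDef; [apply/cvg_ex; eexists; exact: H | exact: cvg_lim H].
by apply: (cvg_comp _ fst cf); exact: cvg_fst.
Qed.

Lemma is_derive_snd (f : V -> W1 * W2) (p v : V) df :
  is_derive p v f df -> is_derive p v (fun q => (f q).2) df.2.
Proof.
move=> [cf <-].
suff H : (fun h : R => h^-1 *: (((fun x => (f x).2) \o shift p) (h *: v) -
    (f p).2)) @ 0^' --> ('D_v f p).2.
  by apply: DeriveDef; [apply/cvg_ex; eexists; exact: H | exact: cvg_lim H].
by apply: (cvg_comp _ snd cf); exact: cvg_snd.
Qed.
End ProductCodomain.

(** * Smooth functions *)

Section Smoothness.
Variables (R : realType) (V : normedModType R).

(* A version of [smooth_on] with finitely many derivatives, so that closure under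
   products and inverses can be proved by induction on their number. *)
Fixpoint ndiff (W : normedModType R) n (U : set V) (f : V -> W) : Prop :=
  (forall x, U x -> differentiable f x) /\
  if n is n'.+1 then forall v, ndiff n' U ('D_v f) else True.

Section Generic.
Variables (W : normedModType R) (U : set V).
Implicit Types f g : V -> W.

Lemma ndiff_differentiable n f x : ndiff n U f -> U x -> differentiable f x.
Proof. by case: n => [|n] [H _]; apply: H. Qed.

Lemma ndiffW n f : ndiff n.+1 U f -> ndiff n U f.
Proof.
elim: n f => [|n IH] f [df H]; split=> // v.
exact: IH (H v).
Qed.

Lemma smooth_onP f : smooth_on U f <-> forall n, ndiff n U f.
Proof.
split=> [sf n|H vs x Ux].
  elim: n f sf => [|n IH] f sf; first by split=> // x; exact: (sf [::]).
  split=> [x|v]; first exact: (sf [::]).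
  apply: IH => vs x Ux; have := sf (rcons vs v) x Ux.
  by rewrite /iter_derive foldr_rcons.
elim/last_ind: vs f H => [|vs v IH] f H; first by case: (H 0%N) => + _; apply.
rewrite /iter_derive foldr_rcons; apply: IH => n.
by case: (H n.+1) => _; apply.
Qed.

Hypothesis openU : open U.

Lemma near_open x : U x -> \forall y \near x, U y.
Proof. by move=> Ux; exact: open_nbhs_nbhs. Qed.

(** The first-order expansion of [f] at [x] is also one of [g], and the uniqueness of the
    differential identifies it with that of [g]. *)
Lemma near_eq_differentiable f g x :
  (\forall y \near x, f y = g y) -> differentiable f x -> differentiable g x.
Proof.
move=> fg df; have gx : f x = g x := nbhs_singleton fg.
have H : g \o shift x = cst (g x) + 'd f x +o_ (0 : V) id.
  apply/eqaddoP => e e0.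
  have /eqaddoP dfo := diff_locally df; have := dfo e e0.
  have : \forall y \near (0:V), f (y + x) = g (y + x).
    by move: fg; rewrite (near_shift 0) /= subr0; apply: filter_app; near=> z.
  apply: filter_app2; near=> y => fgy.
  by rewrite /= !fctE /= -fgy -gx.
have dc : continuous ('d f x) by exact: diff_continuous.
have Hu := diff_unique dc H.
by apply/diff_locallyP; rewrite Hu; split.
Unshelve. all: by end_near. Qed.

Lemma ndiff_eq n f g : (forall x, U x -> f x = g x) -> ndiff n U f -> ndiff n U g.
Proof.
elim: n f g => [|n IH] f g fg [df H]; split=> //.
- move=> x Ux; apply: near_eq_differentiable (df x Ux).
  by near=> y; apply: fg; near: y; exact: near_open.
- move=> x Ux; apply: near_eq_differentiable (df x Ux).
  by near=> y; apply: fg; near: y; exact: near_open.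
move=> v; apply: IH (H v) => x Ux; apply: near_eq_derive.
by near=> y; apply: fg; near: y; exact: near_open.
Unshelve. all: by end_near. Qed.

Lemma ndiff_cst n (c : W) : ndiff n U (cst c).
Proof.
elim: n c => [|n IH] c; split=> // v.
rewrite (_ : 'D_v _ = cst 0) //.
by apply/funext => x; rewrite derive_cst.
Qed.

Lemma ndiffD n f g : ndiff n U f -> ndiff n U g -> ndiff n U (fun x => f x + g x).
Proof.
elim: n f g => [|n IH] f g [df Hf] [dg Hg]; split=> //.
- by move=> x Ux; apply: differentiableD; [exact: df|exact: dg].
- by move=> x Ux; apply: differentiableD; [exact: df|exact: dg].
move=> v; apply: ndiff_eq (IH _ _ (Hf v) (Hg v)) => x Ux.
by rewrite -deriveD //; apply: diff_derivable; [exact: df|exact: dg].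
Qed.

Lemma ndiff_sum n (I : Type) (r : seq I) (P : pred I) (h : I -> V -> W) :
  (forall i, ndiff n U (h i)) -> ndiff n U (fun x => \sum_(i <- r | P i) h i x).
Proof.
move=> H; elim: r => [|i r IH].
  apply: ndiff_eq (ndiff_cst n 0) => x _; by rewrite big_nil.
under eq_fun do rewrite big_cons.
by case: (P i) => //; exact: ndiffD.
Qed.

End Generic.

Section Real.
Variables (U : set V).
Hypothesis openU : open U.
Implicit Types f g : V -> R.

Lemma ndiffM n f g : ndiff n U f -> ndiff n U g -> ndiff n U (fun x => f x * g x).
Proof.
elim: n f g => [|n IH] f g hf hg.
  split=> // x Ux; apply: differentiableM; first exact: ndiff_differentiable hf Ux.
  exact: ndiff_differentiable hg Ux.
split=> [x Ux|v].
  by apply: differentiableM; [exact: ndiff_differentiable hf Ux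
    |exact: ndiff_differentiable hg Ux].
case: (hf) (hg) => _ Hf [_ Hg].
have := ndiffD openU (IH _ _ (Hf v) (ndiffW hg)) (IH _ _ (ndiffW hf) (Hg v)).
apply: ndiff_eq => // x Ux; apply/esym/derive_val.
apply: is_derive_mulr; apply/derivableP/diff_derivable.
  exact: ndiff_differentiable hf Ux.
exact: ndiff_differentiable hg Ux.
Qed.

(** The derivative of 1/f is a product of two copies of 1/f and a derivative of f, so the induction
    on the order only calls itself at a lower order. *)
Lemma ndiffV n f : (forall x, U x -> f x != 0) -> ndiff n U f ->
  ndiff n U (fun x => (f x)^-1).
Proof.
move=> f0; elim: n => [|n IH] hf.
  by split=> // x Ux; apply: differentiableV; [exact: ndiff_differentiable hf Ux|exact: f0].
split=> [x Ux|v].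
  by apply: differentiableV; [exact: ndiff_differentiable hf Ux|exact: f0].
have hV := IH (ndiffW hf); case: (hf) => _ /(_ v) Hf.
have := ndiffM (ndiff_cst U n (-1 : R)) (ndiffM (ndiffM hV hV) Hf).
apply: ndiff_eq => // x Ux.
rewrite deriveV ?f0 //; last exact/diff_derivable/(ndiff_differentiable hf Ux).
rewrite [in RHS]/GRing.scale /= mulN1r mulNr.
by rewrite -invfM -expr2.
Qed.
End Real.

Section Matrix.
Variables (U : set V) (m n : nat).
Hypothesis openU : open U.
Implicit Types f g : V -> 'M[R]_(m, n).

Lemma differentiable_mx f x :
  (forall i j, differentiable (fun y => f y i j : R) x) -> differentiable f x.
Proof.
move=> H.
rewrite (_ : f = \sum_i \sum_j (fun x => f x i j *: delta_mx i j)).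
  apply: differentiable_sum => i; apply: differentiable_sum => j.
  exact: differentiableZl.
apply/funext => y; rewrite {1}(matrix_sum_delta (f y)) fct_sumE.
by apply: eq_bigr => i _; rewrite fct_sumE.
Qed.

Lemma differentiable_mx_entry f x i j :
  differentiable f x -> differentiable (fun y => f y i j : R) x.
Proof.
move=> df; apply: (@differentiable_comp _ _ _ _ f (fun N => N i j : R)) => //.
exact: differentiable_coord.
Qed.

Lemma derive_mx_entry f x v i j : differentiable f x ->
  'D_v f x i j = 'D_v (fun y => f y i j) x.
Proof. by move=> /(diff_derivable (v:=v)) df; rewrite derive_mx // mxE. Qed.

Lemma ndiff_mxP k f :
  ndiff k U f <-> forall i j, ndiff k U (fun x => f x i j : R).
Proof.
elim: k f => [|k IH] f; split=> [hf i j|hf].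
- by split=> // x Ux; exact/differentiable_mx_entry/(ndiff_differentiable hf).
- by split=> // x Ux; apply: differentiable_mx => i j;
    exact: ndiff_differentiable (hf i j) Ux.
- split=> [x Ux|v]; first exact/differentiable_mx_entry/(ndiff_differentiable hf).
  case: (hf) => _ /(_ v)/IH/(_ i j).
  apply: ndiff_eq => // x Ux.
  by rewrite derive_mx_entry //; exact: ndiff_differentiable hf Ux.
have df x : U x -> differentiable f x.
  move=> Ux; apply: differentiable_mx => i j.
  exact: ndiff_differentiable (hf i j) Ux.
split=> // v; apply/IH => i j.
case: (hf i j) => _ /(_ v); apply: ndiff_eq => // x Ux.
by rewrite derive_mx_entry //; exact: df.
Qed.
End Matrix.

End Smoothness.

(** * Symmetry of second derivatives *)

Section Schwarz.
Variables (R : realType) (V : normedModType R).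
Implicit Types (v w x z : V).

Lemma is_derive_line (W : normedModType R) (f : V -> W) v z (t : R) :
  derivable f (t *: v + z) v ->
  is_derive t 1 (fun s => f (s *: v + z)) ('D_v f (t *: v + z)).
Proof.
move=> df.
have E : (fun h : R => h^-1 *: (((fun s => f (s *: v + z)) \o shift t) (h *: 1) -
     f (t *: v + z))) =
  (fun h : R => h^-1 *: ((f \o shift (t *: v + z)) (h *: v) - f (t *: v + z))).
  by apply/funext => h; rewrite /= [h *: 1]mulr1 scalerDl addrA.
by apply: DeriveDef; rewrite /derivable /derive E.
Qed.

Lemma MVT_line (f : V -> R) v z (s : R) : 0 < s ->
  (forall t, 0 <= t <= s -> derivable f (t *: v + z) v) ->
  exists2 t, 0 <= t <= s & f (s *: v + z) - f z = s * 'D_v f (t *: v + z).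
Proof.
move=> s0 df.
have H t : 0 <= t <= s -> is_derive t 1 (fun s => f (s *: v + z)) ('D_v f (t *: v + z)).
  by move=> /df; exact: is_derive_line.
have [t||t] := @MVT R (fun t => f (t *: v + z)) (fun t => 'D_v f (t *: v + z)) 0 s s0.
- rewrite in_itv /= => /andP[t0 ts]; apply: H; by rewrite !ltW.
- apply: derivable_within_continuous => t; rewrite in_itv /= => tI.
  by have [] := H t tI.
move=> + E; rewrite in_itv /= => /andP[t0 ts]; exists t; first by rewrite !ltW.
by move: E; rewrite scale0r add0r subr0 mulrC.
Qed.

(** Two mean value theorems: one along [v] for the increment of [f] in the direction [s *: w], then
    one along [w] for ['D_v f]. *)
Lemma second_difference (f : V -> R) (U : set V) v w x (s : R) : 0 < s ->
  (forall a b : R, 0 <= a <= s -> 0 <= b <= s -> U (b *: w + (a *: v + x))) ->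
  (forall y, U y -> differentiable f y /\ differentiable ('D_v f) y) ->
  exists a b, [/\ 0 <= a <= s, 0 <= b <= s &
    f (s *: w + (s *: v + x)) - f (s *: v + x) - f (s *: w + x) + f x =
    s * (s * 'D_w ('D_v f) (b *: w + (a *: v + x)))].
Proof.
move=> s0 HU df.
have s00 : (0 : R) <= 0 <= s by rewrite lexx ltW.
have ss0 : (0 : R) <= s <= s by rewrite lexx ltW.
have U0 a : 0 <= a <= s -> U (a *: v + x).
  by move=> aI; have := HU _ _ aI s00; rewrite scale0r add0r.
have CA c y z : c *: w + (y + z) = y + (c *: w + z) by rewrite addrCA.
pose phi y := f (s *: w + y) - f y.
have dphi t : 0 <= t <= s -> is_derive (t *: v + x) v phi
    ('D_v f (s *: w + (t *: v + x)) - 'D_v f (t *: v + x)).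
  move=> tI; apply: is_deriveB.
    have [d1 _] := df _ (HU _ _ tI ss0).
    have := derivableP (diff_derivable (v := v) d1).
    move=> [c1 e1].
    have E : (fun h : R => h^-1 *: (((fun y => f (s *: w + y)) \o
       shift (t *: v + x)) (h *: v) - f (s *: w + (t *: v + x)))) =
      (fun h : R => h^-1 *: ((f \o shift (s *: w + (t *: v + x))) (h *: v) -
         f (s *: w + (t *: v + x)))).
      by apply/funext => h; rewrite /= [s *: w + (h *: _ + _)]addrCA.
    by apply: DeriveDef; rewrite /derivable /derive E.
  by apply/derivableP/diff_derivable; case: (df _ (U0 _ tI)).
have [t tI|a aI Ea] := @MVT_line phi v x s s0.
  by have [] := dphi t tI.
have [t tI|b bI Eb] := @MVT_line ('D_v f) w (a *: v + x) s s0.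
  by apply: diff_derivable; case: (df _ (HU _ _ aI tI)).
exists a, b; split=> //.
have -> := esym Eb; have [_ <-] := dphi a aI.
rewrite -Ea /phi /=; ring.
Qed.

(** The second difference of [f] over a parallelogram is symmetric in its sides. Divided by the
    square of [s], it is a value of each mixed derivative at some point of the parallelogram;
    continuity brings both values to [x]. *)
Lemma derive_comm (f : V -> R) (U : set V) v w x : open U -> ndiff 2 U f -> U x ->
  'D_v ('D_w f) x = 'D_w ('D_v f) x.
Proof.
move=> oU [df Hf] Ux.
have cont a b : {for x, continuous ('D_a ('D_b f))}.
  case: (Hf b) => _ /(_ a) [H _].
  exact/differentiable_continuous/H.
apply/eqP; rewrite -subr_eq0 -normr_le0; apply/ler_addgt0Pl => e e0; rewrite addr0.
have e20 : 0 < e / 2 by rewrite divr_gt0.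
have : \forall y \near x, [/\ U y,
    `|'D_v ('D_w f) x - 'D_v ('D_w f) y| < e / 2 &
    `|'D_w ('D_v f) x - 'D_w ('D_v f) y| < e / 2].
  have N1 : \forall y \near x, `|'D_v ('D_w f) x - 'D_v ('D_w f) y| < e / 2.
    exact: ((cvgrPdist_lt _ _).1 (cont v w) _ e20).
  have N2 : \forall y \near x, `|'D_w ('D_v f) x - 'D_w ('D_v f) y| < e / 2.
    exact: ((cvgrPdist_lt _ _).1 (cont w v) _ e20).
  exact: filterS3 (fun y => @And3 _ _ _) (near_open oU Ux) N1 N2.
move=> /nbhs_ballP[d /= d0 Hd].
(* With this [s] the parallelogram on [s *: v] and [s *: w] stays in the ball of radius [d]. The
   summand 1 covers the case where [v] and [w] are both zero; the factor 2 makes the bound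
   strict. *)
pose s := d / (2 * (`|v| + `|w| + 1)).
have den0 : 0 < `|v| + `|w| + 1 by rewrite ltr_wpDl// addr_ge0.
have s0 : 0 < s by rewrite divr_gt0// mulr_gt0.
have Hs a b : 0 <= a <= s -> 0 <= b <= s -> ball x d (b *: w + (a *: v + x)).
  move=> /andP[a0 aS] /andP[b0 bS].
  rewrite -ball_normE /ball_ /= addrA opprD addrCA subrr addr0.
  rewrite normrN (le_lt_trans (ler_normD _ _)) // !normrZ !ger0_norm //.
  apply: (@le_lt_trans _ _ (s * (`|v| + `|w| + 1))).
    have h1 : b * `|w| <= s * `|w| by rewrite ler_wpM2r.
    have h2 : a * `|v| <= s * `|v| by rewrite ler_wpM2r.
    by rewrite !mulrDr mulr1; lra.
  rewrite /s invfM mulrA -mulrA mulVf ?mulr1 ?gt_eqF //.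
  by rewrite ltr_pdivrMr // ltr_pMr // ltr1n.
have dB z y : ball x d y -> differentiable f y /\ differentiable ('D_z f) y.
  by move=> /Hd [Uy _ _]; split; [exact: df|case: (Hf z) => + _; apply].
have Hs' (a b : R) : 0 <= a <= s -> 0 <= b <= s ->
    ball x d (b *: v + (a *: w + x)).
  by move=> aI bI; rewrite addrCA; exact: Hs.
have [a [b [aI bI Eab]]] := second_difference s0 Hs (dB v).
have [b' [a' [bI' aI' Eab']]] := second_difference s0 Hs' (dB w).
have Hvw : 'D_w ('D_v f) (b *: w + (a *: v + x)) =
           'D_v ('D_w f) (a' *: v + (b' *: w + x)).
  apply: (mulfI (lt0r_neq0 s0)); apply: (mulfI (lt0r_neq0 s0)).
  have E : f (s *: w + (s *: v + x)) - f (s *: v + x) - f (s *: w + x) + f x =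
      f (s *: v + (s *: w + x)) - f (s *: w + x) - f (s *: v + x) + f x.
    by rewrite [s *: w + (_ + x)]addrCA; congr (_ + _); exact: addrAC.
  exact: etrans (esym Eab) (etrans E Eab').
have [_ _ H1] := Hd _ (Hs _ _ aI bI).
have [_ H2 _] : [/\ U (a' *: v + (b' *: w + x)),
    `|'D_v ('D_w f) x - 'D_v ('D_w f) (a' *: v + (b' *: w + x))| < e / 2 &
    `|'D_w ('D_v f) x - 'D_w ('D_v f) (a' *: v + (b' *: w + x))| < e / 2].
  by apply: Hd; exact: Hs'.
move: H1; rewrite Hvw => H1.
rewrite -(subrKA ('D_v ('D_w f) (a' *: v + (b' *: w + x)))).
rewrite (splitr e); apply: le_trans (ler_normD _ _) _; apply: lerD; apply: ltW.
  exact: H2.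
by rewrite distrC; exact: H1.
Qed.

End Schwarz.

(** * Gram-Schmidt along a curve *)

Section GramSchmidt.
Variable R : realType.

Lemma is_derive_near_gt0 (a : R -> R) da :
  is_derive (0 : R) 1 a da -> 0 < a 0 -> \forall t \near (0 : R), 0 < a t.
Proof.
move=> [da0 _] a0.
have /differentiable_continuous ca : differentiable a 0.
  exact/derivable1_diffP.
exact: (cvgr_gt _ ca).
Qed.

Lemma is_derive_inv0 (a : R -> R) :
  is_derive (0 : R) 1 a 0 -> a 0 != 0 -> is_derive (0 : R) 1 (fun t => (a t)^-1) 0.
Proof.
move=> [da0 ea] a0; apply: DeriveDef; first exact: derivableV.
by rewrite deriveV // ea scaler0.
Qed.

Lemma schur_complement_pos n (S : 'M[R]_(1 + n)) :
  S^T = S -> (forall X, X != 0 -> 0 < bilin S X X) ->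
  let a := ulsubmx S 0 0 in
  0 < a /\ forall Y, Y != 0 ->
    0 < bilin (drsubmx S - a^-1 *: ((ursubmx S)^T *m ursubmx S)) Y Y.
Proof.
move=> symS posS a.
have Sa : ulsubmx S = a%:M by apply/matrixP => i j; rewrite !ord1 [RHS]mxE eqxx.
have ES : S = block_mx a%:M (ursubmx S) (ursubmx S)^T (drsubmx S).
  by rewrite -Sa trmx_ursub symS submxK.
have a0 : 0 < a.
  have := posS (col_mx 1%:M 0); rewrite /bilin ES tr_col_mx trmx1 trmx0.
  rewrite mul_row_block !mul1mx !mul0mx !addr0 mul_row_col mulmx1 mulmx0 addr0.
  rewrite mxE eqxx; apply.
  by apply/eqP => /(congr1 usubmx); rewrite col_mxKu => /matrixP/(_ 0 0);
    rewrite linear0 !mxE; apply/eqP; rewrite oner_eq0.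
split=> // Y Y0.
(* Completing the square: among the vectors with lower part [Y] this one minimises the form, and the
   minimum is the Schur complement at [Y]. *)
have := posS (col_mx (- (a^-1 *: (ursubmx S *m Y))) Y).
set b := ursubmx S; set D := drsubmx S.
have -> : bilin S (col_mx (- (a^-1 *: (b *m Y))) Y) (col_mx (- (a^-1 *: (b *m Y))) Y)
   = bilin (D - a^-1 *: (b^T *m b)) Y Y.
  rewrite /bilin ES -/b -/D -mulmxA mul_block_col.
  rewrite mul_scalar_mx scalerN scalerA divff ?gt_eqF // scale1r addNr.
  rewrite tr_col_mx mul_row_col mulmx0 add0r -[in RHS]mulmxA; congr ((_ *m _) 0 0).
  by rewrite mulmxBl addrC mulmxN -scalemxAr -scalemxAl mulmxA.
apply; apply/eqP => /(congr1 dsubmx); rewrite col_mxKd linear0 => E.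
by rewrite E eqxx in Y0.
Qed.

(** Induction on the size, splitting off the first vector and passing to the Schur complement. Since
    [S] has derivative zero at 0, so has everything built from it by products, inverses and square
    roots; hence no derivative other than zero has to be propagated. Positivity is only assumed at
    0, as the pivots stay positive nearby. *)
Lemma gram_schmidt_curve n (S : R -> 'M[R]_n) :
  (\forall t \near (0 : R), (S t)^T = S t) ->
  (forall X, X != 0 -> 0 < bilin (S 0) X X) ->
  is_derive (0 : R) 1 S 0 ->
  exists K : R -> 'M[R]_n,
    [/\ \forall t \near (0 : R), (K t)^T *m S t *m K t = 1%:M,
        \forall t \near (0 : R), 0 < \det (K t) & is_derive (0 : R) 1 K 0].
Proof.
elim: n S => [|n IH] S symS posS dS.
  exists (fun _ => 1%:M); split; last exact: is_derive_cst.
    by near=> t; apply/matrixP => -[].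
  by near=> t; rewrite det1.
have {}IH := IH; move: S symS posS dS; rewrite -[n.+1]/(1 + n)%N => S symS posS dS.
pose a t := ulsubmx (S t) 0 0.
pose b t := ursubmx (S t).
pose D t := drsubmx (S t).
have [a0 posS'] := schur_complement_pos (nbhs_singleton symS) posS.
have da : is_derive (0 : R) 1 a 0.
  have /is_derive_mxP/(_ 0 0) := is_derive_ulsubmx dS.
  by rewrite !mxE.
have db : is_derive (0 : R) 1 b 0.
  have := is_derive_ursubmx dS; suff -> : ursubmx (0 : 'M[R]_(1 + n)) = 0 by [].
  by apply/matrixP => i j; rewrite !mxE.
have dD : is_derive (0 : R) 1 D 0.
  have := is_derive_drsubmx dS; suff -> : drsubmx (0 : 'M[R]_(1 + n)) = 0 by [].
  by apply/matrixP => i j; rewrite !mxE.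
have dbT : is_derive (0 : R) 1 (fun t => (b t)^T) 0.
  by have := is_derive_trmx db; rewrite trmx0.
have daV : is_derive (0 : R) 1 (fun t => (a t)^-1) 0.
  by apply: is_derive_inv0 => //; rewrite gt_eqF.
have apos := is_derive_near_gt0 da a0.
have [|||K [KSK detK dK]] := IH (fun t => D t - (a t)^-1 *: ((b t)^T *m b t)).
- move: symS; apply: filterS => t symSt.
  by rewrite linearB linearZ /= trmx_mul trmxK /D trmx_drsub symSt.
- exact: posS'.
- apply: is_derive_eq.
    exact: is_deriveB dD (is_derive_scalemx daV (is_derive_mulmx dbT db)).
  by rewrite mul0mx mulmx0 addr0 scaler0 scale0r addr0 subr0.
pose r t := (Num.sqrt (a t))^-1.
have dr : is_derive (0 : R) 1 r 0.
  apply: is_derive_inv0; last by rewrite sqrtr_eq0 -ltNge.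
  apply: is_derive_eq (is_derive1_comp (is_derive1_sqrt a0) da) _.
  by rewrite mulr0.
(* The first column normalises the first vector; the others are the columns of [K], corrected so as
   to be orthogonal to it for [S t]. *)
exists (fun t => block_mx (r t)%:M (- ((a t)^-1 *: (b t *m K t))) 0 (K t)); split.
- near=> t.
  have at0 : 0 < a t by near: t.
  have symSt : (S t)^T = S t by near: t.
  have KSKt : (K t)^T *m (D t - (a t)^-1 *: ((b t)^T *m b t)) *m K t = 1%:M.
    by near: t.
  have ES : S t = block_mx (a t)%:M (b t) (b t)^T (D t).
    rewrite /b /D trmx_ursub symSt.
    have -> : (a t)%:M = ulsubmx (S t).
      by apply/matrixP => i j; rewrite !ord1 [LHS]mxE eqxx.
    by rewrite submxK.
  rewrite ES -mulmxA mulmx_block !mulmx0 !addr0 tr_block_mx trmx0 tr_scalar_mx.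
  rewrite !mul_scalar_mx scalerN scalerA divff ?gt_eqF // scale1r addNr.
  rewrite mulmx_block !mul0mx !mulmx0 !addr0 add0r.
  rewrite mul_scalar_mx scalerA scale_scalar_mx.
  have trE (A : 'M[R]_(1, n)) c : (- (c *: A))^T = - (c *: A^T).
    by apply/matrixP => i j; rewrite !mxE.
  rewrite trE trmx_mul mulNmx.
  have -> : r t * a t * r t = 1.
    by rewrite mulrAC mulrC -invfM -expr2 sqr_sqrtr ?ltW // divff ?gt_eqF.
  have -> : - ((a t)^-1 *: ((K t)^T *m (b t)^T) *m (a t *: (r t)%:M)) +
      (K t)^T *m ((b t)^T *m (r t)%:M) = 0.
    by rewrite -scalemxAl -scalemxAr scalerA mulVf ?gt_eqF // scale1r -mulmxA addNr.
  have -> : (K t)^T *m ((b t)^T *m - ((a t)^-1 *: (b t *m K t)) + D t *m K t) = 1%:M.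
    rewrite -KSKt -mulmxA; congr (_ *m _); rewrite mulmxBl addrC; congr (_ + _).
    by rewrite mulmxN -scalemxAr -scalemxAl mulmxA.
  by rewrite -scalar_mx_block.
- near=> t; rewrite det_ublock det_scalar1 mulr_gt0 //; last by near: t.
  by rewrite invr_gt0 sqrtr_gt0; near: t.
- have dy := is_deriveN (is_derive_scalemx daV (is_derive_mulmx db dK)).
  have drm : is_derive (0 : R) 1 (fun t => (r t)%:M : 'M[R]_1) 0.
    apply/is_derive_mxP => i j; rewrite !ord1 mxE.
    by under eq_fun do rewrite mxE eqxx mulr1n.
  apply: is_derive_eq.
    exact: (is_derive_block_mx drm dy (is_derive_cst _ _ _) dK).
  by rewrite mul0mx mulmx0 addr0 scaler0 scale0r addr0 oppr0 block_mx0.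
Unshelve. all: by end_near. Qed.

End GramSchmidt.

(** * Smooth matrix-valued functions *)

Section SmoothMatrixOperations.
Variables (R : realType) (V : normedModType R) (U : set V).
Hypothesis openU : open U.

Lemma ndiff_prod k (I : Type) (r : seq I) (P : pred I) (h : I -> V -> R) :
  (forall i, ndiff k U (h i)) -> ndiff k U (fun x => \prod_(i <- r | P i) h i x).
Proof.
move=> H; elim: r => [|i r IH].
  apply: ndiff_eq (ndiff_cst U k (1 : R)) => // x _; by rewrite big_nil.
under eq_fun do rewrite big_cons.
by case: (P i) => //; exact: ndiffM.
Qed.

Lemma ndiff_det k n (f : V -> 'M[R]_n) :
  ndiff k U f -> ndiff k U (fun x => \det (f x) : R).
Proof.
move=> /(ndiff_mxP openU) hf; rewrite /determinant.
apply: ndiff_sum => // s; apply: ndiffM => //; first exact: ndiff_cst.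
by apply: ndiff_prod => i; exact: hf.
Qed.

Lemma ndiff_invmx k n (f : V -> 'M[R]_n) :
  (forall x, U x -> f x \in unitmx) -> ndiff k U f ->
  ndiff k U (fun x => invmx (f x)).
Proof.
move=> unitf hf; apply/(ndiff_mxP openU) => i j.
apply: (@ndiff_eq _ _ _ _ openU _
    (fun x => (\det (f x))^-1 * cofactor (f x) j i)).
  by move=> x Ux; rewrite /invmx unitf // !mxE.
apply: ndiffM => //.
  apply: ndiffV => //; last exact: ndiff_det.
  by move=> x /unitf; rewrite unitmxE unitfE.
rewrite /cofactor; apply: ndiffM => //; first exact: ndiff_cst.
apply: ndiff_det; apply/(ndiff_mxP openU) => a b.
move/(ndiff_mxP openU): hf => /(_ (lift j a) (lift i b)).
by apply: ndiff_eq => // x _; rewrite !mxE.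
Qed.

Lemma ndiff_derive (W : normedModType R) k (f : V -> W) v :
  ndiff k.+1 U f -> ndiff k U ('D_v f).
Proof. by case=> _; apply. Qed.

Lemma derive_comm_mx m n (f : V -> 'M[R]_(m, n)) v w x :
  ndiff 2 U f -> U x -> 'D_v ('D_w f) x = 'D_w ('D_v f) x.
Proof.
move=> hf Ux; apply/matrixP => i j.
have E a b : 'D_a ('D_b f) x i j = 'D_a ('D_b (fun y => f y i j)) x.
  rewrite derive_mx_entry; last exact: ndiff_differentiable (ndiff_derive b hf) Ux.
  apply: near_eq_derive; apply: filterS (near_open openU Ux) => y Uy.
  by rewrite derive_mx_entry //; exact: ndiff_differentiable hf Uy.
have hfij : ndiff 2 U (fun y => f y i j : R).
  by move/(ndiff_mxP openU): hf; apply.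
exact: etrans (E v w) (etrans (derive_comm v w openU hfij Ux) (esym (E w v))).
Qed.

Lemma eq_derive_on (W : normedModType R) (f g : V -> W) v x :
  (forall y, U y -> f y = g y) -> U x -> 'D_v f x = 'D_v g x.
Proof.
move=> fg Ux; apply: near_eq_derive.
exact: filterS (near_open openU Ux).
Qed.

End SmoothMatrixOperations.

Section Linearity.
Variables (R : realType) (W : normedModType R).

Lemma derive_ebase (f : 'cV[R]_4 -> W) x X : differentiable f x ->
  'D_X f x = \sum_i X i 0 *: 'D_(ebase R i) f x.
Proof.
move=> df; rewrite deriveE // [X in 'd f x X](_ : _ = \sum_i X i 0 *: ebase R i).
  by rewrite linear_sum; apply: eq_bigr => i _; rewrite linearZ deriveE.
rewrite {1}(matrix_sum_delta X); apply: eq_bigr => i _.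
by rewrite big_ord1.
Qed.

End Linearity.

(** * The Levi-Civita connection *)

Section LeviCivitaTheory.
Variables (R : realType) (g : 'cV[R]_4 -> 'M[R]_4) (U : set 'cV[R]_4).
Hypothesis openU : open U.
Hypothesis smooth_g : smooth_on U g.
Hypothesis sym_g : forall x, U x -> (g x)^T = g x.
Hypothesis unit_g : forall x, U x -> g x \in unitmx.

Let ndiff_g k : ndiff k U g. Proof. exact/(smooth_onP _ _).1. Qed.

Lemma ndiff_christoffel k i : ndiff k U (christoffel g i).
Proof.
apply/(ndiff_mxP openU) => a b.
apply: (@ndiff_eq _ _ _ _ openU _ (fun x => 2^-1 * \sum_l invmx (g x) a l *
    (partial_g g i x b l + partial_g g b x i l - partial_g g l x i b))).
  by move=> x _; rewrite mxE.
have dg l c d : ndiff k U (fun x => partial_g g l x c d).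
  by have /(ndiff_mxP openU) := ndiff_derive (ebase R l) (ndiff_g k.+1); apply.
apply: ndiffM => //; first exact: ndiff_cst.
apply: ndiff_sum => // l; apply: ndiffM => //.
  by have /(ndiff_mxP openU) := ndiff_invmx openU unit_g (ndiff_g k); apply.
apply: ndiffD => //; first exact: ndiffD.
apply: (@ndiff_eq _ _ _ _ openU _ (fun x => (-1) * partial_g g l x i b)).
  by move=> x _; rewrite mulN1r.
by apply: ndiffM => //; exact: ndiff_cst.
Qed.

Lemma partial_gC l x i j : U x -> partial_g g l x i j = partial_g g l x j i.
Proof.
move=> Ux.
rewrite !derive_mx_entry; try exact: ndiff_differentiable (ndiff_g 0) Ux.
by apply: (eq_derive_on openU) => // y Uy; rewrite -{1}sym_g // mxE.
Qed.

Lemma christoffel_sym i j k x : U x -> christoffel g i x k j = christoffel g j x k i.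
Proof.
move=> Ux; rewrite !mxE; congr (_ * _); apply: eq_bigr => l _; congr (_ * _).
by congr (_ - _); [exact: addrC|exact: partial_gC].
Qed.

(** The Christoffel symbols with lowered index, which are linear in the derivatives of the
    metric. *)
Lemma g_christoffel i x a b : U x -> (g x *m christoffel g i x) a b =
  2^-1 * (partial_g g i x b a + partial_g g b x i a - partial_g g a x i b).
Proof.
move=> Ux.
pose c : 'cV[R]_4 := \col_l
  (partial_g g i x b l + partial_g g b x i l - partial_g g l x i b).
rewrite (_ : _ a b = (2^-1 *: (g x *m (invmx (g x) *m c))) a 0).
  by rewrite mulKVmx ?unit_g // !mxE.
rewrite scalemxAr !mxE; apply: eq_bigr => k _; congr (_ * _).
by rewrite !mxE; congr (_ * _); apply: eq_bigr => l _; rewrite !mxE.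
Qed.

(** The covariant derivative of the metric vanishes: in the sum of a lowered symbol and its
    transpose, the part antisymmetric in [a] and [b] cancels. *)
Lemma partial_g_christoffel i x : U x ->
  partial_g g i x = g x *m christoffel g i x + (christoffel g i x)^T *m g x.
Proof.
move=> Ux.
have -> : (christoffel g i x)^T *m g x = (g x *m christoffel g i x)^T.
  by rewrite trmx_mul sym_g.
apply/matrixP => a b; rewrite [RHS]mxE [in X in _ = _ + X]mxE !g_christoffel //.
have halves (p p' b' c' : R) : p = p' ->
    p = 2^-1 * (p' + b' - c') + 2^-1 * (p + c' - b') by move=> ->; lra.
exact: halves (partial_gC i a b Ux).
Qed.

Lemma differentiable_christoffel i x : U x -> differentiable (christoffel g i) x.
Proof. exact: ndiff_differentiable (ndiff_christoffel 0 i). Qed.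

Lemma differentiable_g x : U x -> differentiable g x.
Proof. exact: ndiff_differentiable (ndiff_g 0). Qed.

Lemma derive_g X x : U x ->
  'D_X g x = g x *m connection_form g x X + (connection_form g x X)^T *m g x.
Proof.
move=> Ux; rewrite derive_ebase; last exact: differentiable_g.
have -> : (connection_form g x X)^T = \sum_i X i 0 *: (christoffel g i x)^T.
  by rewrite /connection_form linear_sum; apply: eq_bigr => i _; rewrite linearZ.
rewrite /connection_form mulmx_sumr mulmx_suml -big_split; apply: eq_bigr => i _.
by rewrite -/(partial_g g i x) partial_g_christoffel // scalerDr scalemxAr scalemxAl.
Qed.

(** Absence of torsion, in the form that later cancels the horizontal part of the Nijenhuis
    tensor. *)
Lemma connection_form_sym x X Y : U x ->
  connection_form g x X *m Y = connection_form g x Y *m X.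
Proof.
move=> Ux; apply/matrixP => k l; rewrite ord1 /connection_form !mulmx_suml !summxE.
transitivity (\sum_i \sum_j X i 0 * Y j 0 * christoffel g i x k j).
  apply: eq_bigr => i _; rewrite -scalemxAl !mxE mulr_sumr; apply: eq_bigr => j _.
  by rewrite mulrA mulrAC.
rewrite exchange_big; apply: eq_bigr => j _.
rewrite -scalemxAl !mxE mulr_sumr; apply: eq_bigr => i _.
by rewrite christoffel_sym // mulrA -mulrA mulrC -mulrA mulrCA.
Qed.

Lemma curvature_antisym i j x : curvature g j i x = - curvature g i j x.
Proof.
have H (B C D E : 'M[R]_4) : B - C + D - E = - (C - B + E - D).
  by apply/matrixP => a b; rewrite !mxE; ring.
exact: H.
Qed.

(** The combinatorial core of the first Bianchi identity: [A] stands for the derivatives of the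
    Christoffel symbols and [B] for their products, both symmetric in the last two indices because
    there is no torsion. *)
Lemma cyclic_sum_eq0 (I : Type) (A B K : I -> I -> I -> R) i j k :
  (forall a b c, A a b c = A a c b) -> (forall a b c, B a b c = B a c b) ->
  (forall a b c, K a b c = A a b c - A b a c + B a b c - B b a c) ->
  K i j k + K j k i + K k i j = 0.
Proof.
move=> SA SB E; rewrite !E (SA i j k) (SA j k i) (SA k i j) (SB i j k) (SB j k i).
rewrite (SB k i j); ring.
Qed.

Lemma bianchi i j k l x : U x ->
  curvature g i j x l k + curvature g j k x l i + curvature g k i x l j = 0.
Proof.
move=> Ux.
have D a b c : 'D_(ebase R a) (christoffel g b) x l c =
   'D_(ebase R a) (christoffel g c) x l b.
  rewrite !derive_mx_entry; try exact: differentiable_christoffel.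
  by apply: (eq_derive_on openU) => // y Uy; rewrite christoffel_sym.
have M a b c : (christoffel g a x *m christoffel g b x) l c =
   (christoffel g a x *m christoffel g c x) l b.
  by rewrite !mxE; apply: eq_bigr => m _; congr (_ * _); rewrite christoffel_sym.
have E a b c : curvature g a b x l c =
    'D_(ebase R a) (christoffel g b) x l c - 'D_(ebase R b) (christoffel g a) x l c
    + (christoffel g a x *m christoffel g b x) l c
    - (christoffel g b x *m christoffel g a x) l c.
  have subE (A B C N : 'M[R]_4) p q :
      (A - B + C - N) p q = A p q - B p q + C p q - N p q by rewrite !mxE.
  exact: subE.
exact: (cyclic_sum_eq0 (A := fun a b c => 'D_(ebase R a) (christoffel g b) x l c)
  (B := fun a b c => (christoffel g a x *m christoffel g b x) l c)
  (K := fun a b c => curvature g a b x l c) i j k D M E).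
Qed.

(** Here [N] is the metric, [P] and [Q] are the Christoffel matrices of the indices i and j, [C] is
    the i-th derivative of [Q] and [D] the j-th derivative of [P]. The hypothesis equates the two
    mixed second derivatives of the metric, each expanded by metric compatibility. *)
Lemma commutator_skew (N P Q C D : 'M[R]_4) :
  (N *m P + P^T *m N) *m Q + N *m C + (C^T *m N + Q^T *m (N *m P + P^T *m N)) =
  (N *m Q + Q^T *m N) *m P + N *m D + (D^T *m N + P^T *m (N *m Q + Q^T *m N)) ->
  N *m (C - D + P *m Q - Q *m P) + (C - D + P *m Q - Q *m P)^T *m N = 0.
Proof.
move=> /eqP; rewrite -subr_eq0 => /eqP H; rewrite -[RHS]H {H}.
have -> : (C - D + P *m Q - Q *m P)^T = C^T - D^T + Q^T *m P^T - P^T *m Q^T.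
  by rewrite -!trmx_mul; apply/matrixP => a b; rewrite !mxE.
rewrite !(mulmxDl, mulmxDr, mulmxBl, mulmxBr, mulNmx, mulmxN, mulmxA).
have addE (X Y : 'M[R]_4) a b : (X + Y) a b = X a b + Y a b by rewrite mxE.
have oppE (X : 'M[R]_4) a b : (- X) a b = - X a b by rewrite mxE.
by apply/matrixP => a b; rewrite !(addE, oppE); ring.
Qed.

Lemma curvature_skew i j x : U x ->
  g x *m curvature g i j x + (curvature g i j x)^T *m g x = 0.
Proof.
move=> Ux.
have E a b : 'D_(ebase R a) ('D_(ebase R b) g) x =
    partial_g g a x *m christoffel g b x
    + g x *m 'D_(ebase R a) (christoffel g b) x
    + (('D_(ebase R a) (christoffel g b) x)^T *m g x
       + (christoffel g b x)^T *m partial_g g a x).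
  rewrite (eq_derive_on openU (g := fun y => g y *m christoffel g b y +
    (christoffel g b y)^T *m g y) _ _ Ux); last first.
    by move=> y Uy; rewrite -/(partial_g g b y) partial_g_christoffel.
  have dg := derivableP (diff_derivable (v := ebase R a) (differentiable_g Ux)).
  have dc := derivableP (diff_derivable (v := ebase R a)
    (differentiable_christoffel b Ux)).
  apply: derive_val; apply: is_deriveD; first exact: is_derive_mulmx.
  by apply: is_derive_mulmx => //; exact: is_derive_trmx.
have Pi := partial_g_christoffel i Ux; have Pj := partial_g_christoffel j Ux.
have Eij := E i j; have Eji := E j i; rewrite Pi in Eij; rewrite Pj in Eji.
have comm := derive_comm_mx openU (ebase R i) (ebase R j) (ndiff_g 2) Ux.
exact: commutator_skew (etrans (esym Eij) (etrans comm Eji)).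
Qed.

End LeviCivitaTheory.

(** * Endomorphisms of TM + T*M *)

Section FibreAlgebra.
Variable R : realType.
Implicit Types (g r : 'M[R]_4) (u M : 'M[R]_(4 + 4)) (e : sign).

Lemma blockCE g e u : blockC g e u = ulsubmx u + sg R e *: (ursubmx u *m g).
Proof.
apply/matrixP => k l; rewrite mxE /liftC -{1}(submxK u) mul_block_col col_mxKu.
rewrite -scalemxAr mulmxA.
have E (B : 'M[R]_4) : (B *m ebase R l) k 0 = B k l.
  by rewrite /ebase -colE mxE.
rewrite mxE [X in _ + X]mxE !E [RHS]mxE; congr (_ + _).
by rewrite [RHS]mxE.
Qed.

Lemma blockCD g e (B C : 'M[R]_(4 + 4)) : blockC g e (B + C) = blockC g e B + blockC g e C.
Proof.
have ulD : ulsubmx (B + C) = ulsubmx B + ulsubmx C.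
  by apply/matrixP => k l; rewrite !mxE.
have urD : ursubmx (B + C) = ursubmx B + ursubmx C.
  by apply/matrixP => k l; rewrite !mxE.
by rewrite !blockCE ulD urD mulmxDl scalerDr addrACA.
Qed.

Lemma blockCN g e (B : 'M[R]_(4 + 4)) : blockC g e (- B) = - blockC g e B.
Proof.
have B0 : blockC g e 0 = 0 by apply: (addrI (blockC g e 0)); rewrite -blockCD !addr0.
by apply: (addrI (blockC g e B)); rewrite -blockCD !subrr.
Qed.
(* M maps C^e to itself: the lower half of M (X + e g X) is e g times its upper
   half. *)
Definition preserves g e M :=
  dlsubmx M + sg R e *: (drsubmx M *m g) = sg R e *: (g *m blockC g e M).

Lemma sgsg e : sg R e * sg R e = 1.
Proof. by case: e; rewrite /= ?mulr1 // mulrNN mulr1. Qed.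

Lemma blockC_block g e a b c d :
  blockC g e (block_mx a b c d) = a + sg R e *: (b *m g).
Proof. by rewrite blockCE block_mxKul block_mxKur. Qed.

(** Only the inner factor has to map C^e to itself: its values on C^e are then lifts of vectors of
    TM, to which the block of [u] applies. *)
Lemma blockC_mul g e u M : preserves g e M ->
  blockC g e (u *m M) = blockC g e u *m blockC g e M.
Proof.
rewrite /preserves; rewrite -(submxK u) -(submxK M).
set P := ulsubmx u; set Q := ursubmx u; set S := dlsubmx u; set W := drsubmx u.
set a := ulsubmx M; set b := ursubmx M; set c := dlsubmx M; set d := drsubmx M.
rewrite mulmx_block !blockC_block block_mxKdl block_mxKdr => H.
rewrite [RHS]mulmxDl -[X in _ = _ + X]scalemxAl -[X in _ = _ + _ *: X]mulmxA
  [X in _ = _ + X]scalemxAr -H.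
rewrite !mulmxDr !mulmxDl scalerDr -!scalemxAr -!mulmxA.
by apply/matrixP => i j; rewrite !mxE; ring.
Qed.

(** The derivation of TM + T*M extending [r], with the dual action on T*M; the connection forms and
    the curvature of TM + T*M have this shape. *)
Definition diag_dual r : 'M[R]_(4 + 4) := block_mx r 0 0 (- r^T).

(** The correction term measures the failure of [r] to be skew for [g]. For a connection form it is
    a derivative of the metric, so it must be kept. *)
Lemma blockC_bracket g e r u :
  blockC g e (diag_dual r *m u - u *m diag_dual r) =
  r *m blockC g e u - blockC g e u *m r
    + sg R e *: (ursubmx u *m (g *m r + r^T *m g)).
Proof.
rewrite -[u in LHS](submxK u) !blockCE /diag_dual.
rewrite !mulmx_block !(mul0mx, mulmx0, addr0, add0r) opp_block_mx add_block_mx.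
rewrite block_mxKul block_mxKur.
rewrite !(mulmxDr, mulmxDl, mulmxN, mulNmx, opprK) -!scalemxAl -!scalemxAr !mulmxA.
by apply/matrixP => i j; rewrite !mxE; ring.
Qed.

Lemma preserves_bracket g e r u : g *m r + r^T *m g = 0 -> preserves g e u ->
  preserves g e (diag_dual r *m u - u *m diag_dual r).
Proof.
move=> skew; rewrite /preserves blockC_bracket skew mulmx0 scaler0 addr0.
have rT : r^T *m g = - (g *m r) by apply/eqP; rewrite -addr_eq0 addrC skew.
move=> H; have {H} HS : dlsubmx u = sg R e *: (g *m blockC g e u)
   - sg R e *: (drsubmx u *m g) by rewrite -H addrK.
rewrite -[u in LHS](submxK u) HS /diag_dual.
rewrite !mulmx_block !(mul0mx, mulmx0, addr0, add0r) opp_block_mx add_block_mx.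
rewrite block_mxKdl block_mxKdr.
set v := blockC g e u; set W := drsubmx u.
rewrite !(mulmxDr, mulmxDl, mulmxBl, mulmxBr, mulmxN, mulNmx, opprK, scalerDr).
rewrite -!scalemxAl -!scalemxAr !mulmxA.
rewrite rT !mulNmx -![W *m _ *m g]mulmxA rT.
rewrite !mulmxN !mulmxA.
by apply/matrixP => i j; rewrite !mxE; ring.
Qed.

(* The hypothesis is [preserves g Plus u] differentiated in a direction along
   which the endomorphism varies by [a] and the metric by [g r + r^T g]. *)
Lemma preserves_derivative g r u a : preserves g Plus u ->
  let g' := g *m r + r^T *m g in
  dlsubmx a + (drsubmx a *m g + drsubmx u *m g') =
    g' *m blockC g Plus u + g *m (blockC g Plus a + ursubmx u *m g') ->
  preserves g Plus (a + (diag_dual r *m u - u *m diag_dual r)).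
Proof.
move=> H g' Ha.
have {}H : dlsubmx u = g *m blockC g Plus u - drsubmx u *m g.
  by move: H; rewrite /preserves /= !scale1r => <-; rewrite addrK.
have {}Ha : dlsubmx a = g' *m blockC g Plus u
    + g *m (blockC g Plus a + ursubmx u *m g')
    - (drsubmx a *m g + drsubmx u *m g') by rewrite -Ha addrK.
move: Ha; rewrite /preserves /g' {g'} => Ha.
rewrite -[a](submxK a) -[u](submxK u) Ha H.
rewrite !blockCE /= !scale1r /diag_dual.
rewrite !mulmx_block !(mul0mx, mulmx0, addr0, add0r) opp_block_mx !add_block_mx.
rewrite !(block_mxKul, block_mxKur, block_mxKdl, block_mxKdr).
rewrite !(mulmxDr, mulmxDl, mulmxBl, mulmxBr, mulmxN, mulNmx, opprK, scalerDr) !mulmxA.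
by apply/matrixP => i j; rewrite !mxE; ring.
Qed.

Lemma form_matrix_inj n (A B : 'M[R]_n) :
  (forall a b : 'cV[R]_n, bilin A a b = bilin B a b) -> A = B.
Proof.
move=> H; apply/matrixP => i j; have := H (delta_mx i 0) (delta_mx j 0).
by rewrite /bilin !trmx_delta -!rowE -!colE !mxE.
Qed.

Lemma orthogonal_bilinP n (N u : 'M[R]_n) :
  orthogonal_for (bilin N) u <-> u^T *m N *m u = N.
Proof.
have E a b : bilin N (u *m a) (u *m b) = bilin (u^T *m N *m u) a b.
  by rewrite /bilin trmx_mul !mulmxA.
split=> [H|H a b]; last by rewrite E H.
by apply: form_matrix_inj => a b; rewrite -E H.
Qed.

Lemma bilin_block (A B C D : 'M[R]_4) (a b : 'cV[R]_(4 + 4)) :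
  bilin (block_mx A B C D) a b =
    bilin A (usubmx a) (usubmx b) + bilin C (dsubmx a) (usubmx b)
    + (bilin B (usubmx a) (dsubmx b) + bilin D (dsubmx a) (dsubmx b)).
Proof.
rewrite -{1}(vsubmxK a) -{1}(vsubmxK b) {1}/bilin tr_col_mx mul_row_block.
by rewrite mul_row_col !mulmxDl /bilin !mxE.
Qed.

Definition swap_mx : 'M[R]_(4 + 4) := block_mx 0 1%:M 1%:M 0.
Definition diag_metric g : 'M[R]_(4 + 4) := block_mx g 0 0 (invmx g).

Lemma bilin0 n (a b : 'cV[R]_n) : bilin 0 a b = 0.
Proof. by rewrite /bilin mulmx0 mul0mx mxE. Qed.

Lemma pairingE a b : pairing a b = 2^-1 * bilin swap_mx a b.
Proof.
rewrite bilin_block !bilin0 add0r addr0 /bilin !mulmx1 /pairing.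
by rewrite -[in X in _ + X](trmxK (usubmx a)) -trmx_mul [in X in _ + X]mxE.
Qed.

Lemma metric_TTE g a b : metric_TT g a b = bilin (diag_metric g) a b.
Proof. by rewrite bilin_block !bilin0 addr0 add0r. Qed.

Lemma twistor_fibreP g u : twistor_fibre g u <->
  [/\ u^T *m swap_mx *m u = swap_mx, u^T *m diag_metric g *m u = diag_metric g
    & u *m u = - 1%:M].
Proof.
have h2 : (2^-1 : R) != 0 by rewrite invr_eq0 pnatr_eq0.
split=> [[H1 H2 H3]|[H1 H2 H3]]; split=> //.
- apply/orthogonal_bilinP => a b; apply: (mulfI h2); rewrite -!pairingE; exact: H1.
- apply/orthogonal_bilinP => a b; rewrite -!metric_TTE; exact: H2.
- move/orthogonal_bilinP: H1 => H1 a b; by rewrite !pairingE H1.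
- move/orthogonal_bilinP: H2 => H2 a b; by rewrite !metric_TTE H2.
Qed.

Lemma swap_mxK : swap_mx *m swap_mx = 1%:M.
Proof.
rewrite /swap_mx mulmx_block !(mul0mx, mulmx0, mulmx1, addr0, add0r).
by rewrite -scalar_mx_block.
Qed.

Lemma isometry_skew n (N u : 'M[R]_n) : u *m u = - 1%:M ->
  u^T *m N *m u = N -> N *m u = - (u^T *m N).
Proof.
by move=> uu H; rewrite -{1}H -!mulmxA uu !mulmxN mulmx1.
Qed.

(** An isometry of square -1 is skew; being skew for both forms, [u] commutes with the endomorphism
    relating them, which sends X + xi to the sum of the vector dual to xi and the covector g(X, .).
    The eigenspaces of this endomorphism for 1 and -1 are C^+ and C^-. *)
Lemma twistor_fibre_preserves g e u : g \in unitmx ->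
  twistor_fibre g u -> preserves g e u.
Proof.
move=> unitg /twistor_fibreP [HJ HG uu].
have HJ' := isometry_skew uu HJ; have HG' := isometry_skew uu HG.
have comm : u *m (swap_mx *m diag_metric g) = swap_mx *m diag_metric g *m u.
  have -> : u *m (swap_mx *m diag_metric g) = swap_mx *m (swap_mx *m u *m swap_mx) *m diag_metric g.
    by rewrite !mulmxA swap_mxK mul1mx.
  rewrite HJ' mulNmx -[u^T *m _ *m _]mulmxA swap_mxK mulmx1 mulmxN mulNmx.
  by rewrite -!mulmxA HG' mulmxN.
move: comm; rewrite -(submxK u) /swap_mx /diag_metric.
set P := ulsubmx u; set Q := ursubmx u; set S := dlsubmx u; set W := drsubmx u.
rewrite !mulmx_block !(mul0mx, mulmx0, mul1mx, addr0, add0r).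
move=> /eq_block_mx [Qg _ Wg _].
rewrite /preserves blockC_block block_mxKdl block_mxKdr Wg mulmxDr scalerDr addrC.
by rewrite -scalemxAr scalerA sgsg scale1r Qg mulmxA mulmxV // mul1mx.
Qed.

Section FromBlocks.
Variable g : 'M[R]_4.
Hypothesis unit_g : g \in unitmx.

(** The columns are the lifts of the coordinate vectors to C^+ and then to C^-: a basis adapted to
    the splitting C^+ + C^-. *)
Definition lift_mx : 'M[R]_(4 + 4) := block_mx 1%:M 1%:M g (- g).
Definition lift_inv : 'M[R]_(4 + 4) :=
  2^-1 *: block_mx 1%:M (invmx g) 1%:M (- invmx g).

Lemma lift_mxK : lift_mx *m lift_inv = 1%:M.
Proof.
rewrite /lift_mx /lift_inv -scalemxAr mulmx_block !(mul1mx, mulmx1).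
rewrite mulmxN mulNmx opprK !mulmxV // !subrr scale_block_mx.
rewrite (scalar_mx_block _ _ 1).
by congr block_mx; apply/matrixP => i j; rewrite !mxE; lra.
Qed.

Lemma lift_inv_mxK : lift_inv *m lift_mx = 1%:M.
Proof. exact: mulmx1C lift_mxK. Qed.

Definition of_blocks (v1 v2 : 'M[R]_4) : 'M[R]_(4 + 4) :=
  lift_mx *m block_mx v1 0 0 v2 *m lift_inv.

Lemma of_blocks_lift v1 v2 :
  of_blocks v1 v2 *m lift_mx = lift_mx *m block_mx v1 0 0 v2.
Proof. by rewrite /of_blocks -mulmxA lift_inv_mxK mulmx1. Qed.

Lemma blockC_of_blocks e v1 v2 :
  blockC g e (of_blocks v1 v2) = if e is Plus then v1 else v2.
Proof.
rewrite /of_blocks /lift_mx /lift_inv mulmx_block !(mul1mx, mulmx0, addr0, add0r).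
rewrite -scalemxAr mulmx_block scale_block_mx blockC_block !mulmx1.
rewrite -scalemxAl mulmxDl mulmxN mulNmx -!mulmxA mulVmx // !mulmx1.
case: e => /=; apply/matrixP => i j; rewrite !mxE; lra.
Qed.

Lemma lift_mx_inj n (A B : 'M[R]_(n, 4 + 4)) : A *m lift_mx = B *m lift_mx -> A = B.
Proof.
by move=> /(congr1 (mulmx^~ lift_inv)); rewrite -!mulmxA lift_mxK !mulmx1.
Qed.

Lemma lift_mxT_inj n (A B : 'M[R]_(4 + 4, n)) :
  lift_mx^T *m A = lift_mx^T *m B -> A = B.
Proof.
by move=> /(congr1 (mulmx lift_inv^T)); rewrite !mulmxA -!trmx_mul lift_mxK trmx1 !mul1mx.
Qed.

(** In the basis [lift_mx] both forms are block diagonal, with blocks 2g and -2g for [swap_mx]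
    (twice the pairing) and 2g and 2g for the metric, so isometries of [g] on each summand preserve
    both. *)
Lemma twistor_fibre_of_blocks v1 v2 : g^T = g ->
  v1^T *m g *m v1 = g -> v2^T *m g *m v2 = g ->
  v1 *m v1 = - 1%:M -> v2 *m v2 = - 1%:M -> twistor_fibre g (of_blocks v1 v2).
Proof.
move=> sg o1 o2 s1 s2; apply/twistor_fibreP.
have trL : lift_mx^T = block_mx 1%:M g 1%:M (- g).
  by rewrite /lift_mx tr_block_mx trmx1 linearN /= sg.
have isom N c : lift_mx^T *m N *m lift_mx = block_mx (2 *: g) 0 0 (c *: g) ->
    (of_blocks v1 v2)^T *m N *m of_blocks v1 v2 = N.
  move=> HN; apply: lift_mx_inj; apply: lift_mxT_inj; rewrite [RHS]mulmxA HN.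
  have conjM (Y L D : 'M[R]_(4 + 4)) :
      L^T *m (Y^T *m D *m Y *m L) = (Y *m L)^T *m D *m (Y *m L).
    by rewrite trmx_mul !mulmxA.
  have conjM' (Y L D : 'M[R]_(4 + 4)) :
      (L *m Y)^T *m D *m (L *m Y) = Y^T *m (L^T *m D *m L) *m Y.
    by rewrite trmx_mul !mulmxA.
  rewrite conjM of_blocks_lift conjM' HN.
  rewrite tr_block_mx !trmx0 !mulmx_block !(mul0mx, mulmx0, addr0, add0r).
  by rewrite -!scalemxAr -!scalemxAl o1 o2.
split.
- apply: (isom _ (-2)).
  rewrite trL /swap_mx /lift_mx !mulmx_block !(mul1mx, mulmx1, mul0mx, mulmx0, addr0, add0r).
  by congr block_mx; apply/matrixP => i j; rewrite !mxE; lra.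
- apply: (isom _ 2).
  rewrite trL /diag_metric /lift_mx !mulmx_block !(mul1mx, mulmx1, mul0mx, mulmx0, addr0, add0r).
  rewrite !mulNmx !mulmxN mulmxV // ?mulNmx !mul1mx.
  by congr block_mx; apply/matrixP => i j; rewrite !mxE; lra.
- apply: lift_mx_inj; rewrite -mulmxA of_blocks_lift mulmxA of_blocks_lift.
  rewrite -mulmxA mulmx_block !(mul0mx, mulmx0, addr0, add0r) s1 s2 mulNmx mul1mx.
  have -> : block_mx (- 1%:M) 0 0 (- 1%:M) = - 1%:M :> 'M[R]_(4 + 4).
    by rewrite (scalar_mx_block _ _ 1) opp_block_mx !oppr0.
  by rewrite mulmxN mulmx1.
Qed.

End FromBlocks.

End FibreAlgebra.

(** * Self-duality and the trace-free Ricci tensor *)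

Section FourDimensions.
Variable R : realType.

Let o0 : 'I_4 := @Ordinal 4 0 isT.
Let o1 : 'I_4 := @Ordinal 4 1 isT.
Let o2 : 'I_4 := @Ordinal 4 2 isT.
Let o3 : 'I_4 := @Ordinal 4 3 isT.

Lemma ord4_ind (P : 'I_4 -> Prop) : P o0 -> P o1 -> P o2 -> P o3 -> forall i, P i.
Proof.
move=> P0 P1 P2 P3 [[|[|[|[|//]]]] lti].
- by rewrite (_ : Ordinal _ = o0) //; exact: val_inj.
- by rewrite (_ : Ordinal _ = o1) //; exact: val_inj.
- by rewrite (_ : Ordinal _ = o2) //; exact: val_inj.
- by rewrite (_ : Ordinal _ = o3) //; exact: val_inj.
Qed.

Lemma sum4 (V : nmodType) (F : 'I_4 -> V) : \sum_i F i = F o0 + F o1 + F o2 + F o3.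
Proof.
rewrite !big_ord_recl big_ord0 addr0 !addrA; congr (F _ + F _ + F _ + F _);
  exact: val_inj.
Qed.

(* For s = 1 (resp. s = -1) these matrices form the self-dual (resp.
   anti-self-dual) part of so(4). *)
Definition quat (s a b c : R) : 'M[R]_4 :=
  \matrix_(i, j) match val i, val j with
  | 0, 1 => - a | 0, 2 => - b | 0, 3 => - c
  | 1, 0 => a | 1, 2 => - (s * c) | 1, 3 => s * b
  | 2, 0 => b | 2, 1 => s * c | 2, 3 => - (s * a)
  | 3, 0 => c | 3, 1 => - (s * b) | 3, 2 => s * a
  | _, _ => 0
  end.

(** For s = 1 the matrix [quat s a b c] is left multiplication by the quaternion ai + bj + ck, and
    for s = -1 right multiplication by it; associativity makes the two commute. *)
Lemma quat_comm s a b c a' b' c' : s = 1 \/ s = -1 ->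
  quat s a b c *m quat (- s) a' b' c' = quat (- s) a' b' c' *m quat s a b c.
Proof.
move=> hs; apply/matrixP.
by case: hs => ->; elim/ord4_ind; elim/ord4_ind; rewrite !mxE !sum4 !mxE /=; ring.
Qed.

Lemma skew_quat s (A : 'M[R]_4) : s = 1 \/ s = -1 -> A^T = - A ->
  A o3 o2 = s * A o1 o0 -> A o3 o1 = - (s * A o2 o0) -> A o2 o1 = s * A o3 o0 ->
  A = quat s (A o1 o0) (A o2 o0) (A o3 o0).
Proof.
move=> hs skA h1 h2 h3.
have sk i j : A j i = - A i j.
  by move/matrixP: skA => /(_ i j); rewrite !mxE.
have d i : A i i = 0 by have := sk i i; lra.
apply/matrixP.
have s01 := sk o0 o1; have s02 := sk o0 o2; have s03 := sk o0 o3.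
have s12 := sk o1 o2; have s13 := sk o1 o3; have s23 := sk o2 o3.
by elim/ord4_ind; elim/ord4_ind; rewrite mxE /= ?d //; lra.
Qed.

(** Each duality is the centraliser in so(4) of the other one, and two of the three quaternion units
    already generate the latter. *)
Lemma commute_quat s (A : 'M[R]_4) : s = 1 \/ s = -1 -> A^T = - A ->
  A *m quat (- s) 1 0 0 = quat (- s) 1 0 0 *m A ->
  A *m quat (- s) 0 1 0 = quat (- s) 0 1 0 *m A ->
  A = quat s (A o1 o0) (A o2 o0) (A o3 o0).
Proof.
move=> hs skA cI cJ.
have sk i j : A j i = - A i j.
  by move/matrixP: skA => /(_ i j); rewrite !mxE.
have s01 := sk o0 o1; have s02 := sk o0 o2; have s03 := sk o0 o3.
have s12 := sk o1 o2; have s13 := sk o1 o3; have s23 := sk o2 o3.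
have E B i j : A *m B = B *m A -> A i o0 * B o0 j + A i o1 * B o1 j + A i o2 * B o2 j
   + A i o3 * B o3 j = B i o0 * A o0 j + B i o1 * A o1 j + B i o2 * A o2 j
   + B i o3 * A o3 j.
  by move/matrixP => /(_ i j); rewrite !mxE !sum4.
have := E _ o0 o2 cI; have := E _ o0 o3 cI; have := E _ o0 o3 cJ.
rewrite !mxE /= => e1 e2 e3.
by apply: skew_quat => //; case: hs e1 e2 e3 => ->; lra.
Qed.

(** * Algebraic curvature tensors in an orthonormal frame *)

Section AlgebraicCurvature.
Variable K : 'I_4 -> 'I_4 -> 'M[R]_4.
Hypothesis K_antisym : forall i j, K j i = - K i j.
Hypothesis K_skew : forall i j, (K i j)^T = - K i j.
Hypothesis K_bianchi : forall i j k l, K i j l k + K j k l i + K k i l j = 0.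

Definition Rm (X Y : 'cV[R]_4) : 'M[R]_4 :=
  \sum_i \sum_j (X i 0 * Y j 0) *: K i j.

Definition Ric : 'M[R]_4 := \matrix_(j, k) \sum_i K i j i k.

Let anti i j k l : K j i k l = - K i j k l.
Proof. by rewrite K_antisym mxE. Qed.

Let skew i j k l : K i j l k = - K i j k l.
Proof. by move/matrixP: (K_skew i j) => /(_ k l); rewrite !mxE. Qed.

(** The usual combination of the four Bianchi identities on i, j, k, l; the antisymmetries supplied
    bring their terms to a common form. *)
Lemma K_pair_sym i j k l : K i j k l = K k l i j.
Proof.
have a := anti; have sk := skew.
have b1 := K_bianchi i j k l; have b2 := K_bianchi j k l i.
have b3 := K_bianchi k l i j; have b4 := K_bianchi l i j k.
have a0 := a k i l j; have a1 := a i j l k; have a2 := a j k l i.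
have a3 := a l j i k; have a4 := a k l i j; have a5 := a i k j l.
have a6 := a l i j k; have a7 := a j l k i; have s0 := sk i j l k.
have s1 := sk j k l i; have s2 := sk k i l j; have s3 := sk k l i j.
have s4 := sk j k i l; have s5 := sk l j i k; have s6 := sk k l j i.
have s7 := sk l i j k; have s8 := sk i k j l; have s9 := sk l i k j.
have s10 := sk i j k l; have s11 := sk j l k i.
lra.
Qed.

Let diag i j k : K i j k k = 0.
Proof. by have := skew i j k k; lra. Qed.

Let diag' i k l : K i i k l = 0.
Proof. by have := anti i i k l; lra. Qed.

(* Rewrites every component of K in terms of those K i j k l with i < j, k < l
   and (i, j) <= (k, l) lexicographically. *)
Let canon := (diag', anti o0 o1, anti o0 o2, anti o0 o3, anti o1 o2, anti o1 o3, anti o2 o3,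
  (fun i j => skew i j o0 o1), (fun i j => skew i j o0 o2), (fun i j => skew i j o0 o3),
  (fun i j => skew i j o1 o2), (fun i j => skew i j o1 o3), (fun i j => skew i j o2 o3),
  diag,
  K_pair_sym o0 o2 o0 o1, K_pair_sym o0 o3 o0 o1, K_pair_sym o0 o3 o0 o2,
  K_pair_sym o1 o2 o0 o1, K_pair_sym o1 o2 o0 o2, K_pair_sym o1 o2 o0 o3,
  K_pair_sym o1 o3 o0 o1, K_pair_sym o1 o3 o0 o2, K_pair_sym o1 o3 o0 o3,
  K_pair_sym o1 o3 o1 o2, K_pair_sym o2 o3 o0 o1, K_pair_sym o2 o3 o0 o2,
  K_pair_sym o2 o3 o0 o3, K_pair_sym o2 o3 o1 o2, K_pair_sym o2 o3 o1 o3).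

(** Vanishing of the trace-free part of [A], not of its trace; the metric is the identity in an
    orthonormal frame. *)
Definition tracefree (A : 'M[R]_4) := A = (\tr A / 4) *: 1%:M.

(* K maps a basis of the bivectors of duality s to endomorphisms of duality s. *)
Definition dual_stable s :=
  [/\ K o0 o1 + s *: K o2 o3 = quat s ((K o0 o1 + s *: K o2 o3) o1 o0)
        ((K o0 o1 + s *: K o2 o3) o2 o0) ((K o0 o1 + s *: K o2 o3) o3 o0),
      K o0 o2 - s *: K o1 o3 = quat s ((K o0 o2 - s *: K o1 o3) o1 o0)
        ((K o0 o2 - s *: K o1 o3) o2 o0) ((K o0 o2 - s *: K o1 o3) o3 o0)
    & K o0 o3 + s *: K o1 o2 = quat s ((K o0 o3 + s *: K o1 o2) o1 o0)
        ((K o0 o3 + s *: K o1 o2) o2 o0) ((K o0 o3 + s *: K o1 o2) o3 o0)].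

Lemma RicE j k : Ric j k = K o0 j o0 k + K o1 j o1 k + K o2 j o2 k + K o3 j o3 k.
Proof. by rewrite mxE sum4. Qed.

(** The block of the curvature operator from bivectors of duality [s] to those of the other duality
    is a 3 by 3 matrix. Its nine entries are, up to linear recombination, the nine components of the
    trace-free Ricci tensor. *)
Lemma tracefree_Ric_dual_stable s : s = 1 \/ s = -1 ->
  tracefree Ric <-> dual_stable s.
Proof.
move=> hs.
have b : K o0 o1 o2 o3 - K o0 o2 o1 o3 + K o0 o3 o1 o2 = 0.
  have := K_bianchi o0 o1 o2 o3; rewrite !canon; lra.
have skD A B c : A^T = - A -> B^T = - B -> (A + c *: B)^T = - (A + c *: B) :> 'M[R]_4.
  move=> hA hB; rewrite linearD linearZ /= hA hB.
  by apply/matrixP => i j; rewrite !mxE; ring.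
have sk1 := skD _ _ s (K_skew o0 o1) (K_skew o2 o3).
have sk2 := skD _ _ (- s) (K_skew o0 o2) (K_skew o1 o3).
have sk3 := skD _ _ s (K_skew o0 o3) (K_skew o1 o2).
rewrite scaleNr in sk2.
have EA (A B : 'M[R]_4) c i j : (A + c *: B) i j = A i j + c * B i j by rewrite !mxE.
have EB (A B : 'M[R]_4) c i j : (A - c *: B) i j = A i j - c * B i j by rewrite !mxE.
have r00 := RicE o0 o0; have r01 := RicE o0 o1; have r02 := RicE o0 o2; have r03 := RicE o0 o3.
have r10 := RicE o1 o0; have r11 := RicE o1 o1; have r12 := RicE o1 o2; have r13 := RicE o1 o3.
have r20 := RicE o2 o0; have r21 := RicE o2 o1; have r22 := RicE o2 o2; have r23 := RicE o2 o3.
have r30 := RicE o3 o0; have r31 := RicE o3 o1; have r32 := RicE o3 o2; have r33 := RicE o3 o3.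
rewrite !canon in r00 r01 r02 r03 r10 r11 r12 r13.
rewrite !canon in r20 r21 r22 r23 r30 r31 r32 r33.
split=> [/matrixP T|[/matrixP M1 /matrixP M2 /matrixP M3]].
  have T' i j : Ric i j = (Ric o0 o0 + Ric o1 o1 + Ric o2 o2 + Ric o3 o3) / 4 *
      (i == j)%:R.
    by rewrite {1}T [LHS]mxE [X in _ * X]mxE /mxtrace sum4.
  have t00 := T' o0 o0; have t11 := T' o1 o1; have t22 := T' o2 o2.
  have t01 := T' o0 o1; have t02 := T' o0 o2; have t03 := T' o0 o3.
  have t12 := T' o1 o2; have t13 := T' o1 o3; have t23 := T' o2 o3.
  rewrite r00 r11 r22 r33 /= in t00 t11 t22.
  rewrite r01 /= mulr0 in t01; rewrite r02 /= mulr0 in t02; rewrite r03 /= mulr0 in t03.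
  rewrite r12 /= mulr0 in t12; rewrite r13 /= mulr0 in t13; rewrite r23 /= mulr0 in t23.
  clear r00 r01 r02 r03 r10 r11 r12 r13 r20 r21 r22 r23 r30 r31 r32 r33.
  by split; apply: skew_quat => //; rewrite ?EA ?EB !canon; case: hs => ->; lra.
have m1 := M1 o3 o2; have m2 := M1 o3 o1; have m3 := M1 o2 o1.
have m4 := M2 o3 o2; have m5 := M2 o3 o1; have m6 := M2 o2 o1.
have m7 := M3 o3 o2; have m8 := M3 o3 o1; have m9 := M3 o2 o1.
rewrite !mxE /= !canon in m1 m2 m3 m4 m5 m6 m7 m8 m9.
apply/matrixP => i j; rewrite [RHS]mxE [X in _ * X]mxE /mxtrace sum4 r00 r11 r22 r33.
move: i j; case: hs => hs; subst s; elim/ord4_ind; elim/ord4_ind;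
  rewrite ?(r00, r01, r02, r03, r10, r11, r12, r13) /= ?mulr0 ?mulr1;
  rewrite ?(r20, r21, r22, r23, r30, r31, r32, r33) /= ?mulr0 ?mulr1;
  clear r00 r01 r02 r03 r10 r11 r12 r13 r20 r21 r22 r23 r30 r31 r32 r33; lra.
Qed.

End AlgebraicCurvature.

(** Laplace expansion along the first two rows. Entries are indexed by natural numbers so that the
    shifted indices of the cofactors reduce by computation. *)
Lemma det4_fun (f : nat -> nat -> R) :
  \det (\matrix_(i < 4, j < 4) f i j) =
    (f 0 0 * f 1 1 - f 0 1 * f 1 0) * (f 2 2 * f 3 3 - f 2 3 * f 3 2)
  - (f 0 0 * f 1 2 - f 0 2 * f 1 0) * (f 2 1 * f 3 3 - f 2 3 * f 3 1)
  + (f 0 0 * f 1 3 - f 0 3 * f 1 0) * (f 2 1 * f 3 2 - f 2 2 * f 3 1)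
  + (f 0 1 * f 1 2 - f 0 2 * f 1 1) * (f 2 0 * f 3 3 - f 2 3 * f 3 0)
  - (f 0 1 * f 1 3 - f 0 3 * f 1 1) * (f 2 0 * f 3 2 - f 2 2 * f 3 0)
  + (f 0 2 * f 1 3 - f 0 3 * f 1 2) * (f 2 0 * f 3 1 - f 2 1 * f 3 0).
Proof.
rewrite (expand_det_row _ ord0) !big_ord_recl big_ord0 /cofactor.
rewrite !(expand_det_row _ ord0) !big_ord_recl !big_ord0 /cofactor.
rewrite !(expand_det_row _ ord0) !big_ord_recl !big_ord0 /cofactor !det_mx11.
rewrite !mxE /= /bump /= !add0n !addn0 !add1n; ring.
Qed.

Lemma det4 (A : 'M[R]_4) : \det A =
    (A o0 o0 * A o1 o1 - A o0 o1 * A o1 o0) * (A o2 o2 * A o3 o3 - A o2 o3 * A o3 o2)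
  - (A o0 o0 * A o1 o2 - A o0 o2 * A o1 o0) * (A o2 o1 * A o3 o3 - A o2 o3 * A o3 o1)
  + (A o0 o0 * A o1 o3 - A o0 o3 * A o1 o0) * (A o2 o1 * A o3 o2 - A o2 o2 * A o3 o1)
  + (A o0 o1 * A o1 o2 - A o0 o2 * A o1 o1) * (A o2 o0 * A o3 o3 - A o2 o3 * A o3 o0)
  - (A o0 o1 * A o1 o3 - A o0 o3 * A o1 o1) * (A o2 o0 * A o3 o2 - A o2 o2 * A o3 o0)
  + (A o0 o2 * A o1 o3 - A o0 o3 * A o1 o2) * (A o2 o0 * A o3 o1 - A o2 o1 * A o3 o0).
Proof.
have i0 : inord 0 = o0 by apply: val_inj; rewrite /= inordK.
have i1 : inord 1 = o1 by apply: val_inj; rewrite /= inordK.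
have i2 : inord 2 = o2 by apply: val_inj; rewrite /= inordK.
have i3 : inord 3 = o3 by apply: val_inj; rewrite /= inordK.
pose f (i j : nat) := A (inord i) (inord j).
have E : A = \matrix_(i < 4, j < 4) f i j.
  by apply/matrixP => i j; rewrite mxE /f !inord_val.
by rewrite {1}E det4_fun /f !i0 !i1 !i2 !i3.
Qed.

Lemma family4E (X Y Z W : 'cV[R]_4) i :
  (family4 X Y Z W i o0 = X i 0) * (family4 X Y Z W i o1 = Y i 0) *
  (family4 X Y Z W i o2 = Z i 0) * (family4 X Y Z W i o3 = W i 0).
Proof.
pose F := row_mx (row_mx X Y) (row_mx Z W).
have e k (j : 'I_(1 + 1 + (1 + 1))) : val k = val j -> family4 X Y Z W i k = F i j.
  by move=> kj; rewrite /family4; congr (F i _); exact: val_inj.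
rewrite (e _ (lshift (1 + 1) (lshift 1 (0 : 'I_1)))) //.
rewrite (e _ (lshift (1 + 1) (rshift 1 (0 : 'I_1)))) //.
rewrite (e _ (rshift (1 + 1) (lshift 1 (0 : 'I_1)))) //.
rewrite (e _ (rshift (1 + 1) (rshift 1 (0 : 'I_1)))) //.
by rewrite /F !(row_mxEl, row_mxEr).
Qed.

Lemma family4_mul (P : 'M[R]_4) X Y Z W :
  family4 (P *m X) (P *m Y) (P *m Z) (P *m W) = P *m family4 X Y Z W.
Proof. by rewrite /family4 -!mul_mx_row. Qed.

(** A family of four vectors is dependent exactly when its determinant vanishes, so the two cases of
    the orientation clause merge into a non-strict inequality, stable under conjugation. *)
Lemma ZfibreP (g : 'M[R]_4) e v : Zfibre g e v <->
  [/\ v^T *m g *m v = g, v *m v = - 1%:M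
    & forall X Y, 0 <= sg R e * \det (family4 X (v *m X) Y (v *m Y))].
Proof.
have H (F : 'M[R]_4) : (\rank F < 4)%N \/ 0 < sg R e * \det F <-> 0 <= sg R e * \det F.
  have D : (\rank F < 4)%N = (\det F == 0).
    rewrite ltn_neqAle rank_leq_row andbT -/(row_free F) row_free_unit unitmxE.
    by rewrite unitfE negbK.
  have s0 : sg R e != 0 by case: e; rewrite /= ?oppr_eq0 oner_eq0.
  rewrite D le_eqVlt [0 == _]eq_sym mulf_eq0 (negbTE s0) /=.
  by split=> [[->|->]|/orP[->|->]]; rewrite ?orbT //; [left|right].
split=> [[/orthogonal_bilinP H1 H2 H3]|[H1 H2 H3]]; split=> //.
- by move=> X Y; apply/H; exact: H3.
- exact/orthogonal_bilinP.
- by move=> X Y; apply/H; exact: H3.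
Qed.

Lemma Zfibre_conj (g h P Q : 'M[R]_4) e v : P *m Q = 1%:M -> 0 < \det P ->
  P^T *m h *m P = g -> Zfibre g e v -> Zfibre h e (P *m v *m Q).
Proof.
move=> PQ detP Ph /ZfibreP [ov vv orv].
have QP : Q *m P = 1%:M := mulmx1C PQ.
have hE : h = Q^T *m g *m Q.
  by rewrite -Ph !mulmxA -trmx_mul PQ trmx1 mul1mx -mulmxA PQ mulmx1.
apply/ZfibreP; split.
- rewrite trmx_mul trmx_mul.
  have -> : Q^T *m (v^T *m P^T) *m h *m (P *m v *m Q) =
     Q^T *m (v^T *m (P^T *m h *m P) *m v) *m Q by rewrite !mulmxA.
  by rewrite Ph ov.
- have -> : P *m v *m Q *m (P *m v *m Q) = P *m (v *m (Q *m P) *m v) *m Q.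
    by rewrite !mulmxA.
  by rewrite QP mulmx1 vv mulmxN mulNmx mulmx1 PQ.
move=> X Y.
have E (Z : 'cV[R]_4) : Z = P *m (Q *m Z) by rewrite mulmxA PQ mul1mx.
rewrite {1}(E X) {1}(E Y) -[P *m v *m Q *m X]mulmxA -[P *m v *m Q *m Y]mulmxA.
rewrite -!(mulmxA P v) family4_mul det_mulmx mulrCA.
by apply: mulr_ge0; [exact: ltW|exact: orv].
Qed.

Lemma sg_cases e : sg R e = 1 \/ sg R e = - 1.
Proof. by case: e; [left|right]. Qed.

(* With w the vector of coordinates <X, I Y>, <X, J Y>, <X, K Y>, the oriented
   volume of (X, vX, Y, vY) is |w|^2 |v|^2 - <w, v>^2 = |w x v|^2. *)
Lemma Zfibre_quat e a b c : a ^+ 2 + b ^+ 2 + c ^+ 2 = 1 ->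
  Zfibre (1%:M : 'M[R]_4) e (quat (sg R e) a b c).
Proof.
move=> n1; have hs := sg_cases e.
apply/ZfibreP; split.
- rewrite mulmx1 -n1; apply/matrixP.
  by case: hs => ->; elim/ord4_ind; elim/ord4_ind; rewrite !mxE !sum4 !mxE /=; ring.
- rewrite -n1; apply/matrixP.
  by case: hs => ->; elim/ord4_ind; elim/ord4_ind; rewrite !mxE !sum4 !mxE /=; ring.
move=> X Y.
set s := sg R e in hs *.
pose x i := X i 0; pose y i := Y i 0.
pose w1 := - x o0 * y o1 + x o1 * y o0 + s * (x o3 * y o2 - x o2 * y o3).
pose w2 := - x o0 * y o2 + x o2 * y o0 + s * (x o1 * y o3 - x o3 * y o1).
pose w3 := - x o0 * y o3 + x o3 * y o0 + s * (x o2 * y o1 - x o1 * y o2).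
suff -> : s * \det (family4 X (quat s a b c *m X) Y (quat s a b c *m Y)) =
   (w2 * c - w3 * b) ^+ 2 + (w3 * a - w1 * c) ^+ 2 + (w1 * b - w2 * a) ^+ 2.
  by rewrite !addr_ge0 // sqr_ge0.
rewrite det4 !family4E !mxE !sum4 !mxE /= /w1 /w2 /w3 /x /y.
by case: hs => ->; ring.
Qed.

(** Because v^2 = -1, the Pfaffian [t] of [v] satisfies t^2 = 1 and the Hodge dual of [v] is [t]
    times [v]. Thus [v] has a duality, and the orientation clause decides which one. *)
Lemma quat_of_Zfibre e v : Zfibre (1%:M : 'M[R]_4) e v ->
  exists a b c, a ^+ 2 + b ^+ 2 + c ^+ 2 = 1 /\ v = quat (sg R e) a b c.
Proof.
move=> /ZfibreP [ov vv orv].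
have hs := sg_cases e.
have skv : v^T = - v.
  move: ov; rewrite mulmx1 => /(congr1 (mulmx^~ v)).
  by rewrite mul1mx -mulmxA vv mulmxN mulmx1 => /(congr1 -%R); rewrite opprK.
have sk i j : v j i = - v i j by move/matrixP: skv => /(_ i j); rewrite !mxE.
have d i : v i i = 0 by have := sk i i; lra.
have V i j : v i o0 * v o0 j + v i o1 * v o1 j + v i o2 * v o2 j + v i o3 * v o3 j =
   - (i == j)%:R.
  by move/matrixP: vv => /(_ i j); rewrite !mxE sum4.
set a := v o1 o0; set b := v o2 o0; set c := v o3 o0.
set p := v o2 o1; set q := v o3 o1; set r := v o3 o2.
have canon := (d, sk o1 o0, sk o2 o0, sk o3 o0, sk o2 o1, sk o3 o1, sk o3 o2).
have := V o0 o0; have := V o1 o1; have := V o2 o2; have := V o3 o3.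
have := V o0 o1; have := V o0 o2; have := V o0 o3.
have := V o1 o2; have := V o1 o3; have := V o2 o3.
rewrite /= !canon -/a -/b -/c -/p -/q -/r => e23 e13 e12 e03 e02 e01 e33 e22 e11 e00.
have n1 : a * a + b * b + c * c = 1 by lra.
(* The Pfaffian of [v]. The next three facts, obtained from the entries of v^2 = -1, say that
   multiplication by it exchanges complementary entries of [v] up to sign. *)
pose t := a * r - b * q + c * p.
have tr : t * a = r.
  have -> : t * a = r * (a * a) - q * (a * b) + p * (a * c) by rewrite /t; ring.
  have -> : a * b = - (q * r) by lra.
  have -> : a * c = p * r by lra.
  have -> : r * (a * a) - q * - (q * r) + p * (p * r) = r * (a * a + p * p + q * q).
    by ring.
  by rewrite (_ : _ + _ = 1) ?mulr1 //; lra.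
have tq : t * b = - q.
  have -> : t * b = r * (a * b) - q * (b * b) + p * (b * c) by rewrite /t; ring.
  have -> : a * b = - (q * r) by lra.
  have -> : b * c = - (p * q) by lra.
  have -> : r * - (q * r) - q * (b * b) + p * - (p * q) = - q * (b * b + p * p + r * r).
    by ring.
  by rewrite (_ : _ + _ = 1) ?mulr1 //; lra.
have tp : t * c = p.
  have -> : t * c = r * (a * c) - q * (b * c) + p * (c * c) by rewrite /t; ring.
  have -> : a * c = p * r by lra.
  have -> : b * c = - (p * q) by lra.
  have -> : r * (p * r) - q * - (p * q) + p * (c * c) = p * (c * c + q * q + r * r).
    by ring.
  by rewrite (_ : _ + _ = 1) ?mulr1 //; lra.
have tt : t * t = 1.
  have -> : t * t = (t * a) * r - (t * b) * q + (t * c) * p by rewrite {2}/t; ring.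
  rewrite tr tq tp; lra.
have ts : t = sg R e.
  (* The volumes of (e_0, v e_0, e_k, v e_k) for k = 1, 2, 3 add up to 2t, which fixes the sign of
     [t]. *)
  have H k : 0 <= sg R e * \det (family4 (ebase R o0) (v *m ebase R o0)
      (ebase R k) (v *m ebase R k)) by exact: orv.
  have h1 := H o1; have h2 := H o2; have h3 := H o3.
  have vE k i : (v *m ebase R k) i 0 = v i k by rewrite /ebase -colE mxE.
  rewrite !det4 !family4E !vE /ebase !mxE /= !canon -/a -/b -/c -/p -/q -/r in h1 h2 h3.
  have pos : 0 <= sg R e * t.
    have -> : t = t * (a * a + b * b + c * c) by rewrite n1 mulr1.
    have -> : t * (a * a + b * b + c * c) = a * (t * a) + b * (t * b) + c * (t * c).
      by ring.
    rewrite tr tq tp; case: hs h1 h2 h3 => ->; lra.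
  have /eqP := tt; rewrite -expr2 sqrf_eq1 => /orP [] /eqP tE; move: pos; rewrite tE.
    by case: hs => ->; lra.
  by case: hs => ->; lra.
exists a, b, c; split; first by rewrite !expr2.
by apply: skew_quat => //; rewrite -?ts /= -/a -/b -/c -/p -/q -/r; lra.
Qed.

Definition curv_cond (Rm : 'cV[R]_4 -> 'cV[R]_4 -> 'M[R]_4) (u1 u2 : 'M[R]_4) X Y :=
  let R1 := Rm (u1 *m X) (u1 *m Y) - Rm X Y in
  let R2 := Rm (u1 *m X) Y + Rm X (u1 *m Y) in
  R1 *m u2 - u2 *m R1 = u2 *m (R2 *m u2 - u2 *m R2).

(* The left-hand side of [curv_cond] is odd in u2 and the right-hand side even. *)
Lemma curv_cond_commute Rm (u1 u2 : 'M[R]_4) X Y :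
  curv_cond Rm u1 u2 X Y -> curv_cond Rm u1 (- u2) X Y ->
  (Rm (u1 *m X) (u1 *m Y) - Rm X Y) *m u2 = u2 *m (Rm (u1 *m X) (u1 *m Y) - Rm X Y).
Proof.
rewrite /curv_cond; set A := _ - Rm X Y.
set B := Rm (u1 *m X) Y + Rm X (u1 *m Y) => H1.
have -> : A *m - u2 - - u2 *m A = - (A *m u2 - u2 *m A).
  by rewrite mulmxN mulNmx opprD.
have -> : - u2 *m (B *m - u2 - - u2 *m B) = u2 *m (B *m u2 - u2 *m B).
  by rewrite [B *m - u2]mulmxN [- u2 *m B]mulNmx -opprD mulNmx mulmxN opprK.
rewrite -H1 => /eqP; rewrite eq_sym -subr_eq0 opprK -mulr2n -scaler_nat.
by rewrite scaler_eq0 pnatr_eq0 /= subr_eq0 => /eqP.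
Qed.

(** * The curvature condition and the duality of bivectors *)

Section CurvatureCondition.
Variable K : 'I_4 -> 'I_4 -> 'M[R]_4.
Hypothesis K_antisym : forall i j, K j i = - K i j.
Hypothesis K_skew : forall i j, (K i j)^T = - K i j.

Lemma Rm_ebase i j : Rm K (ebase R i) (ebase R j) = K i j.
Proof.
rewrite /Rm (bigD1 i) //= (bigD1 j) //= !mxE !eqxx mulr1 scale1r.
rewrite !big1 ?addr0 // => [k ki|k kj].
  by rewrite big1 // => l _; rewrite !mxE (negbTE ki) /= mul0r scale0r.
by rewrite !mxE (negbTE kj) /= mulr0 scale0r.
Qed.

Lemma RmZr c X Y : Rm K X (c *: Y) = c *: Rm K X Y.
Proof.
rewrite /Rm scaler_sumr; apply: eq_bigr => i _; rewrite scaler_sumr.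
by apply: eq_bigr => j _; rewrite mxE scalerA mulrCA.
Qed.

(** The curvature operator applied to a bivector with components [p]; by antisymmetry of [K] only
    the antisymmetric part of [p] counts. *)
Definition contract (p : 'I_4 -> 'I_4 -> R) : 'M[R]_4 := \sum_i \sum_j p i j *: K i j.

(** The three equations say that the antisymmetric part of [p] is a combination of the basis
    bivectors of [dual_stable]. *)
Lemma contract_dual s p : dual_stable K s ->
  p o2 o3 - p o3 o2 = s * (p o0 o1 - p o1 o0) ->
  p o1 o3 - p o3 o1 = - s * (p o0 o2 - p o2 o0) ->
  p o1 o2 - p o2 o1 = s * (p o0 o3 - p o3 o0) ->
  exists a b c, contract p = quat s a b c.
Proof.
move=> [M1 M2 M3] h1 h2 h3.
have -> : contract p = (p o0 o1 - p o1 o0) *: (K o0 o1 + s *: K o2 o3)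
    + (p o0 o2 - p o2 o0) *: (K o0 o2 - s *: K o1 o3)
    + (p o0 o3 - p o3 o0) *: (K o0 o3 + s *: K o1 o2).
  have anti i j a b : K j i a b = - K i j a b by rewrite K_antisym mxE.
  have K0 i a b : K i i a b = 0 by have := anti i i a b; lra.
  apply/matrixP => a b; rewrite /contract !sum4 !mxE !K0 (anti o0 o1) (anti o0 o2).
  rewrite (anti o0 o3) (anti o1 o2) (anti o1 o3) (anti o2 o3).
  have -> : p o2 o3 = p o3 o2 + s * (p o0 o1 - p o1 o0) by lra.
  have -> : p o1 o3 = p o3 o1 - s * (p o0 o2 - p o2 o0) by lra.
  have -> : p o1 o2 = p o2 o1 + s * (p o0 o3 - p o3 o0) by lra.
  ring.
rewrite M1 M2 M3.
set x := p o0 o1 - p o1 o0; set y := p o0 o2 - p o2 o0; set z := p o0 o3 - p o3 o0.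
have quatD a b c a' b' c' : quat s a b c + quat s a' b' c' =
    quat s (a + a') (b + b') (c + c').
  by apply/matrixP; elim/ord4_ind; elim/ord4_ind; rewrite !mxE /=; ring.
have quatZ k a b c : k *: quat s a b c = quat s (k * a) (k * b) (k * c).
  by apply/matrixP; elim/ord4_ind; elim/ord4_ind; rewrite !mxE /=; ring.
by rewrite !quatZ !quatD; do 3 eexists.
Qed.

Lemma dual_stable_curv_cond s a b c a' b' c' X Y : s = 1 \/ s = -1 ->
  dual_stable K s -> a ^+ 2 + b ^+ 2 + c ^+ 2 = 1 ->
  curv_cond (Rm K) (quat s a b c) (quat (- s) a' b' c') X Y.
Proof.
move=> hs dK n1; set u := quat s a b c.
have uE Z i : (u *m Z) i 0 = u i o0 * Z o0 0 + u i o1 * Z o1 0 + u i o2 * Z o2 0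
   + u i o3 * Z o3 0 by move=> *; rewrite mxE sum4.
have [a1 [b1 [c1 E1]]] : exists a b c, Rm K (u *m X) (u *m Y) - Rm K X Y = quat s a b c.
  have -> : Rm K (u *m X) (u *m Y) - Rm K X Y =
      contract (fun i j => (u *m X) i 0 * (u *m Y) j 0 - X i 0 * Y j 0).
    rewrite /Rm /contract -sumrB; apply: eq_bigr => i _; rewrite -sumrB.
    by apply: eq_bigr => j _; rewrite scalerBl.
  (* u multiplies by |u|^2 = 1 the component of opposite duality of X ^ Y. *)
  have [e1 e2 e3] : [/\
     (a ^+ 2 + b ^+ 2 + c ^+ 2 - 1) * (X o2 0 * Y o3 0 - X o3 0 * Y o2 0
        - s * (X o0 0 * Y o1 0 - X o1 0 * Y o0 0)) = 0,
     (a ^+ 2 + b ^+ 2 + c ^+ 2 - 1) * (X o1 0 * Y o3 0 - X o3 0 * Y o1 0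
        + s * (X o0 0 * Y o2 0 - X o2 0 * Y o0 0)) = 0 &
     (a ^+ 2 + b ^+ 2 + c ^+ 2 - 1) * (X o1 0 * Y o2 0 - X o2 0 * Y o1 0
        - s * (X o0 0 * Y o3 0 - X o3 0 * Y o0 0)) = 0].
    by split; rewrite n1 subrr mul0r.
  apply: (contract_dual dK); rewrite !uE !mxE /=; apply/eqP; rewrite -subr_eq0;
    apply/eqP; [rewrite -[RHS]e1|rewrite -[RHS]e2|rewrite -[RHS]e3];
    by case: hs => ->; ring.
have [a2 [b2 [c2 E2]]] : exists a b c, Rm K (u *m X) Y + Rm K X (u *m Y) = quat s a b c.
  have -> : Rm K (u *m X) Y + Rm K X (u *m Y) =
      contract (fun i j => (u *m X) i 0 * Y j 0 + X i 0 * (u *m Y) j 0).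
    rewrite /Rm /contract -big_split; apply: eq_bigr => i _; rewrite -big_split.
    by apply: eq_bigr => j _; rewrite scalerDl.
  (* [u] acts on the bivector X ^ Y as a derivation and, being of duality [s], kills its component
     of the other duality. *)
  by apply: (contract_dual dK); rewrite !uE !mxE /=; case: hs => ->; ring.
by rewrite /curv_cond E1 E2 !quat_comm // !subrr mulmx0.
Qed.

(** With u1 one of the units I, J and X, Y suitable coordinate vectors, the bivector u1 X ^ u1 Y - X
    ^ Y is the opposite of each of the three basis bivectors of duality [s] in turn. Its image
    commutes with all [u2], hence has duality [s] by [commute_quat]. *)
Lemma curv_cond_dual_stable s : s = 1 \/ s = -1 ->
  (forall a b c a' b' c' X Y, a ^+ 2 + b ^+ 2 + c ^+ 2 = 1 ->
    a' ^+ 2 + b' ^+ 2 + c' ^+ 2 = 1 ->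
    curv_cond (Rm K) (quat s a b c) (quat (- s) a' b' c') X Y) ->
  dual_stable K s.
Proof.
move=> hs H.
have quatN a b c : - quat (- s) a b c = quat (- s) (- a) (- b) (- c).
  by apply/matrixP; elim/ord4_ind; elim/ord4_ind; rewrite !mxE /=; ring.
have C a b c a' b' c' X Y : a ^+ 2 + b ^+ 2 + c ^+ 2 = 1 ->
    a' ^+ 2 + b' ^+ 2 + c' ^+ 2 = 1 ->
    let A := Rm K (quat s a b c *m X) (quat s a b c *m Y) - Rm K X Y in
    A *m quat (- s) a' b' c' = quat (- s) a' b' c' *m A.
  move=> n n' A; apply: curv_cond_commute; first exact: H.
  by rewrite quatN; apply: H; rewrite // !sqrrN.
have n100 : 1 ^+ 2 + 0 ^+ 2 + 0 ^+ 2 = 1 :> R by rewrite !expr2; ring.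
have n010 : 0 ^+ 2 + 1 ^+ 2 + 0 ^+ 2 = 1 :> R by rewrite !expr2; ring.
have quatE a b c k : quat s a b c *m ebase R k = \col_i quat s a b c i k.
  by rewrite /ebase -colE; apply/colP => i; rewrite !mxE.
have eE (x y z w : R) (v : 'cV[R]_4) : v o0 0 = x -> v o1 0 = y -> v o2 0 = z ->
    v o3 0 = w -> v = x *: ebase R o0 + y *: ebase R o1 + z *: ebase R o2 + w *: ebase R o3.
  move=> hx hy hz hw; apply/matrixP => i j; rewrite ord1; move: i.
  by elim/ord4_ind; rewrite !mxE /= ?hx ?hy ?hz ?hw ?mulr1 ?mulr0; ring.
have qE a b c k x y z w : quat s a b c o0 k = x -> quat s a b c o1 k = y ->
    quat s a b c o2 k = z -> quat s a b c o3 k = w -> quat s a b c *m ebase R k =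
    x *: ebase R o0 + y *: ebase R o1 + z *: ebase R o2 + w *: ebase R o3.
  by move=> *; rewrite quatE; apply: eE; rewrite mxE.
have I0 : quat s 1 0 0 *m ebase R o0 = ebase R o1.
  rewrite (@qE _ _ _ _ 0 1 0 0) ?mxE //; apply/matrixP => i j; rewrite !mxE; ring.
have I2 : quat s 1 0 0 *m ebase R o2 = s *: ebase R o3.
  rewrite (@qE _ _ _ _ 0 0 0 s) ?mxE /= ?mulr1 ?mulr0 ?oppr0 //.
  by apply/matrixP => i j; rewrite !mxE; ring.
have I3 : quat s 1 0 0 *m ebase R o3 = (- s) *: ebase R o2.
  rewrite (@qE _ _ _ _ 0 0 (- s) 0) ?mxE /= ?mulr1 ?mulr0 ?oppr0 //.
  by apply/matrixP => i j; rewrite !mxE; ring.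
have J0 : quat s 0 1 0 *m ebase R o0 = ebase R o2.
  rewrite (@qE _ _ _ _ 0 0 1 0) ?mxE //=.
  by apply/matrixP => i j; rewrite !mxE; ring.
have J1 : quat s 0 1 0 *m ebase R o1 = (- s) *: ebase R o3.
  rewrite (@qE _ _ _ _ 0 0 0 (- s)) ?mxE /= ?mulr1 ?mulr0 ?oppr0 //.
  by apply/matrixP => i j; rewrite !mxE; ring.
have skD A B k : A^T = - A -> B^T = - B -> (A + k *: B)^T = - (A + k *: B) :> 'M[R]_4.
  move=> hA hB; rewrite linearD linearZ /= hA hB.
  by apply/matrixP => i j; rewrite !mxE; ring.
have D A : A^T = - A ->
    (forall a' b' c', a' ^+ 2 + b' ^+ 2 + c' ^+ 2 = 1 ->
      (- A) *m quat (- s) a' b' c' = quat (- s) a' b' c' *m (- A)) ->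
    A = quat s (A o1 o0) (A o2 o0) (A o3 o0).
  move=> skA cA; apply: commute_quat => //; apply: oppr_inj;
    by rewrite -mulNmx -mulmxN cA.
have sm1 := skD _ _ s (K_skew o0 o1) (K_skew o2 o3).
have sm2 := skD _ _ (- s) (K_skew o0 o2) (K_skew o1 o3).
have sm3 := skD _ _ s (K_skew o0 o3) (K_skew o1 o2).
rewrite scaleNr in sm2.
split; apply: D => // a' b' c' n'.
- have := C 0 1 0 a' b' c' (ebase R o0) (ebase R o1) n010 n'.
  by rewrite J0 J1 RmZr !Rm_ebase opprD addrC scaleNr.
- have := C 1 0 0 a' b' c' (ebase R o0) (ebase R o2) n100 n'.
  by rewrite I0 I2 RmZr !Rm_ebase opprB.
- have := C 1 0 0 a' b' c' (ebase R o0) (ebase R o3) n100 n'.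
  by rewrite I0 I3 RmZr !Rm_ebase opprD addrC scaleNr.
Qed.

End CurvatureCondition.

End FourDimensions.

(** * From coordinates to a positive orthonormal frame *)

Section FrameTransfer.
Variables (R : realType) (g : 'M[R]_4) (K : 'I_4 -> 'I_4 -> 'M[R]_4).
Hypothesis g_sym : g^T = g.
Hypothesis g_pos : forall X, X != 0 -> 0 < bilin g X X.
Hypothesis K_antisym : forall i j, K j i = - K i j.
Hypothesis K_skew : forall i j, g *m K i j + (K i j)^T *m g = 0.
Hypothesis K_bianchi : forall i j k l, K i j l k + K j k l i + K k i l j = 0.

(** The case of a constant curve in [gram_schmidt_curve]. *)
Lemma orthonormal_frame : exists E : 'M[R]_4, E^T *m g *m E = 1%:M /\ 0 < \det E.
Proof.
have symS : \forall t \near (0 : R), ((fun _ : R => g) t)^T = g by near=> t.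
have dS : is_derive (0 : R) 1 (fun _ : R => g) 0 by exact: is_derive_cst.
have [F [H1 H2 _]] := gram_schmidt_curve symS g_pos dS.
by exists (F 0); split; [exact: nbhs_singleton H1|exact: nbhs_singleton H2].
Unshelve. all: by end_near. Qed.

Lemma Rm_sum (x y : 'I_4 -> R) (A B : 'I_4 -> 'cV[R]_4) :
  Rm K (\sum_i x i *: A i) (\sum_j y j *: B j) =
  \sum_i \sum_j (x i * y j) *: Rm K (A i) (B j).
Proof.
have sumE (z : 'I_4 -> R) (C : 'I_4 -> 'cV[R]_4) p :
    (\sum_i z i *: C i) p 0 = \sum_i z i * C i p 0.
  by rewrite summxE; apply: eq_bigr => i _; rewrite mxE.
transitivity (\sum_p \sum_q \sum_i \sum_j (x i * y j * (A i p 0 * B j q 0)) *: K p q).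
  apply: eq_bigr => p _; apply: eq_bigr => q _; rewrite !sumE mulr_suml scaler_suml.
  apply: eq_bigr => i _; rewrite mulr_sumr scaler_suml; apply: eq_bigr => j _.
  by rewrite mulrACA.
under eq_bigr do rewrite exchange_big; rewrite exchange_big; apply: eq_bigr => i _.
under eq_bigr do rewrite exchange_big; rewrite exchange_big; apply: eq_bigr => j _.
rewrite /Rm scaler_sumr; apply: eq_bigr => p _; rewrite scaler_sumr.
by apply: eq_bigr => q _; rewrite scalerA.
Qed.

Lemma Rm_antisym X Y : Rm K Y X = - Rm K X Y.
Proof.
rewrite /Rm exchange_big -sumrN; apply: eq_bigr => i _; rewrite -sumrN.
by apply: eq_bigr => j _; rewrite K_antisym scalerN mulrC.
Qed.

Lemma Rm_skew X Y : g *m Rm K X Y + (Rm K X Y)^T *m g = 0.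
Proof.
rewrite /Rm mulmx_sumr linear_sum mulmx_suml -big_split big1 // => i _.
rewrite /= mulmx_sumr linear_sum mulmx_suml -big_split big1 // => j _.
by rewrite /= -scalemxAr linearZ /= -scalemxAl -scalerDr K_skew scaler0.
Qed.

Lemma Rm_bianchi X Y Z : Rm K X Y *m Z + Rm K Y Z *m X + Rm K Z X *m Y = 0.
Proof.
have E (A B C : 'cV[R]_4) l : (Rm K A B *m C) l 0 =
    \sum_i \sum_j \sum_k A i 0 * B j 0 * C k 0 * K i j l k.
  rewrite /Rm mulmx_suml summxE; apply: eq_bigr => i _.
  rewrite mulmx_suml summxE; apply: eq_bigr => j _.
  by rewrite -scalemxAl !mxE mulr_sumr; apply: eq_bigr => k _; rewrite mulrA mulrAC.
apply/matrixP => l z; rewrite ord1 [RHS]mxE 2!mxE !E.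
have -> : \sum_i \sum_j \sum_k Y i 0 * Z j 0 * X k 0 * K i j l k =
    \sum_i \sum_j \sum_k X i 0 * Y j 0 * Z k 0 * K j k l i.
  rewrite [RHS]exchange_big; apply: eq_bigr => j _.
  rewrite [RHS]exchange_big; apply: eq_bigr => k _; apply: eq_bigr => i _ /=.
  by congr (_ * _); rewrite mulrC mulrA.
have -> : \sum_i \sum_j \sum_k Z i 0 * X j 0 * Y k 0 * K i j l k =
    \sum_i \sum_j \sum_k X i 0 * Y j 0 * Z k 0 * K k i l j.
  rewrite exchange_big; apply: eq_bigr => i _ /=.
  rewrite exchange_big; apply: eq_bigr => j _; apply: eq_bigr => k _ /=; ring.
rewrite -!big_split big1 // => i _; rewrite /= -!big_split big1 // => j _.
rewrite /= -!big_split big1 // => k _ /=.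
by rewrite -!mulrDr K_bianchi mulr0.
Qed.

Section Frame.
Variables E Q : 'M[R]_4.
Hypothesis frameE : E^T *m g *m E = 1%:M.
Hypothesis QE : Q *m E = 1%:M.

Let EQ : E *m Q = 1%:M. Proof. exact: mulmx1C. Qed.

Let QT : Q = E^T *m g.
Proof. by rewrite -[RHS]mulmx1 -EQ mulmxA frameE mul1mx. Qed.

Definition frame_curv i j : 'M[R]_4 :=
  Q *m Rm K (E *m ebase R i) (E *m ebase R j) *m E.

Lemma cV_ebase (X : 'cV[R]_4) : X = \sum_i X i 0 *: ebase R i.
Proof.
rewrite {1}(matrix_sum_delta X); apply: eq_bigr => i _; by rewrite big_ord1.
Qed.

Lemma Rm_frame X Y : Rm frame_curv X Y = Q *m Rm K (E *m X) (E *m Y) *m E.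
Proof.
have EX Z : E *m Z = \sum_i Z i 0 *: (E *m ebase R i).
  rewrite {1}(cV_ebase Z) mulmx_sumr; apply: eq_bigr => i _.
  by rewrite scalemxAr.
rewrite [in RHS](EX X) [in RHS](EX Y) Rm_sum mulmx_sumr mulmx_suml.
apply: eq_bigr => i _; rewrite mulmx_sumr mulmx_suml; apply: eq_bigr => j _.
by rewrite /frame_curv -scalemxAr -scalemxAl.
Qed.

Lemma frame_antisym i j : frame_curv j i = - frame_curv i j.
Proof. by rewrite /frame_curv Rm_antisym mulmxN mulNmx. Qed.

Lemma frame_skew i j : (frame_curv i j)^T = - frame_curv i j.
Proof.
rewrite /frame_curv; set M := Rm _ _ _.
have H : M^T *m g = - (g *m M).
  by apply/eqP; rewrite -addr_eq0 addrC Rm_skew.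
rewrite !trmx_mul {1}QT trmx_mul trmxK g_sym !mulmxA.
by rewrite -[E^T *m _ *m _]mulmxA H mulmxN !mulNmx !mulmxA -QT.
Qed.

Lemma frame_bianchi i j k l :
  frame_curv i j l k + frame_curv j k l i + frame_curv k i l j = 0.
Proof.
have H a b c : frame_curv a b l c =
    (Q *m (Rm K (E *m ebase R a) (E *m ebase R b) *m (E *m ebase R c))) l 0.
  have vE (A : 'M[R]_4) : A l c = (A *m ebase R c) l 0 by rewrite /ebase -colE mxE.
  by rewrite vE /frame_curv !mulmxA.
have addE (A B C : 'cV[R]_4) : A l 0 + B l 0 + C l 0 = (A + B + C) l 0.
  by rewrite !mxE.
by rewrite !H addE -!mulmxDr Rm_bianchi mulmx0 mxE.
Qed.

(** The trace defining Ricci is insensitive to conjugation by [E], so only its two arguments are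
    transformed. *)
Lemma Ric_frame : Ric frame_curv = E^T *m Ric K *m E.
Proof.
have RmE i j : Rm K (E *m ebase R i) (E *m ebase R j) =
    \sum_p \sum_q (E p i * E q j) *: K p q.
  by apply: eq_bigr => p _; apply: eq_bigr => q _; rewrite /ebase -!colE !mxE.
apply/matrixP => j k; rewrite mxE.
transitivity (\sum_p \sum_q E q j * (K p q *m E) p k); last first.
  rewrite -mulmxA mxE exchange_big; apply: eq_bigr => q _.
  have -> : E^T j q = E q j by rewrite mxE.
  rewrite -mulr_sumr; congr (_ * _); rewrite [RHS]mxE.
  under eq_bigr do rewrite mxE; rewrite exchange_big /=; apply: eq_bigr => r _.
  by rewrite mxE mulr_suml.
transitivity (\sum_i \sum_p \sum_a (Q i a * E p i) * \sum_q E q j * (K p q *m E) a k).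
  apply: eq_bigr => i _; rewrite /frame_curv RmE -mulmxA mxE [RHS]exchange_big /=.
  apply: eq_bigr => a _; rewrite mulmx_suml summxE mulr_sumr; apply: eq_bigr => p _.
  rewrite mulmx_suml summxE mulr_sumr mulr_sumr; apply: eq_bigr => q _.
  by rewrite -scalemxAl mxE -!mulrA.
rewrite exchange_big; apply: eq_bigr => p _; rewrite exchange_big /=.
rewrite (bigD1 p) //= [X in _ + X]big1 ?addr0.
  rewrite -mulr_suml (_ : \sum_i _ = 1) ?mul1r //.
  have /matrixP/(_ p p) := EQ; rewrite !mxE eqxx => H; rewrite -[RHS]H.
  by apply: eq_bigr => i _; rewrite mulrC.
move=> a ap; rewrite -mulr_suml (_ : \sum_i _ = 0) ?mul0r //.
have /matrixP/(_ p a) := EQ; rewrite !mxE eq_sym (negbTE ap) => H; rewrite -[RHS]H.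
by apply: eq_bigr => i _; rewrite mulrC.
Qed.

Lemma tracefree_frame : tracefree (Ric frame_curv) <->
  Ric K - (\tr (invmx g *m Ric K) / 4) *: g = 0.
Proof.
have gEE : g *m (E *m E^T) = 1%:M.
  apply: mulmx1C; by rewrite -mulmxA -QT EQ.
have ginv : invmx g = E *m E^T.
  have [ug _] := mulmx1_unit gEE.
  by rewrite -[RHS](mulKmx ug) gEE mulmx1.
have gQ : g = Q^T *m Q.
  by rewrite {1}QT trmx_mul trmxK g_sym -mulmxA EQ mulmx1.
rewrite ginv -mulmxA mxtrace_mulC -Ric_frame /tracefree.
set t := \tr _ / 4.
have RicQ : Ric K = Q^T *m Ric frame_curv *m Q.
  rewrite Ric_frame !mulmxA -trmx_mul EQ trmx1 mul1mx -mulmxA EQ mulmx1 //.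
split=> [T|/eqP].
  by rewrite RicQ T -scalemxAr -scalemxAl mulmx1 -gQ subrr.
rewrite subr_eq0 => /eqP RicE.
by rewrite Ric_frame RicE -scalemxAr -scalemxAl frameE.
Qed.

Lemma curv_cond_frame u1 u2 X Y :
  curv_cond (Rm frame_curv) (Q *m u1 *m E) (Q *m u2 *m E) X Y <->
  curv_cond (Rm K) u1 u2 (E *m X) (E *m Y).
Proof.
have uE Z : E *m (Q *m u1 *m E *m Z) = u1 *m (E *m Z).
  by rewrite !mulmxA EQ mul1mx.
rewrite /curv_cond !Rm_frame !uE.
set A := Rm K (u1 *m _) (u1 *m _); set B := Rm K (E *m X) (E *m Y).
set C := Rm K (u1 *m _) (E *m Y); set D := Rm K (E *m X) _.
rewrite -!mulmxBl -!mulmxBr -!mulmxDl -!mulmxDr.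
have M S T : Q *m S *m E *m (Q *m T *m E) = Q *m (S *m T) *m E.
  by rewrite !mulmxA -[Q *m S *m E *m Q]mulmxA EQ mulmx1.
rewrite !M -!mulmxBl -!mulmxBr M; split=> [H|-> //].
have inj S : S = E *m (Q *m S *m E) *m Q.
  by rewrite !mulmxA EQ mul1mx -mulmxA EQ mulmx1.
by rewrite [LHS]inj H -inj.
Qed.

End Frame.

(** The pointwise equivalence. In a positive orthonormal frame [u1] and [u2] become unit imaginary
    quaternions, of opposite dualities because the signs are opposite. *)
Theorem curv_cond_einstein e1 e2 : sg R e2 = - sg R e1 ->
  (forall u1 u2 X Y, Zfibre g e1 u1 -> Zfibre g e2 u2 -> curv_cond (Rm K) u1 u2 X Y)
  <-> Ric K - (\tr (invmx g *m Ric K) / 4) *: g = 0.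
Proof.
move=> se; have [E [frameE detE]] := orthonormal_frame.
have unitE : E \in unitmx by rewrite unitmxE unitfE gt_eqF.
pose Q := invmx E.
have QE : Q *m E = 1%:M by rewrite mulVmx.
have EQ : E *m Q = 1%:M by rewrite mulmxV.
have detQ : 0 < \det Q by rewrite det_inv invr_gt0.
have hs := sg_cases R e1.
have anti := frame_antisym E Q.
have skew := frame_skew frameE QE.
have Qg : Q^T *m 1%:M *m Q = g.
  have QT : Q = E^T *m g by rewrite -[RHS]mulmx1 -EQ mulmxA frameE mul1mx.
  by rewrite mulmx1 {1}QT trmx_mul trmxK g_sym -mulmxA EQ mulmx1.
rewrite -(tracefree_frame frameE QE).
rewrite (tracefree_Ric_dual_stable anti skew (frame_bianchi E Q) hs).
have conj_uE u : Q *m (E *m u *m Q) *m E = u.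
  by rewrite !mulmxA QE mul1mx -mulmxA QE mulmx1.
split=> [H|dS u1 u2 X Y z1 z2].
  apply: curv_cond_dual_stable => // a b c a' b' c' X Y n n'.
  have zq := Zfibre_quat e1 n; have zq' := Zfibre_quat e2 n'.
  have := Zfibre_conj EQ detE frameE zq; have := Zfibre_conj EQ detE frameE zq'.
  rewrite se => z2 z1; have := H _ _ (E *m X) (E *m Y) z1 z2.
  by rewrite -(curv_cond_frame QE) !conj_uE.
have conj_QE (Z : 'cV[R]_4) : Z = E *m (Q *m Z) by rewrite mulmxA EQ mul1mx.
rewrite (conj_QE X) (conj_QE Y) -(curv_cond_frame QE).
have [a [b [c [n ->]]]] := quat_of_Zfibre (Zfibre_conj QE detQ Qg z1).
have [a' [b' [c' [_ ->]]]] := quat_of_Zfibre (Zfibre_conj QE detQ Qg z2).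
by rewrite se; exact: dual_stable_curv_cond.
Qed.

End FrameTransfer.

(** * Transport of twistors along a curve *)

Section Transport.
Variable R : realType.
Implicit Types (g h P Q : 'M[R]_4) (u : 'M[R]_(4 + 4)).

(** The action on TM + T*M of an isomorphism [P] of TM with inverse [Q]: [P] on vectors and the
    inverse transpose on covectors. *)
Definition transport P Q : 'M[R]_(4 + 4) := block_mx P 0 0 Q^T.
Definition transport_inv P Q : 'M[R]_(4 + 4) := block_mx Q 0 0 P^T.

Lemma transportK P Q : Q *m P = 1%:M -> transport P Q *m transport_inv P Q = 1%:M.
Proof.
move=> QP; rewrite /transport /transport_inv mulmx_block.
rewrite !(mul0mx, mulmx0, addr0, add0r) -trmx_mul !(mulmx1C QP) trmx1.
by rewrite -scalar_mx_block.
Qed.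

Lemma conj_isometry n (T Ti N N' u : 'M[R]_n) : T *m Ti = 1%:M ->
  T^T *m N' *m T = N -> u^T *m N *m u = N ->
  (T *m u *m Ti)^T *m N' *m (T *m u *m Ti) = N'.
Proof.
move=> TTi TN uN.
have -> : (T *m u *m Ti)^T *m N' *m (T *m u *m Ti) =
    Ti^T *m (u^T *m (T^T *m N' *m T) *m u) *m Ti by rewrite !trmx_mul !mulmxA.
rewrite TN uN -TN.
have -> : Ti^T *m (T^T *m N' *m T) *m Ti = (T *m Ti)^T *m N' *m (T *m Ti).
  by rewrite trmx_mul !mulmxA.
by rewrite TTi trmx1 mul1mx mulmx1.
Qed.

Lemma twistor_fibre_transport g h P Q u : g \in unitmx -> h \in unitmx ->
  Q *m P = 1%:M -> P^T *m h *m P = g -> twistor_fibre g u ->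
  twistor_fibre h (transport P Q *m u *m transport_inv P Q).
Proof.
move=> ug uh QP Ph /twistor_fibreP [H1 H2 H3].
have PQ : P *m Q = 1%:M := mulmx1C QP.
have TTi := transportK QP.
apply/twistor_fibreP; split.
- apply: (conj_isometry TTi) H1.
  rewrite /transport /swap_mx tr_block_mx trmxK !trmx0 !mulmx_block.
  rewrite !(mul0mx, mulmx0, mulmx1, addr0, add0r) -trmx_mul QP trmx1.
  by rewrite ?QP.
- apply: (conj_isometry TTi) H2.
  rewrite /transport /diag_metric tr_block_mx trmxK !trmx0 !mulmx_block.
  rewrite !(mul0mx, mulmx0, mulmx1, addr0, add0r) Ph; congr block_mx.
  have H : g *m (Q *m invmx h *m Q^T) = 1%:M.
    rewrite -Ph -!mulmxA [P *m _]mulmxA PQ mul1mx [h *m _]mulmxA mulmxV // mul1mx.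
    by rewrite -trmx_mul QP trmx1.
  by rewrite -[LHS]mul1mx -(mulVmx ug) -[LHS]mulmxA H mulmx1.
- have -> : transport P Q *m u *m transport_inv P Q *m (transport P Q *m u *m transport_inv P Q)
     = transport P Q *m (u *m (transport_inv P Q *m transport P Q) *m u) *m transport_inv P Q.
    by rewrite !mulmxA.
  by rewrite (mulmx1C TTi) mulmx1 H3 mulmxN mulNmx mulmx1 TTi.
Qed.

Lemma blockC_transport g h P Q u e : Q *m P = 1%:M -> P^T *m h *m P = g ->
  blockC h e (transport P Q *m u *m transport_inv P Q) = P *m blockC g e u *m Q.
Proof.
move=> QP Ph; have PQ : P *m Q = 1%:M := mulmx1C QP.
have PTh : P^T *m h = g *m Q by rewrite -Ph -mulmxA PQ mulmx1.
rewrite -[in LHS](submxK u) /transport /transport_inv !mulmx_block.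
rewrite !(mul0mx, mulmx0, addr0, add0r) blockC_block blockCE.
by rewrite -[_ *m h]mulmxA PTh mulmxDr mulmxDl -scalemxAr -scalemxAl !mulmxA.
Qed.

Lemma twistor_component_transport g h P Q u e1 e2 : g \in unitmx -> h \in unitmx ->
  Q *m P = 1%:M -> 0 < \det P -> P^T *m h *m P = g ->
  twistor_fibre_component g e1 e2 u ->
  twistor_fibre_component h e1 e2 (transport P Q *m u *m transport_inv P Q).
Proof.
move=> ug uh QP dP Ph [H1 H2 H3]; split.
- exact: twistor_fibre_transport Ph H1.
- by rewrite (blockC_transport _ _ QP Ph); exact: Zfibre_conj (mulmx1C QP) dP Ph H2.
- by rewrite (blockC_transport _ _ QP Ph); exact: Zfibre_conj (mulmx1C QP) dP Ph H3.
Qed.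

Lemma derivable_sum_fun (I : Type) (r : seq I) (F : I -> R -> R) (t : R) :
  (forall j, derivable (F j) t 1) -> derivable (fun s => \sum_(j <- r) F j s) t 1.
Proof.
move=> H; apply: ex_derive; apply: is_derive_fsum => j; exact/derivableP/H.
Qed.

Lemma derivable_prod_fun (I : Type) (r : seq I) (F : I -> R -> R) (t : R) :
  (forall j, derivable (F j) t 1) -> derivable (fun s => \prod_(j <- r) F j s) t 1.
Proof.
move=> H; elim: r => [|j r IH].
  under eq_fun do rewrite big_nil; exact: derivable_cst.
rewrite (_ : (fun _ => _) = fun s => F j s * \prod_(k <- r) F k s).
  exact: derivableM.
by apply/funext => s; rewrite big_cons.
Qed.

Lemma near_det_gt0 n (P : R -> 'M[R]_n) dP : is_derive (0 : R) 1 P dP ->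
  0 < \det (P 0) -> \forall t \near (0 : R), 0 < \det (P t).
Proof.
move=> /is_derive_mxP dPij P0.
suff dd : derivable (fun t => \det (P t)) 0 1.
  exact: (is_derive_near_gt0 (derivableP dd) P0).
rewrite /determinant; apply: derivable_sum_fun => s.
apply: derivableM; first exact: derivable_cst.
by apply: derivable_prod_fun => k; apply: ex_derive.
Qed.

(* Since 1 - t w is an isometry to first order, the Gram-Schmidt correction has
   derivative zero at t = 0. *)
Lemma isometric_curve (gt : R -> 'M[R]_4) (w : 'M[R]_4) :
  (\forall t \near (0 : R), (gt t)^T = gt t) ->
  (forall X, X != 0 -> 0 < bilin (gt 0) X X) ->
  is_derive (0 : R) 1 gt (gt 0 *m w + w^T *m gt 0) ->
  exists P : R -> 'M[R]_4, [/\ P 0 = 1%:M, is_derive (0 : R) 1 P (- w) &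
    \forall t \near (0 : R), (P t)^T *m gt t *m P t = gt 0 /\ 0 < \det (P t)].
Proof.
move=> symg posg dg.
pose Q (t : R) : 'M[R]_4 := 1%:M - t *: w.
have Q0 : Q 0 = 1%:M by rewrite /Q scale0r subr0.
have dQ : is_derive (0 : R) 1 Q (- w).
  have dt : is_derive (0 : R) 1 (fun t : R => t *: w) w.
    apply: is_derive_eq.
      exact: is_derive_scalemx (is_derive_id _ _) (is_derive_cst w _ _).
    by rewrite scaler0 addr0 scale1r.
  have := is_deriveB (@is_derive_cst R R 'M[R]_4 1%:M 0 1) dt.
  by rewrite sub0r.
pose S t := (Q t)^T *m gt t *m Q t.
have S0 : S 0 = gt 0 by rewrite /S Q0 trmx1 mul1mx mulmx1.
have symS : \forall t \near (0 : R), (S t)^T = S t.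
  by apply: filterS symg => t ht; rewrite /S !trmx_mul trmxK ht mulmxA.
have posS X : X != 0 -> 0 < bilin (S 0) X X by rewrite S0; exact: posg.
have dS : is_derive (0 : R) 1 S 0.
  apply: is_derive_eq.
    exact: is_derive_mulmx (is_derive_mulmx (is_derive_trmx dQ) dg) dQ.
  rewrite /= Q0 trmx1 !mul1mx mulmx1 linearN /= mulNmx mulmxN.
  by apply/matrixP => k l; rewrite !mxE; ring.
have [K [KSK detK dK]] := gram_schmidt_curve symS posS dS.
have K0 := nbhs_singleton KSK; rewrite S0 in K0.
(* The inverse of [K 0], since [K 0] is an orthonormal frame for [gt 0]; it makes the curve start at
   the identity. *)
pose L := (K 0)^T *m gt 0.
have KL : K 0 *m L = 1%:M by apply: mulmx1C.
have dP : is_derive (0 : R) 1 (fun t => Q t *m K t *m L) (- w).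
  apply: is_derive_eq.
    exact: is_derive_mulmx (is_derive_mulmx dQ dK) (is_derive_cst L _ _).
  by rewrite !mulmx0 !addr0 -mulmxA KL mulmx1.
have P0 : Q 0 *m K 0 *m L = 1%:M by rewrite Q0 mul1mx KL.
exists (fun t => Q t *m K t *m L); split=> //.
have detP : \forall t \near (0 : R), 0 < \det (Q t *m K t *m L).
  by apply: near_det_gt0 dP _; rewrite P0 det1.
apply: filterS2 KSK detP => t ht dt; split=> //.
have -> : (Q t *m K t *m L)^T *m gt t *m (Q t *m K t *m L) =
    L^T *m ((K t)^T *m S t *m K t) *m L by rewrite !trmx_mul /S !mulmxA.
rewrite ht mulmx1 {1}/L trmx_mul trmxK (nbhs_singleton symg) -mulmxA KL mulmx1 //.
Qed.

End Transport.


(** * Smooth maps on the space of pairs (x, u) *)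

Section MoreSmoothness.
Variable R : realType.

Lemma ndiff_pair (V W1 W2 : normedModType R) (U : set V) n (f : V -> W1) (h : V -> W2) :
  open U -> ndiff n U f -> ndiff n U h -> ndiff n U (fun x => (f x, h x)).
Proof.
move=> openU; elim: n f h => [|n IH] f h hf hh.
  split=> // x Ux; apply: differentiable_pair; first exact: ndiff_differentiable hf Ux.
  exact: ndiff_differentiable hh Ux.
split=> [x Ux|v].
  by apply: differentiable_pair; [exact: ndiff_differentiable hf Ux|
    exact: ndiff_differentiable hh Ux].
have := IH _ _ (ndiff_derive v hf) (ndiff_derive v hh).
apply: ndiff_eq => // x Ux; apply/esym/derive_val.
by apply: is_derive_pair; apply/derivableP/diff_derivable;
  [exact: ndiff_differentiable hf Ux|exact: ndiff_differentiable hh Ux].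
Qed.

Lemma differentiable_fst_comp (V1 V2 W : normedModType R) (f : V1 -> W) (q : V1 * V2) :
  differentiable f q.1 -> differentiable (fun q : V1 * V2 => f q.1) q.
Proof.
move=> df; apply: (@differentiable_comp _ _ _ _ fst f) => //.
by apply: linear_differentiable => x; exact: cvg_fst.
Qed.

Lemma differentiable_snd_comp (V1 V2 W : normedModType R) (f : V2 -> W) (q : V1 * V2) :
  differentiable f q.2 -> differentiable (fun q : V1 * V2 => f q.2) q.
Proof.
move=> df; apply: (@differentiable_comp _ _ _ _ snd f) => //.
by apply: linear_differentiable => x; exact: cvg_snd.
Qed.

Lemma ndiff_fst_comp (V1 V2 W : normedModType R) (U : set V1) n (f : V1 -> W) :
  ndiff n U f -> ndiff n [set q : V1 * V2 | U q.1] (fun q => f q.1).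
Proof.
elim: n f => [|n IH] f hf.
  by split=> // q Uq; apply: differentiable_fst_comp; exact: ndiff_differentiable hf Uq.
split=> [q Uq|v].
  by apply: differentiable_fst_comp; exact: ndiff_differentiable hf Uq.
exact: (IH _ (ndiff_derive v.1 hf)).
Qed.

Lemma ndiff_snd_comp (V1 V2 W : normedModType R) (U : set V2) n (f : V2 -> W) :
  ndiff n U f -> ndiff n [set q : V1 * V2 | U q.2] (fun q => f q.2).
Proof.
elim: n f => [|n IH] f hf.
  by split=> // q Uq; apply: differentiable_snd_comp; exact: ndiff_differentiable hf Uq.
split=> [q Uq|v].
  by apply: differentiable_snd_comp; exact: ndiff_differentiable hf Uq.
exact: (IH _ (ndiff_derive v.2 hf)).
Qed.

Lemma ndiff_id (V : normedModType R) (U : set V) n : ndiff n U (@id V).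
Proof.
case: n => [|n]; first by split=> // x _; exact: ex_diff.
split=> [x _|v]; first exact: ex_diff.
by rewrite (_ : 'D_v id = cst v); [exact: ndiff_cst|apply/funext => x; rewrite derive_id].
Qed.

Lemma ndiff_sub (V W : normedModType R) (U U' : set V) n (f : V -> W) :
  U `<=` U' -> ndiff n U' f -> ndiff n U f.
Proof.
move=> UU'; elim: n f => [|n IH] f [df Hf]; split=> //.
- by move=> x Ux; apply: df; exact: UU'.
- by move=> x Ux; apply: df; exact: UU'.
- by move=> v; exact: IH (Hf v).
Qed.

Section Matrices.
Variables (V : normedModType R) (U : set V).
Hypothesis openU : open U.

Lemma ndiff_mulmx k m n p (f : V -> 'M[R]_(m, n)) (h : V -> 'M[R]_(n, p)) :
  ndiff k U f -> ndiff k U h -> ndiff k U (fun x => f x *m h x).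
Proof.
move=> /(ndiff_mxP openU) hf /(ndiff_mxP openU) hh; apply/(ndiff_mxP openU) => a b.
apply: (@ndiff_eq _ _ _ _ openU _ (fun x => \sum_j f x a j * h x j b)).
  by move=> x _; rewrite mxE.
by apply: ndiff_sum => // j; exact: ndiffM.
Qed.

Lemma ndiff_oppmx k m n (f : V -> 'M[R]_(m, n)) :
  ndiff k U f -> ndiff k U (fun x => - f x).
Proof.
move=> /(ndiff_mxP openU) hf; apply/(ndiff_mxP openU) => a b.
apply: (@ndiff_eq _ _ _ _ openU _ (fun x => (-1) * f x a b)).
  by move=> x _; rewrite mxE mulN1r.
by apply: ndiffM => //; exact: ndiff_cst.
Qed.

Lemma ndiff_diag_dual k (f : V -> 'M[R]_4) :
  ndiff k U f -> ndiff k U (fun x => diag_dual (f x)).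
Proof.
move=> hf; have /(ndiff_mxP openU) hN := ndiff_oppmx hf.
move/(ndiff_mxP openU): hf => hf; apply/(ndiff_mxP openU) => a b.
rewrite -[a]splitK -[b]splitK.
have E := (block_mxEul, block_mxEur, block_mxEdl, block_mxEdr).
case: (fintype.split a) => a'; case: (fintype.split b) => b' /=.
- by apply: ndiff_eq (hf a' b') => // x _; rewrite E.
- by apply: ndiff_eq (ndiff_cst U k (0 : R)) => // x _; rewrite E mxE.
- by apply: ndiff_eq (ndiff_cst U k (0 : R)) => // x _; rewrite E mxE.
- by apply: ndiff_eq (hN b' a') => // x _; rewrite E !mxE.
Qed.
End Matrices.
End MoreSmoothness.

(** * The Nijenhuis tensor over a chart *)

Section NijenhuisAlgebra.
Variables (R : realType) (n : nat) (u : 'M[R]_n).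
Hypothesis uu : u *m u = - 1%:M.

Let br (A : 'M[R]_n) := A *m u - u *m A.

(* Here a, b are the vertical parts of two vectors over X, Y; OX, OY, PX, PY are
   the connection forms of X, Y, u1 X, u1 Y; dXY is the derivative along X of the
   connection form at Y, with P in front of an argument multiplied by u1.  The
   letters Z and W, the connection forms of the derivatives of u1, cancel. *)
Lemma nijenhuis_vertical (a b OX OY PX PY Z1 Z2 Z3 Z4 W D1 D2 D3 D4 : 'M[R]_n)
    (dXY dYX dPXY dYPX dXPY dPYX dPXPY dPYPX : 'M[R]_n) :
  let com A B := A *m B - B *m A in
  let Ja := u *m a - br PX in let Jb := u *m b - br PY in
  let a' := a - br OX in let b' := b - br OY in
  let DJ d dP Z O P w v := - (br (dP + Z) + com P w) + (w *m v + u *m (br d + com O w)) in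
  Z1 - Z2 + W = 0 ->
  D1 = DJ dPXY dPXPY Z1 OY PY Ja b -> D2 = DJ dPYX dPYPX Z2 OX PX Jb a ->
  D3 = DJ dYX dYPX Z3 OX PX b' a -> D4 = DJ dXY dXPY Z4 OY PY a' b ->
  D1 - D2 + (- br W + u *m (D3 - D4 + br (Z3 - Z4))) =
  - br ((dPXPY - dPYPX + com PX PY) - (dXY - dYX + com OX OY))
    + u *m br ((dPXY - dYPX + com PX OY) + (dXPY - dPYX + com OX PY)).
Proof.
move=> com Ja Jb a' b' DJ H -> -> -> ->.
have {H} -> : W = Z2 - Z1.
  by apply: (addrI (Z1 - Z2)); rewrite H addrA subrK subrr.
rewrite /DJ /a' /b' /Ja /Jb /com /br {DJ a' b' Ja Jb com}.
have uuX m (X : 'M[R]_(m, n)) : X *m u *m u = - X.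
  by rewrite -mulmxA uu mulmxN mulmx1.
rewrite !(mulmxDl, mulmxDr, mulmxBl, mulmxBr, mulmxN, mulNmx, opprD, opprB, opprK, mulmxA).
rewrite !(uu, uuX, mulNmx, mul1mx, opprK).
have addE (A B : 'M[R]_n) i j : (A + B) i j = A i j + B i j by rewrite mxE.
have oppE (A : 'M[R]_n) i j : (- A) i j = - A i j by rewrite mxE.
apply/matrixP => i j; rewrite !(addE, oppE); ring.
Qed.

End NijenhuisAlgebra.

Lemma posdef_unit (R : realType) n (g : 'M[R]_n) :
  (forall X, X != 0 -> 0 < bilin g X X) -> g \in unitmx.
Proof.
move=> pos; rewrite -row_free_unit -kermx_eq0; apply/negPn/negP => /rowV0Pn [v].
move=> /sub_kermxP vg v0.
have /pos : v^T != 0 by apply: contra_neq v0 => /(congr1 trmx); rewrite trmxK trmx0.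
by rewrite /bilin trmxK vg mul0mx mxE ltxx.
Qed.

Lemma is_derive_comp_curve (R : realType) (V W : normedModType R) (f : R -> V)
    (h : V -> W) (t : R) df :
  is_derive t 1 f df -> differentiable h (f t) ->
  is_derive t 1 (fun s => h (f s)) ('D_df h (f t)).
Proof.
move=> [df1 <-] dh.
have dft : differentiable f t by exact/derivable1_diffP.
have dhf : differentiable (h \o f) t by exact: differentiable_comp.
apply: DeriveDef; first exact: diff_derivable.
by rewrite deriveE // diff_comp //= -deriveE // -deriveE.
Qed.

Section Chart.
Variables (R : realType) (M : topologicalType) (A : oriented_atlas R M).
Variables (g : riemannian_metric A) (i : idx A).

Let U := @codom_chart R M A i.
Let G := gmx g i.
Let openU : open U. Proof. exact: codom_open. Qed.
Let smoothG : smooth_on U G. Proof. exact: gmx_smooth. Qed.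
Let symG x : U x -> (G x)^T = G x. Proof. exact: gmx_sym. Qed.
Let posG x X : U x -> X != 0 -> 0 < bilin (G x) X X. Proof. exact: gmx_pos. Qed.
Let unitG x : U x -> G x \in unitmx.
Proof. by move=> Ux; apply: posdef_unit => X; exact: posG. Qed.
Let Om x X := connection_form_TT g i x X.
Let om x X := connection_form G x X.
Implicit Types (p q w v : twistor_coord R) (e : sign).

Lemma connection_form_TTE x X : Om x X = diag_dual (om x X).
Proof. by []. Qed.

Lemma connection_formD x X Y : om x (X + Y) = om x X + om x Y.
Proof.
rewrite /om /connection_form -big_split; apply: eq_bigr => k _.
by rewrite mxE scalerDl.
Qed.

Lemma connection_formZ c x X : om x (c *: X) = c *: om x X.
Proof.
rewrite /om /connection_form scaler_sumr; apply: eq_bigr => k _.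
by rewrite mxE scalerA.
Qed.

Lemma diag_dualD r r' : diag_dual (r + r') = diag_dual r + diag_dual r' :> 'M[R]_(4 + 4).
Proof. by rewrite /diag_dual add_block_mx !addr0 linearD opprD. Qed.

Lemma diag_dualN r : diag_dual (- r) = - diag_dual r :> 'M[R]_(4 + 4).
Proof. by rewrite /diag_dual opp_block_mx !oppr0 linearN. Qed.

Lemma diag_dual_com r r' : diag_dual (r *m r' - r' *m r) =
  diag_dual r *m diag_dual r' - diag_dual r' *m diag_dual r :> 'M[R]_(4 + 4).
Proof.
rewrite /diag_dual !mulmx_block !(mul0mx, mulmx0, addr0, add0r) opp_block_mx.
rewrite add_block_mx !subrr; congr block_mx.
by rewrite linearB /= !trmx_mul !mulNmx !mulmxN !opprK opprB.
Qed.

Definition dconnection (x X Y : 'cV[R]_4) : 'M[R]_4 := \sum_k Y k 0 *: 'D_X (christoffel G k) x.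

Lemma is_derive_base (W : normedModType R) (f : 'cV[R]_4 -> W) p w :
  differentiable f p.1 -> is_derive p w (fun q => f q.1) ('D_w.1 f p.1).
Proof.
by move=> df; apply: is_derive_fst_comp; exact/derivableP/diff_derivable.
Qed.

Lemma is_derive_fibre p w : is_derive p w (fun q => q.2) w.2.
Proof. exact: (is_derive_snd (is_derive_id p w)). Qed.

Lemma is_derive_blockC e p w : U p.1 ->
  is_derive p w (fun q => blockC (G q.1) e q.2)
    (blockC (G p.1) e w.2 + sg R e *: (ursubmx p.2 *m 'D_w.1 G p.1)).
Proof.
move=> Up; have dG := is_derive_base w (differentiable_g smoothG Up).
have d2 := is_derive_fibre p w.
rewrite (_ : (fun _ => _) = fun q => ulsubmx q.2 + sg R e *: (ursubmx q.2 *m G q.1)).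
  apply: is_derive_eq.
    exact: is_deriveD (is_derive_ulsubmx d2)
      (is_deriveZ _ (is_derive_mulmx (is_derive_ursubmx d2) dG)).
  by rewrite blockCE scalerDr addrA.
by apply/funext => q; rewrite blockCE.
Qed.

Lemma is_derive_connection p w (Y : twistor_coord R -> 'cV[R]_4) dY : U p.1 ->
  is_derive p w Y dY ->
  is_derive p w (fun q => Om q.1 (Y q))
    (diag_dual (dconnection p.1 w.1 (Y p)) + Om p.1 dY).
Proof.
move=> Up /is_derive_mxP hY.
have H : is_derive p w (fun q => om q.1 (Y q))
    (dconnection p.1 w.1 (Y p) + om p.1 dY).
  rewrite addrC /om /connection_form /dconnection -big_split.
  apply: is_derive_fsum => k; have dk := is_derive_base w
    (differentiable_christoffel openU smoothG unitG k Up).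
  exact: is_derive_scalemx (hY k 0) dk.
have d0 : is_derive p w (fun _ : twistor_coord R => 0 : 'M[R]_4) 0.
  exact: is_derive_cst.
have := is_derive_block_mx H d0 d0 (is_deriveN (is_derive_trmx H)).
by rewrite -/(diag_dual _) diag_dualD.
Qed.

Lemma J1E p v : J1 g i p v =
  (blockC (G p.1) Plus p.2 *m v.1,
   - (Om p.1 (blockC (G p.1) Plus p.2 *m v.1) *m p.2
      - p.2 *m Om p.1 (blockC (G p.1) Plus p.2 *m v.1))
   + p.2 *m (v.2 + (Om p.1 v.1 *m p.2 - p.2 *m Om p.1 v.1))).
Proof.
rewrite /J1 /hlift /vpart /ad_connection /=.
by congr pair; rewrite ?addr0 // opprK.
Qed.

(* The derivative at p in the direction w of q |-> J1 q v, for a fixed v. *)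
Definition DJ1 p w v : twistor_coord R :=
  let u := p.2 in
  let u1 := blockC (G p.1) Plus u in
  let du1 := blockC (G p.1) Plus w.2 + ursubmx u *m 'D_w.1 G p.1 in
  let br B := B *m u - u *m B in
  let com B C := B *m C - C *m B in
  (du1 *m v.1,
   - (br (diag_dual (dconnection p.1 w.1 (u1 *m v.1)) + Om p.1 (du1 *m v.1))
      + com (Om p.1 (u1 *m v.1)) w.2)
   + (w.2 *m (v.2 + br (Om p.1 v.1))
      + u *m (br (diag_dual (dconnection p.1 w.1 v.1)) + com (Om p.1 v.1) w.2))).

Lemma connection_TTD x X Y : Om x (X + Y) = Om x X + Om x Y.
Proof. by rewrite !connection_form_TTE connection_formD diag_dualD. Qed.

Lemma connection_TTN x X : Om x (- X) = - Om x X.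
Proof.
by rewrite !connection_form_TTE -scaleN1r connection_formZ scaleN1r diag_dualN.
Qed.

(** The fibre component of the product rule for q |-> J1 q (B q): the left side is the raw
    derivative, and the right side separates the derivative of [J1] from [J1] applied to the
    derivative of [B]. *)
Lemma J1_product_rule (u u' v v' c c' d d1 O1 O O1' : 'M[R]_(4 + 4)) :
  - ((d + (c + c')) *m u - u *m (d + (c + c')) + (O1 *m u' - u' *m O1))
  + (u' *m (v + (O *m u - u *m O))
     + u *m (v' + ((d1 + O1') *m u - u *m (d1 + O1') + (O *m u' - u' *m O)))) =
  - ((d + c) *m u - u *m (d + c) + (O1 *m u' - u' *m O1))
  + (u' *m (v + (O *m u - u *m O))
     + u *m (d1 *m u - u *m d1 + (O *m u' - u' *m O)))
  + (- (c' *m u - u *m c') + u *m (v' + (O1' *m u - u *m O1'))).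
Proof.
have addE (C D : 'M[R]_(4 + 4)) a b : (C + D) a b = C a b + D a b by rewrite mxE.
have oppE (C : 'M[R]_(4 + 4)) a b : (- C) a b = - C a b by rewrite mxE.
rewrite !(mulmxDl, mulmxDr, mulmxBl, mulmxBr, mulmxN, mulNmx, opprD, opprB, opprK).
by apply/matrixP => a b; rewrite !(addE, oppE); ring.
Qed.

Lemma is_derive_J1 p w (B : twistor_coord R -> twistor_coord R) dB : U p.1 ->
  is_derive p w B dB ->
  is_derive p w (fun q => J1 g i q (B q)) (DJ1 p w (B p) + J1 g i p dB).
Proof.
move=> Up hB; have h1 := is_derive_fst hB; have h2 := is_derive_snd hB.
have du := is_derive_fibre p w; have du1 := is_derive_blockC Plus w Up.
have -> : (fun q => J1 g i q (B q)) = fun q =>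
    let Y := blockC (G q.1) Plus q.2 *m (B q).1 in
    (Y, - (Om q.1 Y *m q.2 - q.2 *m Om q.1 Y)
        + q.2 *m ((B q).2 + (Om q.1 (B q).1 *m q.2 - q.2 *m Om q.1 (B q).1))).
  by apply/funext => q; rewrite J1E.
have dv := is_derive_mulmx du1 h1.
have dO1 := is_derive_connection Up dv; have dO := is_derive_connection Up h1.
have dbr O dO' : is_derive p w O dO' -> is_derive p w (fun q => O q *m q.2 - q.2 *m O q)
    (dO' *m p.2 - p.2 *m dO' + (O p *m w.2 - w.2 *m O p)).
  move=> hO; apply: is_derive_eq.
    exact: is_deriveB (is_derive_mulmx hO du) (is_derive_mulmx du hO).
  by apply/matrixP => a b; rewrite !mxE; ring.
apply: is_derive_eq.
  exact: (is_derive_pair dv (is_deriveD (is_deriveN (dbr _ _ dO1))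
    (is_derive_mulmx du (is_deriveD h2 (dbr _ _ dO))))).
rewrite J1E /DJ1 /= scale1r; congr pair.
by rewrite !connection_TTD; exact: J1_product_rule.
Qed.

Lemma J1D p v w : J1 g i p (v + w) = J1 g i p v + J1 g i p w.
Proof.
have H (u a b c d e f : 'M[R]_(4 + 4)) :
    - ((a + b) *m u - u *m (a + b)) + u *m (c + d + ((e + f) *m u - u *m (e + f))) =
    - (a *m u - u *m a) + u *m (c + (e *m u - u *m e))
    + (- (b *m u - u *m b) + u *m (d + (f *m u - u *m f))).
  rewrite !(mulmxDl, mulmxDr, mulmxN, mulNmx, opprD, opprK).
  by apply/matrixP => k l; rewrite !mxE; ring.
rewrite !J1E; congr pair; first exact: mulmxDr.
by rewrite mulmxDr !connection_TTD; exact: H.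
Qed.

Lemma J1N p v : J1 g i p (- v) = - J1 g i p v.
Proof.
have J0 : J1 g i p 0 = 0.
  by apply: (addrI (J1 g i p 0)); rewrite -J1D !addr0.
by apply: (addrI (J1 g i p v)); rewrite -J1D !subrr.
Qed.

(** [J1] acts by [u1] on the horizontal part and by left multiplication by u on the vertical part,
    and both square to -1 whether or not [v] is tangent. *)
Lemma J1K p v : p.2 *m p.2 = - 1%:M ->
  blockC (G p.1) Plus p.2 *m blockC (G p.1) Plus p.2 = - 1%:M ->
  J1 g i p (J1 g i p v) = - v.
Proof.
move=> uu u1u1; rewrite [J1 g i p v]J1E J1E /=.
set u1 := blockC _ _ _ in u1u1 *.
have u1K (Z : 'cV[R]_4) : u1 *m (u1 *m Z) = - Z.
  by rewrite mulmxA u1u1 mulNmx mul1mx.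
rewrite u1K !connection_TTN [- _ + _ + _]addrAC addNr add0r.
rewrite [in RHS](surjective_pairing v); congr pair.
rewrite mulmxA uu !(mulNmx, mulmxN, mul1mx) opprD !opprK.
have addE (C D : 'M[R]_(4 + 4)) k l : (C + D) k l = C k l + D k l by rewrite mxE.
have oppE (C : 'M[R]_(4 + 4)) k l : (- C) k l = - C k l by rewrite mxE.
by apply/matrixP => k l; rewrite !(addE, oppE); ring.
Qed.

(** The [x] are derivatives of J and the [y] derivatives of the two fields; each [y] occurs once
    directly and once through J applied twice, with cancelling signs. *)
Lemma nijenhuis_cancel (J : twistor_coord R -> twistor_coord R) :
  (forall v w, J (v + w) = J v + J w) -> (forall v, J (- v) = - J v) ->
  (forall v, J (J v) = - v) ->
  forall x1 x2 x3 x4 y1 y2 y3 y4,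
    x1 + J y1 - (x2 + J y2) - J (y1 - (x3 + J y3)) - J (x4 + J y4 - y2) - (y4 - y3) =
    x1 - x2 + J (x3 - x4).
Proof.
move=> JD JN JK x1 x2 x3 x4 y1 y2 y3 y4.
rewrite (JD y1) (JN (_ + _)) (JD x3) (JK y3) (JD (_ + _)) (JD x4) (JK y4) (JN y2).
rewrite (JD x3) (JN x4).
move: (J x3) (J x4) (J y1) (J y2) => z3 z4 t1 t2.
by apply: injective_projections => /=; apply/matrixP => k l; rewrite !mxE; ring.
Qed.

Lemma nijenhuis_tensor p V1 V2 (a := V1 p) (b := V2 p) : U p.1 ->
  p.2 *m p.2 = - 1%:M ->
  blockC (G p.1) Plus p.2 *m blockC (G p.1) Plus p.2 = - 1%:M ->
  differentiable V1 p -> differentiable V2 p ->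
  nijenhuis (J1 g i) V1 V2 p =
    DJ1 p (J1 g i p a) b - DJ1 p (J1 g i p b) a
    + J1 g i p (DJ1 p b a - DJ1 p a b).
Proof.
move=> Up uu u1u1 d1 d2.
have D1 w : 'D_w (fun q => J1 g i q (V1 q)) p = DJ1 p w a + J1 g i p ('D_w V1 p).
  by apply: derive_val; apply: is_derive_J1 => //; exact/derivableP/diff_derivable.
have D2 w : 'D_w (fun q => J1 g i q (V2 q)) p = DJ1 p w b + J1 g i p ('D_w V2 p).
  by apply: derive_val; apply: is_derive_J1 => //; exact/derivableP/diff_derivable.
have unfold d1' d2' d3' d4' : 'D_(J1 g i p a) (fun q => J1 g i q (V2 q)) p = d1' ->
    'D_(J1 g i p b) (fun q => J1 g i q (V1 q)) p = d2' ->
    'D_b (fun q => J1 g i q (V1 q)) p = d3' ->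
    'D_a (fun q => J1 g i q (V2 q)) p = d4' ->
    nijenhuis (J1 g i) V1 V2 p = d1' - d2'
      - J1 g i p ('D_(J1 g i p a) V2 p - d3') - J1 g i p (d4' - 'D_(J1 g i p b) V1 p)
      - ('D_a V2 p - 'D_b V1 p).
  by move=> <- <- <- <-.
exact: (etrans (unfold _ _ _ _ (D2 _) (D1 _) (D1 _) (D2 _))
  (nijenhuis_cancel (J1D p) (J1N p) (fun v => J1K v uu u1u1) _ _ _ _ _ _ _ _)).
Qed.

(** [vpart] unfolded: the covariant derivative of the endomorphism in the direction [v]. *)
Definition vertical p v := v.2 + (Om p.1 v.1 *m p.2 - p.2 *m Om p.1 v.1).

(** The derivative of the metric in that of [u1] is exactly the correction term of [blockC_bracket],
    since the connection is metric. What remains is the covariant derivative of [u1] minus a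
    commutator. *)
Lemma derive_blockC_plus p w (u1 := blockC (G p.1) Plus p.2) : U p.1 ->
  blockC (G p.1) Plus w.2 + ursubmx p.2 *m 'D_w.1 G p.1 =
  blockC (G p.1) Plus (vertical p w) - (om p.1 w.1 *m u1 - u1 *m om p.1 w.1).
Proof.
move=> Up; rewrite (derive_g openU smoothG symG unitG w.1 Up) /vertical.
rewrite blockCD -[Om p.1 w.1]/(diag_dual (om p.1 w.1)) blockC_bracket /= scale1r -/u1 -/(om _ _).
by rewrite -[RHS]addrA; congr (_ + _); rewrite addrAC subrr add0r.
Qed.

Lemma vertical_J1 p v : vertical p (J1 g i p v) = p.2 *m vertical p v.
Proof. by rewrite /vertical J1E /= addrAC [- _ + _]addrC subrr add0r. Qed.

Lemma DJ1_fst p w v (u1 := blockC (G p.1) Plus p.2) : U p.1 ->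
  (DJ1 p w v).1 = (blockC (G p.1) Plus (vertical p w)
    - (om p.1 w.1 *m u1 - u1 *m om p.1 w.1)) *m v.1.
Proof. by move=> Up; rewrite -derive_blockC_plus. Qed.

Lemma J1_fst p w : (J1 g i p w).1 = blockC (G p.1) Plus p.2 *m w.1.
Proof. by rewrite J1E. Qed.

Lemma J1_snd p w (u1 := blockC (G p.1) Plus p.2) : (J1 g i p w).2 =
  - (Om p.1 (u1 *m w.1) *m p.2 - p.2 *m Om p.1 (u1 *m w.1)) + p.2 *m vertical p w.
Proof. by rewrite J1E. Qed.

Lemma DJ1_snd p w v (u1 := blockC (G p.1) Plus p.2) :
  let br B := B *m p.2 - p.2 *m B in
  let com B C := B *m C - C *m B in
  (DJ1 p w v).2 =
   - (br (diag_dual (dconnection p.1 w.1 (u1 *m v.1)) + Om p.1 (DJ1 p w v).1)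
      + com (Om p.1 (u1 *m v.1)) w.2)
   + (w.2 *m vertical p v
      + p.2 *m (br (diag_dual (dconnection p.1 w.1 v.1)) + com (Om p.1 v.1) w.2)).
Proof. by []. Qed.

(* Without this, unification unfolds these terms and does not end. *)
Local Opaque J1 DJ1.

(** [al] and [be] are the endomorphisms of TM induced by the two vertical parts, and [oX], [oY],
    [pX], [pY] the connection forms of X, Y, u1 X, u1 Y; the four symmetry hypotheses express the
    absence of torsion. *)
Lemma vertical_fst_cancel (u1 al be oX oY pX pY : 'M[R]_4) (X Y D1 D2 D3 D4 : 'cV[R]_4) :
  u1 *m u1 = - 1%:M ->
  pX *m (u1 *m Y) = pY *m (u1 *m X) -> pX *m Y = oY *m (u1 *m X) ->
  pY *m X = oX *m (u1 *m Y) -> oY *m X = oX *m Y ->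
  D1 = (u1 *m al - (pX *m u1 - u1 *m pX)) *m Y ->
  D2 = (u1 *m be - (pY *m u1 - u1 *m pY)) *m X ->
  D3 = (be - (oY *m u1 - u1 *m oY)) *m X ->
  D4 = (al - (oX *m u1 - u1 *m oX)) *m Y ->
  D1 - D2 + u1 *m (D3 - D4) = 0.
Proof.
move=> u1u1 s1 s2 s3 s4 -> -> -> ->.
have u1K (Z : 'cV[R]_4) : u1 *m (u1 *m Z) = - Z.
  by rewrite mulmxA u1u1 mulNmx mul1mx.
rewrite !(mulmxDl, mulmxDr, mulmxBl, mulmxBr, mulmxN, mulNmx, opprD, opprB, opprK).
rewrite -!mulmxA !u1K s1 s2 s3 s4 ?mulmxN ?opprK.
have addE (C D : 'cV[R]_4) x y : (C + D) x y = C x y + D x y by rewrite mxE.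
have oppE (C : 'cV[R]_4) x y : (- C) x y = - C x y by rewrite mxE.
apply/matrixP => x y; rewrite !(addE, oppE) [RHS]mxE; ring.
Qed.

Lemma DJ1_J1_fst p a b (u1 := blockC (G p.1) Plus p.2) : U p.1 ->
  preserves (G p.1) Plus (vertical p a) ->
  (DJ1 p (J1 g i p a) b).1 = (u1 *m blockC (G p.1) Plus (vertical p a)
    - (om p.1 (u1 *m a.1) *m u1 - u1 *m om p.1 (u1 *m a.1))) *m b.1.
Proof.
move=> Up pa; rewrite (DJ1_fst (J1 g i p a) b Up) vertical_J1 J1_fst.
by rewrite (blockC_mul _ pa).
Qed.

Lemma nijenhuis_horizontal p (a b : twistor_coord R) : U p.1 ->
  blockC (G p.1) Plus p.2 *m blockC (G p.1) Plus p.2 = - 1%:M ->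
  preserves (G p.1) Plus (vertical p a) -> preserves (G p.1) Plus (vertical p b) ->
  (DJ1 p (J1 g i p a) b).1 - (DJ1 p (J1 g i p b) a).1
  + blockC (G p.1) Plus p.2 *m ((DJ1 p b a).1 - (DJ1 p a b).1) = 0.
Proof.
move=> Up u1u1 pa pb.
have sym X Y := connection_form_sym openU smoothG symG X Y Up.
exact: (vertical_fst_cancel u1u1 (sym _ _) (sym _ _) (sym _ _) (sym _ _)
  (DJ1_J1_fst b Up pa) (DJ1_J1_fst a Up pb) (DJ1_fst b a Up) (DJ1_fst a b Up)).
Qed.

Definition chart_curvature x k l := curvature G k l x.

(** The structure equation of the connection; X and Y have constant coefficients, so no bracket term
    occurs. *)
Lemma dconnection_curvature x X Y : U x ->
  dconnection x X Y - dconnection x Y X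
    + (om x X *m om x Y - om x Y *m om x X) = Rm (chart_curvature x) X Y.
Proof.
move=> Ux.
have dE Z T : dconnection x Z T =
    \sum_k \sum_l (Z k 0 * T l 0) *: 'D_(ebase R k) (christoffel G l) x.
  rewrite /dconnection [RHS]exchange_big; apply: eq_bigr => l _.
  rewrite derive_ebase; last exact: (differentiable_christoffel openU smoothG unitG).
  by rewrite scaler_sumr; apply: eq_bigr => k _; rewrite scalerA mulrC.
have oE Z T : om x Z *m om x T =
    \sum_k \sum_l (Z k 0 * T l 0) *: (christoffel G k x *m christoffel G l x).
  rewrite /om /connection_form mulmx_suml; apply: eq_bigr => k _.
  rewrite mulmx_sumr; apply: eq_bigr => l _.
  by rewrite -scalemxAl -scalemxAr scalerA.
rewrite (dE X Y) (oE X Y) (dE Y X) (oE Y X).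
rewrite [X in _ - X + _]exchange_big [X in _ + (_ - X)]exchange_big.
rewrite -!sumrB -big_split; apply: eq_bigr => k _ /=.
rewrite -!sumrB -big_split; apply: eq_bigr => l _ /=.
rewrite [Y l 0 * _]mulrC -!scalerBr -scalerDr /chart_curvature /curvature.
by rewrite addrA.
Qed.

Lemma nijenhuis_J1 p V1 V2 (a := V1 p) (b := V2 p)
    (u1 := blockC (G p.1) Plus p.2) (K := Rm (chart_curvature p.1)) : U p.1 ->
  p.2 *m p.2 = - 1%:M -> u1 *m u1 = - 1%:M ->
  differentiable V1 p -> differentiable V2 p ->
  preserves (G p.1) Plus (vertical p a) -> preserves (G p.1) Plus (vertical p b) ->
  let F1 := diag_dual (K (u1 *m a.1) (u1 *m b.1) - K a.1 b.1) in
  let F2 := diag_dual (K (u1 *m a.1) b.1 + K a.1 (u1 *m b.1)) in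
  nijenhuis (J1 g i) V1 V2 p =
    (0, - (F1 *m p.2 - p.2 *m F1) + p.2 *m (F2 *m p.2 - p.2 *m F2)).
Proof.
move=> Up uu u1u1 d1 d2 pa pb F1 F2.
rewrite nijenhuis_tensor // -/a -/b.
have N1 := nijenhuis_horizontal Up u1u1 pa pb.
have fstE (x1 x2 x3 x4 : twistor_coord R) : (x1 - x2 + J1 g i p (x3 - x4)).1 =
    x1.1 - x2.1 + u1 *m (x3.1 - x4.1) by rewrite J1E.
have sndE (x1 x2 x3 x4 : twistor_coord R) : (x1 - x2 + J1 g i p (x3 - x4)).2 =
    x1.2 - x2.2
    + (- (Om p.1 (u1 *m (x3.1 - x4.1)) *m p.2 - p.2 *m Om p.1 (u1 *m (x3.1 - x4.1)))
       + p.2 *m (x3.2 - x4.2 +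
          ((Om p.1 x3.1 - Om p.1 x4.1) *m p.2 - p.2 *m (Om p.1 x3.1 - Om p.1 x4.1)))).
  by rewrite J1E /= connection_TTD connection_TTN.
apply: injective_projections; first exact: etrans (fstE _ _ _ _) N1.
apply: (etrans (sndE _ _ _ _)).
have a2 v : v.2 = vertical p v - (Om p.1 v.1 *m p.2 - p.2 *m Om p.1 v.1).
  by rewrite /vertical addrK.
have Ja2 v : (J1 g i p v).2 = p.2 *m vertical p v
    - (Om p.1 (u1 *m v.1) *m p.2 - p.2 *m Om p.1 (u1 *m v.1)).
  by rewrite J1_snd addrC.
have FE X Y : diag_dual (K X Y) = diag_dual (dconnection p.1 X Y)
    - diag_dual (dconnection p.1 Y X)
    + (Om p.1 X *m Om p.1 Y - Om p.1 Y *m Om p.1 X).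
  rewrite /K -(dconnection_curvature X Y Up) !diag_dualD !diag_dualN.
  by rewrite -diag_dual_com diag_dualD diag_dualN.
rewrite /F1 /F2 (diag_dualD (K _ _)) (diag_dualD (K _ _)) diag_dualN !FE.
(* The horizontal component vanishes, hence so does its connection form; this disposes of the terms
   with the derivatives of [u1]. *)
have OmN : Om p.1 (DJ1 p (J1 g i p a) b).1 - Om p.1 (DJ1 p (J1 g i p b) a).1
    + Om p.1 (u1 *m ((DJ1 p b a).1 - (DJ1 p a b).1)) = 0.
  have OmD3 x1 x2 x3 : x1 - x2 + x3 = 0 -> Om p.1 x1 - Om p.1 x2 + Om p.1 x3 = 0.
    move=> H; have -> : x3 = x2 - x1.
      by apply: (addrI (x1 - x2)); rewrite H addrA subrK subrr.
    by rewrite connection_TTD connection_TTN addrA subrK subrr.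
  exact: OmD3 N1.
have h1 := DJ1_snd p (J1 g i p a) b; rewrite (Ja2 a) (J1_fst p a) in h1.
have h2 := DJ1_snd p (J1 g i p b) a; rewrite (Ja2 b) (J1_fst p b) in h2.
have h3 := DJ1_snd p b a; rewrite (a2 b) in h3.
have h4 := DJ1_snd p a b; rewrite (a2 a) in h4.
exact: (nijenhuis_vertical uu OmN h1 h2 h3 h4).
Qed.

(** The isometries transporting u along a coordinate line have derivative -w at 0, where w is the
    connection form of X; conjugation by them therefore has as derivative minus the bracket with the
    connection form, as in [hlift]. *)
Lemma tangent_hlift e1 e2 (p : twistor_coord R) (X : 'cV[R]_4) :
  twistor_component g i e1 e2 p ->
  tangent (twistor_component g i e1 e2) p (hlift g i p X).
Proof.
case: p => x u [/= Ux Zu].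
pose w := connection_form G x X.
pose xt (t : R) := t *: X + x.
have xt0 : xt 0 = x by rewrite /xt scale0r add0r.
have dxt : is_derive (0 : R) 1 xt X.
  have dt : is_derive (0 : R) 1 (fun t : R => t *: X) X.
    apply: is_derive_eq.
      exact: is_derive_scalemx (is_derive_id _ _) (is_derive_cst X _ _).
    by rewrite scaler0 addr0 scale1r.
  have := is_deriveD dt (@is_derive_cst R R 'cV[R]_4 x 0 1).
  by rewrite addr0.
have Uxt : \forall t \near (0 : R), U (xt t).
  have cxt : {for (0 : R), continuous xt}.
    apply/differentiable_continuous/derivable1_diffP; exact: ex_derive.
  by apply: cxt; rewrite xt0; exact: (near_open openU Ux).
have dG : differentiable G (xt 0) by rewrite xt0; exact: (@differentiable_g _ G U smoothG x Ux).
have dgt : is_derive (0 : R) 1 (fun t => G (xt t))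
    (G (xt 0) *m w + w^T *m G (xt 0)).
  apply: is_derive_eq (is_derive_comp_curve dxt dG) _; rewrite xt0.
  exact: (derive_g openU smoothG symG unitG X Ux).
have symgt : \forall t \near (0 : R), (G (xt t))^T = G (xt t).
  by apply: filterS Uxt => t /symG.
have posgt Y : Y != 0 -> 0 < bilin (G (xt 0)) Y Y by rewrite xt0; exact: posG.
have [P [P0 dP HP]] := isometric_curve symgt posgt dgt.
rewrite xt0 in dgt HP.
(* The inverse of the isometry [P t], written as its adjoint so that its derivative follows from the
   product rule. *)
pose Q t := invmx (G x) *m (P t)^T *m G (xt t).
have Q0 : Q 0 = 1%:M by rewrite /Q P0 trmx1 mulmx1 xt0 mulVmx ?unitG.
have dQ : is_derive (0 : R) 1 Q w.
  apply: is_derive_eq.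
    exact: is_derive_mulmx (is_derive_mulmx (is_derive_cst (invmx (G x)) _ _)
      (is_derive_trmx dP)) dgt.
  rewrite /= P0 xt0 trmx1 mul0mx add0r mulmx1 linearN /= mulmxN mulNmx mulmxDr.
  by rewrite !mulmxA mulVmx ?unitG // mul1mx addrCA addNr addr0.
pose T t := transport (P t) (Q t).
pose Ti t := transport_inv (P t) (Q t).
have d0 : is_derive (0 : R) 1 (fun _ : R => 0 : 'M[R]_4) 0 by exact: is_derive_cst.
have dT := is_derive_block_mx dP d0 d0 (is_derive_trmx dQ).
have dTi := is_derive_block_mx dQ d0 d0 (is_derive_trmx dP).
have T0 : T 0 = 1%:M by rewrite /T /transport P0 Q0 trmx1 -scalar_mx_block.
have Ti0 : Ti 0 = 1%:M by rewrite /Ti /transport_inv P0 Q0 trmx1 -scalar_mx_block.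
exists (fun t => (xt t, T t *m u *m Ti t)); split.
- by rewrite xt0 T0 Ti0 mul1mx mulmx1.
- apply: filterS2 Uxt HP => t Ut [PG dPt]; split; first exact: Ut.
  apply: (twistor_component_transport (unitG Ux) (unitG Ut) _ dPt PG Zu).
  by rewrite /Q -!mulmxA [_^T *m _]mulmxA PG mulVmx ?unitG.
- apply: is_derive_pair => //.
  have du := is_derive_mulmx (is_derive_mulmx dT (is_derive_cst u _ _)) dTi.
  apply: is_derive_eq du _.
  have EN : block_mx (- w) 0 0 w^T = - diag_dual w :> 'M[R]_(4 + 4).
    by rewrite /diag_dual opp_block_mx !oppr0 opprK.
  have EP : block_mx w 0 0 (- w)^T = diag_dual w :> 'M[R]_(4 + 4).
    by rewrite /diag_dual linearN.
  rewrite EN EP /= -/(transport _ _) -/(transport_inv _ _) -/(T 0) -/(Ti 0) T0 Ti0.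
  rewrite mulmx0 addr0 mulmx1 mul1mx /ad_connection /= opprB addrC mulNmx.
  by rewrite /connection_form_TT.
Qed.

Lemma open_domain : open [set q : twistor_coord R | U q.1].
Proof.
by apply: (open_comp _ openU) => q _; exact: cvg_fst.
Qed.

Lemma hlift_vector_field e1 e2 (X : 'cV[R]_4) :
  vector_field (twistor_component g i e1 e2) [set q | U q.1] (fun q => hlift g i q X).
Proof.
split; last by move=> p [Zp _]; exact: tangent_hlift.
apply/smooth_onP => n; have oW := open_domain.
apply: ndiff_pair => //; first exact: (ndiff_cst _ n X).
have hO : ndiff n [set q : twistor_coord R | U q.1]
    (fun q => diag_dual (connection_form G q.1 X)).
  apply: ndiff_diag_dual => //.
  apply: (@ndiff_fst_comp R _ _ _ U n (fun x => connection_form G x X)).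
  apply/(ndiff_mxP openU) => a b.
  apply: (@ndiff_eq _ _ _ _ openU _ (fun x => \sum_k X k 0 * christoffel G k x a b)).
    by move=> x _; rewrite /connection_form summxE; apply: eq_bigr => k _; rewrite [RHS]mxE.
  apply: ndiff_sum => // k; apply: ndiffM => //; first exact: ndiff_cst.
  have := ndiff_christoffel openU smoothG unitG n k.
  by move/(ndiff_mxP openU); apply.
have hu : ndiff n [set q : twistor_coord R | U q.1] (fun q => q.2).
  apply: (@ndiff_sub _ _ _ _ [set q : twistor_coord R | [set: 'M[R]_(4 + 4)] q.2]) => //.
  exact: (@ndiff_snd_comp R _ _ _ setT n id (ndiff_id _ n)).
apply: ndiff_oppmx => //; apply: ndiffD => //; first exact: ndiff_mulmx.
by apply: ndiff_oppmx => //; exact: ndiff_mulmx.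
Qed.

(** The relation expressing that an endomorphism maps C^+ to itself is differentiated along a curve
    of twistors; metric compatibility turns the derivative of the metric into the commutator
    contained in [vertical]. *)
Lemma tangent_preserves e1 e2 p a : twistor_component g i e1 e2 p ->
  tangent (twistor_component g i e1 e2) p a ->
  preserves (G p.1) Plus (vertical p a).
Proof.
move=> [Up [Zu _ _]] [c [c0 Zc dc]]; subst p.
have d1 := is_derive_fst dc; have d2 := is_derive_snd dc.
set G' := 'D_a.1 G (c 0).1.
have dG : is_derive (0 : R) 1 (fun t => G (c t).1) G'.
  apply: is_derive_comp_curve d1 _; exact: (@differentiable_g _ G U smoothG).
(* The defect of [preserves] for the sign [Plus], which is identically zero near 0. *)
pose H t := dlsubmx (c t).2 + (drsubmx (c t).2 *m G (c t).1
  - G (c t).1 *m (ulsubmx (c t).2 + ursubmx (c t).2 *m G (c t).1)).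
have dH : is_derive (0 : R) 1 H (dlsubmx a.2 +
    (drsubmx a.2 *m G (c 0).1 + drsubmx (c 0).2 *m G' -
      (G' *m (ulsubmx (c 0).2 + ursubmx (c 0).2 *m G (c 0).1) +
       G (c 0).1 *m (ulsubmx a.2 + (ursubmx a.2 *m G (c 0).1 + ursubmx (c 0).2 *m G'))))).
  exact: (is_deriveD (is_derive_dlsubmx d2)
    (is_deriveB (is_derive_mulmx (is_derive_drsubmx d2) dG)
      (is_derive_mulmx dG (is_deriveD (is_derive_ulsubmx d2)
         (is_derive_mulmx (is_derive_ursubmx d2) dG))))).
have H0 : \forall t \near (0 : R), (cst 0 : R -> 'M[R]_4) t = H t.
  apply: filterS Zc => t [Ut [Zt _ _]].
  have := twistor_fibre_preserves Plus (unitG Ut) Zt.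
  by rewrite /preserves /= !scale1r blockCE /= scale1r /H /cst addrA => ->; rewrite subrr.
have dH0 : is_derive (0 : R) 1 H 0.
  by apply: near_eq_is_derive H0 _; exact: is_derive_cst.
have E := etrans (esym (@derive_val _ _ _ _ _ _ _ dH)) (@derive_val _ _ _ _ _ _ _ dH0).
apply: preserves_derivative; first exact: twistor_fibre_preserves (unitG Up) Zu.
rewrite -(derive_g openU smoothG symG unitG a.1 Up) -/G' !blockCE /= !scale1r.
by move/eqP: E; rewrite addrA subr_eq0 => /eqP ->; rewrite addrA.
Qed.

(** Along a vertical direction the metric is constant and [blockC] is linear in the endomorphism. *)
Lemma derive_pr_minus p (N : 'M[R]_(4 + 4)) : U p.1 ->
  'D_((0, N) : twistor_coord R) (pr_minus g i) p = (0, blockC (G p.1) Minus N).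
Proof.
move=> Up.
have d1 := is_derive_fst (is_derive_id p ((0, N) : twistor_coord R)).
have d2 := is_derive_blockC Minus ((0, N) : twistor_coord R) Up.
have := is_derive_pair d1 d2; rewrite /= derive0 mulmx0 scaler0 addr0.
by move=> h; exact: (@derive_val _ _ _ _ _ _ _ h).
Qed.

Lemma derive_pr_minus_nijenhuis e1 e2 W V1 V2 p
    (u1 := blockC (G p.1) Plus p.2) (u2 := blockC (G p.1) Minus p.2)
    (K := Rm (chart_curvature p.1)) :
  vector_field (twistor_component g i e1 e2) W V1 ->
  vector_field (twistor_component g i e1 e2) W V2 ->
  (twistor_component g i e1 e2 `&` W) p ->
  'D_(nijenhuis (J1 g i) V1 V2 p) (pr_minus g i) p = 0 <->
  curv_cond K u1 u2 (V1 p).1 (V2 p).1.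
Proof.
move=> [s1 t1] [s2 t2] [Zp Wp].
have [Up [Zu /ZfibreP [_ u1u1 _] /ZfibreP [_ u2u2 _]]] := Zp.
have /twistor_fibreP [_ _ uu] := Zu.
have d1 : differentiable V1 p := s1 [::] p Wp.
have d2 : differentiable V2 p := s2 [::] p Wp.
have pa := tangent_preserves Zp (t1 p (conj Zp Wp)).
have pb := tangent_preserves Zp (t2 p (conj Zp Wp)).
rewrite (nijenhuis_J1 Up uu u1u1 d1 d2 pa pb) derive_pr_minus //.
set F1 := diag_dual _; set F2 := diag_dual _.
have pu := twistor_fibre_preserves Minus (unitG Up) Zu.
have skewK X Y : G p.1 *m K X Y + (K X Y)^T *m G p.1 = 0.
  apply: Rm_skew => k l; exact: (curvature_skew openU smoothG symG unitG k l Up).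
(* Skewness of R1 and R2, with c = -1 and c = 1: it removes the correction terms of
   [blockC_bracket], so that restriction to C^- turns the brackets with u into brackets with
   [u2]. *)
have skewB (r r' : 'M[R]_4) c : G p.1 *m r + r^T *m G p.1 = 0 ->
    G p.1 *m r' + r'^T *m G p.1 = 0 ->
    G p.1 *m (r + c *: r') + (r + c *: r')^T *m G p.1 = 0.
  move=> h1 h2; have -> : (r + c *: r')^T = r^T + c *: r'^T.
    by apply/matrixP => k l; rewrite !mxE.
  rewrite mulmxDr mulmxDl addrACA h1 add0r.
  by rewrite -scalemxAr -scalemxAl -scalerDr h2 scaler0.
have skew1 := skewB _ _ (-1) (skewK (u1 *m (V1 p).1) (u1 *m (V2 p).1))
   (skewK (V1 p).1 (V2 p).1).
have skew2 := skewB _ _ 1 (skewK (u1 *m (V1 p).1) (V2 p).1)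
   (skewK (V1 p).1 (u1 *m (V2 p).1)).
rewrite scaleN1r in skew1; rewrite scale1r in skew2.
rewrite blockCD blockCN (blockC_mul _ (preserves_bracket skew2 pu)).
rewrite !blockC_bracket skew1 skew2 !mulmx0 !scaler0 !addr0 -/u2 /curv_cond -/K.
split=> [/(congr1 snd) /= /eqP|->]; first by rewrite addrC subr_eq0 => /eqP ->.
by rewrite addNr.
Qed.

End Chart.

(** * Semi-integrability and the Einstein condition *)

Section Main.
Variables (R : realType) (M : topologicalType) (A : oriented_atlas R M).
Variable g : riemannian_metric A.

Lemma semi_integrable_einstein e1 e2 : sg R e2 = - sg R e1 ->
  semi_integrable g (J1 g) e1 e2 <-> einstein g.
Proof.
move=> se.
have key i x : codom_chart i x ->
    (forall u1 u2 X Y, Zfibre (gmx g i x) e1 u1 -> Zfibre (gmx g i x) e2 u2 ->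
       curv_cond (Rm (chart_curvature g i x)) u1 u2 X Y)
    <-> tracefree_ricci (gmx g i) x = 0.
  move=> Ux; have openU := @codom_open _ _ A i.
  have unitG y : codom_chart i y -> gmx g i y \in unitmx.
    by move=> Uy; apply: posdef_unit => X; exact: gmx_pos.
  have symG y : codom_chart i y -> (gmx g i y)^T = gmx g i y by exact: gmx_sym.
  apply: curv_cond_einstein => //.
  - exact: symG.
  - by move=> X; exact: gmx_pos.
  - by move=> k l; exact: curvature_antisym.
  - by move=> k l; exact: (curvature_skew openU (@gmx_smooth _ _ _ g i) symG unitG k l Ux).
  - by move=> j k l m; exact: (bianchi openU (@gmx_smooth _ _ _ g i) symG unitG j k l m Ux).
split=> [H i x Ux|H i W V1 V2 Z oW hV1 hV2 p ZWp].
  apply/key => // u1 u2 X Y z1 z2.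
  have unitG : gmx g i x \in unitmx by apply: posdef_unit => X'; exact: gmx_pos.
  move: (z1) (z2) => /ZfibreP [ug1 uu1 _] /ZfibreP [ug2 uu2 _].
  (* Every pair (u1, u2) of the prescribed signs is realised by a twistor over [x]. *)
  pose p : twistor_coord R := (x, of_blocks (gmx g i x) u1 u2).
  have Zp : twistor_component g i e1 e2 p.
    split=> //=; split.
    - exact: twistor_fibre_of_blocks (gmx_sym _ Ux) ug1 ug2 uu1 uu2.
    - by rewrite blockC_of_blocks.
    - by rewrite blockC_of_blocks.
  have hX := hlift_vector_field g i e1 e2 X; have hY := hlift_vector_field g i e1 e2 Y.
  have := H i _ _ _ (@open_domain R M A i) hX hY p (conj Zp Ux).
  move/(derive_pr_minus_nijenhuis hX hY (conj Zp Ux)).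
  by rewrite /= !blockC_of_blocks.
apply/(derive_pr_minus_nijenhuis hV1 hV2 ZWp).
have [[Up [_ z1 z2]] _] := ZWp.
exact: (key _ _ Up).2 (H i _ Up) _ _ _ _ z1 z2.
Qed.

End Main.

Theorem proposition5 (R : realType) (M : topologicalType)
    (hausdorffM : hausdorff_space M) (countableM : @second_countable M)
    (connectedM : connected [set: M])
    (A : oriented_atlas R M) (g : riemannian_metric A) :
  (semi_integrable g (J1 g) Plus Minus <-> einstein g) /\
  (semi_integrable g (J1 g) Minus Plus <-> einstein g).
Proof.
by split; apply: semi_integrable_einstein; rewrite /= ?opprK.
Qed.
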